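(* Let $X,U,Y$ be complex Banach spaces, let $A$ generate a uniformly exponentially stable strongly continuous semigroup $\{e^{tA}\}_{t\ge0}$ on $X$, and let $B\in\mathcal L(U,X)$, $C\in\mathcal L(X,Y)$. Then for every $1\le p<\infty$, $$\frac{1}{\|\mathbb L\|_{\mathcal L(L^p)}}\le r_{stab}(\{e^{tA}\},B,C)\le\frac{1}{\sup_{s\in\mathbb R}\|C(A-is)^{-1}B\|}.$$
   Context: $\mathbb R_+=[0,\infty)$; $1/0:=\infty$. The input-output operator is $(\mathbb Lu)(t)=C\int_0^te^{(t-\tau)A}Bu(\tau)\,d\tau$, and $\|\mathbb L\|_{\mathcal L(L^p)}$ is its norm as an operator from $L^p(\mathbb R_+,U)$ to $L^p(\mathbb R_+,Y)$. $L^\infty(\mathbb R_+,\mathcal L_s(Y,U))$ is the set of (essentially) bounded functions $\Delta:\mathbb R_+\to\mathcal L(Y,U)$ such that $t\mapsto\Delta(t)y$ is strongly measurable for each $y\in Y$; $\|\Delta(\cdot)\|_\infty=\operatorname{ess\,sup}_{t\in\mathbb R_+}\|\Delta(t)\|$. For such $\Delta$, $\mathcal U_\Delta=\{U_\Delta(t,s)\}_{t\ge s\ge0}$ is the unique evolution family on $X$ (i.e. $U_\Delta(t,\tau)=U_\Delta(t,s)U_\Delta(s,\tau)$, $U_\Delta(t,t)=I$ for $t\ge s\ge\tau\ge 0$, and $(t,\tau)\mapsto U_\Delta(t,\tau)x$ continuous for each $x$) satisfying $$U_\Delta(t,s)x=e^{(t-s)A}x+\int_s^te^{(t-\tau)A}B\Delta(\tau)C\,U_\Delta(\tau,s)x\,d\tau,\qquad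 x\in X,\ t\ge s\ge0.$$ It is exponentially stable if there are $M\ge1$, $\omega<0$ with $\|U_\Delta(t,s)\|\le Me^{\omega(t-s)}$ for $t\ge s\ge0$. The stability radius is $$r_{stab}(\{e^{tA}\},B,C)=\sup\{r\ge0:\ \|\Delta(\cdot)\|_\infty\le r\Rightarrow\mathcal U_\Delta\text{ is exponentially stable}\},$$ where $\Delta$ ranges over $L^\infty(\mathbb R_+,\mathcal L_s(Y,U))$. *)

(* Defs.v *)
From HB Require Import structures.
From mathcomp Require Import all_boot all_order all_algebra.
From mathcomp Require Import complex.
From mathcomp Require Import all_classical all_reals all_analysis.
From mathcomp Require Import ess_sup_inf hoelder.

Set Implicit Arguments.
Unset Strict Implicit.
Unset Printing Implicit Defensive.

Import Order.TTheory GRing.Theory Num.Theory.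
Import numFieldNormedType.Exports.

Local Open Scope classical_set_scope.
Local Open Scope ring_scope.
Local Open Scope complex_scope.

(* Complex Banach spaces are [completeNormedModType R[i]]; their norm takes
   values in R[i] (with zero imaginary part), [rnorm] is its real version. *)
Definition rnorm {R : realType} {V : normedModType R[i]} (x : V) : R :=
  complex.Re `|x|.

Definition opnorm {R : realType} {V W : normedModType R[i]} (f : V -> W)
  : \bar R :=
  ereal_sup [set (rnorm (f x))%:E | x in [set x : V | rnorm x <= 1]].

Section bochner.
Context {R : realType} {V : completeNormedModType R[i]}.
Local Notation mu := (@lebesgue_measure R).

Definition simple_fun (g : R -> V) : Prop :=
  finite_set (range g) /\ forall v, measurable (g @^-1` [set v]).

(* [lebesgue_measure] lives on the Borel sets, but [\ae] allows any subset of a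
   Borel null set as exceptional set, so this is strong Lebesgue
   measurability. *)
Definition strongly_measurable (D : set R) (f : R -> V) : Prop :=
  exists g : nat -> R -> V, (forall n, simple_fun (g n)) /\
    \forall t \ae mu, D t -> g n t @[n --> \oo] --> f t.

Definition simple_integrable (D : set R) (g : R -> V) : Prop :=
  simple_fun g /\
  forall v, v != 0 -> (mu (D `&` g @^-1` [set v]) < +oo)%E.

Definition simple_integral (D : set R) (g : R -> V) : V :=
  \sum_(v \in [set: V]) (fine (mu (D `&` g @^-1` [set v])))%:C *: v.

Definition is_bochner_integral (D : set R) (f : R -> V) (v : V) : Prop :=
  strongly_measurable D f /\
  exists g : nat -> R -> V,
    [/\ forall n, simple_integrable D (g n),
        (\int[mu]_(t in D) (rnorm (f t - g n t))%:E)%E @[n --> \oo] --> 0%E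
      & simple_integral D (g n) @[n --> \oo] --> v].

Definition bochner_integrable (D : set R) (f : R -> V) : Prop :=
  exists v, is_bochner_integral D f v.

Definition bochner_integral (D : set R) (f : R -> V) : V :=
  xget 0 [set v | is_bochner_integral D f v].

End bochner.

Section lebesgue_spaces.
Context {R : realType}.
Local Notation mu := (@lebesgue_measure R).
Local Notation Rplus := (`[0, +oo[%classic : set R).

Definition Lpnorm {V : completeNormedModType R[i]} (p : R) (f : R -> V)
  : \bar R :=
  ('N[mu]_p%:E[(fun t => (rnorm (f t))%:E) \_ Rplus])%E.

Definition Lp_opnorm {V W : completeNormedModType R[i]} (p : R)
    (F : (R -> V) -> (R -> W)) : \bar R :=
  ereal_sup [set Lpnorm p (F u) | u in
    [set u : R -> V | strongly_measurable Rplus u /\ (Lpnorm p u <= 1)%E]].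

Definition Linfnorm {V W : completeNormedModType R[i]}
    (Delta : R -> V -> W) : \bar R :=
  ess_sup mu ((fun t => opnorm (Delta t)) \_ Rplus).

(* The class L^oo(R_+, L_s(V, W)); values at negative times are irrelevant. *)
Definition Linf_s {V W : completeNormedModType R[i]}
    (Delta : R -> {linear V -> W}) : Prop :=
  [/\ forall t, 0 <= t -> continuous (Delta t),
      forall y, strongly_measurable Rplus (fun t => Delta t y)
    & (Linfnorm Delta < +oo)%E].

End lebesgue_spaces.

Section semigroups.
Context {R : realType} {X : completeNormedModType R[i]}.
Implicit Types (T : R -> {linear X -> X}) (W : R -> R -> {linear X -> X}).

(* Only the values T t with t >= 0 and W t s with t >= s >= 0 are relevant. *)
Definition C0_semigroup T : Prop :=
  [/\ forall t, 0 <= t -> continuous (T t),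
      forall x, T 0 x = x,
      forall t s x, 0 <= t -> 0 <= s -> T (t + s) x = T t (T s x)
    & forall x, T h x @[h --> 0^'+] --> x].

Definition is_generator T (DA : set X) (A : X -> X) : Prop :=
  (forall x, DA x <-> cvg ((h^-1)%:C *: (T h x - x) @[h --> (0 : R)^'+])) /\
  (forall x, DA x -> (h^-1)%:C *: (T h x - x) @[h --> (0 : R)^'+] --> A x).

Definition exp_stable_semigroup T : Prop :=
  exists M w : R, [/\ 1 <= M, w < 0 &
    forall t, 0 <= t -> (opnorm (T t) <= (M * expR (w * t))%:E)%E].

(* Inverse of the operator A - z with domain DA. *)
Definition inv_shift (DA : set X) (A : X -> X) (z : R[i]) (y : X) : X :=
  xget 0 [set x | DA x /\ A x - z *: x = y].

Definition evolution_family W : Prop :=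
  [/\ forall t s, 0 <= s -> s <= t -> continuous (W t s),
      forall t x, 0 <= t -> W t t x = x,
      forall t s r x, 0 <= r -> r <= s -> s <= t ->
        W t r x = W t s (W s r x)
    & forall x, {within [set ts : R * R | 0 <= ts.2 /\ ts.2 <= ts.1],
        continuous (fun ts : R * R => W ts.1 ts.2 x)}].

Definition exp_stable_family W : Prop :=
  exists M w : R, [/\ 1 <= M, w < 0 &
    forall t s, 0 <= s -> s <= t ->
      (opnorm (W t s) <= (M * expR (w * (t - s)))%:E)%E].

End semigroups.

Section control_system.
Context {R : realType} {X U Y : completeNormedModType R[i]}.
Variables (T : R -> {linear X -> X}) (B : U -> X) (C : X -> Y).

Definition io_operator (u : R -> U) (t : R) : Y :=
  C (bochner_integral `[0, t] (fun tau => T (t - tau) (B (u tau)))).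

(* W is the perturbed evolution family U_Delta. *)
Definition perturbed_family (Delta : R -> {linear Y -> U})
    (W : R -> R -> {linear X -> X}) : Prop :=
  evolution_family W /\
  forall x t s, 0 <= s -> s <= t ->
    let f tau := T (t - tau) (B (Delta tau (C (W tau s x)))) in
    bochner_integrable `[s, t] f /\
    W t s x = T (t - s) x + bochner_integral `[s, t] f.

(* U_Delta exists and is unique on t >= s >= 0, so quantifying over all W
   satisfying its defining conditions amounts to speaking of U_Delta. *)
Definition r_stab : \bar R :=
  ereal_sup [set r%:E | r in [set r : R | 0 <= r /\
    forall Delta, Linf_s Delta -> (Linfnorm Delta <= r%:E)%E ->
    forall W, perturbed_family Delta W -> exp_stable_family W]].

End control_system.

(* Main.v *)
(** Lower bound. If [r * ||L|| < 1], the output [y t = C (W t s x)] on [s, N]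
    solves [y = C T x + L (Delta y)], so Minkowski's inequality bounds its L^p
    norm by that of the free output over [1 - r * ||L||], uniformly in [s] and
    [N].  A long interval therefore contains a cell on which [y] is small in
    L^p; there the perturbed orbit is close to the exponentially decaying free
    one, and since the family is bounded it contracts by 1/2 over a fixed time,
    which is exponential stability.

    Upper bound. If [A x - i om x = B u] with [rnorm u <= 1] and
    [r * rnorm (C x) > 1], Hahn-Banach yields a constant feedback of norm at
    most [r] sending [C x] to [- u].  For it [x] is an eigenvector of
    [A + B Delta C] for [i om], so [rnorm (W t 0 x) = rnorm x] for all [t] and
    the family is not exponentially stable.  That family exists as the fixed
    point of a Volterra equation, whose integrals may be taken as limits of
    Riemann sums. *)

Require Import Defs.
From HB Require Import structures.
From mathcomp Require Import all_boot all_order all_algebra.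
From mathcomp Require Import finmap complex.
From mathcomp Require Import all_classical all_reals all_analysis.
From mathcomp Require Import ess_sup_inf hoelder measurable_realfun.
From mathcomp Require Import ring lra.
Import Order.TTheory GRing.Theory Num.Theory.
Import numFieldNormedType.Exports.
Set Implicit Arguments.
Unset Strict Implicit.
Unset Printing Implicit Defensive.
Local Open Scope classical_set_scope.
Local Open Scope ring_scope.
Local Open Scope complex_scope.

(** * Real-valued norms and bounded operators *)

(** A priori the perturbed output may have infinite L^p norm, so absorbing the term [r * ||L||] is
    legitimate only on finite segments, where continuity makes the norm finite; causality of the
    input-output operator allows the input to be cut off at [N]. The resulting bound concerns
    [C (W t s x)], not the state. It reaches the state because the feedback sees the state only
    through the output: in Duhamel's formula the integral term is governed by the output alone. This
    by itself gives boundedness; decay has to come from the free semigroup, hence the search for a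
    cell where the output is negligible.

    In the upper bound, membership in the domain of the generator is a statement about the right
    derivative of [T h x] at 0. The orbit [exp (i om t) x] is therefore compared with Duhamel's
    formula one step of length [h] at a time: the error of a step is o(h), and the [t / h] steps up
    to time [t] accumulate only o(1). Existence, uniqueness and the semigroup law of the perturbed
    orbits all rest on one exponentially weighted norm in which the Volterra map contracts by
    1/2. *)

Section real_norm.
Context {R : realType} {V : normedModType R[i]}.
Implicit Types x y : V.

Lemma complex_ge0E (z : R[i]) : 0 <= z -> z = (complex.Re z)%:C.
Proof. by move=> z0; rewrite RRe_real// ger0_real. Qed.

Lemma normcE x : `|x| = (rnorm x)%:C.
Proof. exact: complex_ge0E. Qed.

Lemma rnorm_ge0 x : 0 <= rnorm x.
Proof. by move: (normr_ge0 x); rewrite normcE lecE => /andP[]. Qed.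

Lemma rnorm0 : rnorm (0 : V) = 0.
Proof. by rewrite /rnorm normr0. Qed.

Lemma rnormN x : rnorm (- x) = rnorm x.
Proof. by rewrite /rnorm normrN. Qed.

Lemma rnorm_distC x y : rnorm (x - y) = rnorm (y - x).
Proof. by rewrite /rnorm distrC. Qed.

Lemma rnormD x y : rnorm (x + y) <= rnorm x + rnorm y.
Proof. by rewrite -lecR rmorphD /= -!normcE ler_normD. Qed.

Lemma rnormB x y : rnorm (x - y) <= rnorm x + rnorm y.
Proof. by rewrite -(rnormN y) rnormD. Qed.

Lemma rnorm_dist x y : `|rnorm x - rnorm y| <= rnorm (x - y).
Proof.
have h (a b : V) : rnorm a - rnorm b <= rnorm (a - b).
  by rewrite lerBlDr -{1}(subrK b a) rnormD.
by rewrite ler_norml h andbT lerNl opprB rnorm_distC h.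
Qed.

Lemma rnorm_triangle z x y : rnorm (x - y) <= rnorm (x - z) + rnorm (z - y).
Proof. by rewrite -{1}(subrK z x) -addrA rnormD. Qed.

Lemma rnorm_eq0 x : rnorm x = 0 -> x = 0.
Proof. by move=> x0; apply: normr0_eq0; rewrite normcE x0. Qed.

Lemma rnormZ (a : R[i]) x : rnorm (a *: x) = complex.Re `|a| * rnorm x.
Proof.
have := normrZ a x.
by rewrite !normcE [X in X * _](complex_ge0E (normr_ge0 a)) -rmorphM => -[].
Qed.

Lemma rnormZr (a : R) x : rnorm (a%:C *: x) = `|a| * rnorm x.
Proof. by rewrite rnormZ normc_def /= expr0n addr0 sqrtr_sqr. Qed.

Lemma rnorm_sum (I : Type) (r : seq I) (P : pred I) (F : I -> V) :
  rnorm (\sum_(i <- r | P i) F i) <= \sum_(i <- r | P i) rnorm (F i).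
Proof.
elim/big_ind2: _ => //; first by rewrite rnorm0.
by move=> x a y b xa yb; rewrite (le_trans (rnormD _ _))// lerD.
Qed.

(** Neighbourhoods in [V] have radii in [R[i]]; a positive radius there is real, so all later limits
    can be run with a real [e]. *)
Lemma cvg_rnormP (S : Type) (F : set_system S) (FF : Filter F) (f : S -> V) l :
  f x @[x --> F] --> l <->
  forall e : R, 0 < e -> \forall x \near F, rnorm (f x - l) < e.
Proof.
rewrite cvgrPdistC_lt; split=> [h e e0|h e].
  have /h : 0 < e%:C by rewrite ltcR.
  by apply: filterS => x; rewrite normcE ltcR.
move=> e0; have eE := complex_ge0E (ltW e0).
move: (e0); rewrite eE ltcR => /h; apply: filterS => x.
by rewrite normcE ltcR.
Qed.

Lemma cvg_rnorm (S : Type) (F : set_system S) (FF : Filter F) (f : S -> V) l :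
  f x @[x --> F] --> l -> rnorm (f x) @[x --> F] --> rnorm l.
Proof.
move/cvg_rnormP => h; apply/cvgrPdistC_lt => e /h; apply: filterS => x.
exact/le_lt_trans/rnorm_dist.
Qed.

Lemma cvg_real_complex (S : Type) (F : set_system S) (FF : Filter F)
  (a : S -> R) (b : R) (x : V) : a s @[s --> F] --> b ->
  (a s)%:C *: x @[s --> F] --> b%:C *: x.
Proof.
move=> ab; apply/cvg_rnormP => e e0.
have k0 : 0 < e / (rnorm x + 1) by rewrite divr_gt0// ltr_wpDl// rnorm_ge0.
move/cvgrPdistC_lt : ab => /(_ _ k0); apply: filterS => s h.
rewrite -scalerBl -rmorphB rnormZr.
have x1 : 0 < rnorm x + 1 by rewrite ltr_wpDl// rnorm_ge0.
rewrite ltr_pdivlMr// in h; apply: le_lt_trans h.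
by rewrite ler_wpM2l// lerDl.
Qed.

Lemma rnorm_small_eq0 x : (forall e : R, 0 < e -> rnorm x <= e) -> x = 0.
Proof.
move=> h; apply: rnorm_eq0; apply/le_anti; rewrite rnorm_ge0 andbT.
by apply/ler_addgt0Pl => e /h; rewrite addr0.
Qed.

End real_norm.

Lemma cvg_of_cauchy {R : realType} {V : completeNormedModType R[i]}
  (u : nat -> V) :
  (forall e : R, 0 < e -> exists N, forall n m, (N <= n)%N -> (N <= m)%N ->
     rnorm (u n - u m) < e) ->
  cvg (u n @[n --> \oo]).
Proof.
move=> h; apply/cauchy_cvgP/cauchyP => e e0.
have eE := complex_ge0E (ltW e0).
move: e0; rewrite eE ltcR => /h[N hN].
exists (u N), N => // n /= Nn; rewrite -ball_normE /= normcE ltcR.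
by apply: hN.
Qed.

Section bounded_linear.
Context {R : realType} {V W : normedModType R[i]}.

Lemma linear_rnorm_continuous (f : {linear V -> W}) (M : R) :
  (forall x, rnorm (f x) <= M * rnorm x) -> continuous f.
Proof.
move=> fM x; apply/cvg_rnormP => e e0.
have M1 : 0 < `|M| + 1 by rewrite ltr_wpDl.
have k0 : 0 < e / (`|M| + 1) by rewrite divr_gt0.
have /cvg_rnormP/(_ _ k0) : y @[y --> x] --> x by exact: cvg_id.
apply: filterS => y /= h; rewrite -linearB (le_lt_trans (fM _))//.
rewrite ltr_pdivlMr// in h; apply: le_lt_trans h.
rewrite mulrC ler_wpM2l ?rnorm_ge0//.
by rewrite (le_trans (ler_norm _))// lerDl.
Qed.

(** Boundedness provides every constant above some real [K]; choosing [|Re K| + 1] makes it strictly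
    positive, so that products of such constants stay positive. *)
Lemma linear_rnorm_bounded (f : {linear V -> W}) : continuous f ->
  exists2 M : R, 0 < M & forall x, rnorm (f x) <= M * rnorm x.
Proof.
move=> /linear_bounded_continuous/linear_boundedP[K [Kreal hK]].
exists (`|complex.Re K| + 1) => [|x]; first by rewrite ltr_wpDl.
have KE : K = (complex.Re K)%:C by rewrite RRe_real.
have /hK/(_ x) : K < (`|complex.Re K| + 1)%:C.
  by rewrite {1}KE ltcR (le_lt_trans (ler_norm _))// ltrDl.
by rewrite !normcE -rmorphM lecR.
Qed.

Lemma opnorm_le (f : {linear V -> W}) (M : R) : 0 <= M ->
  (opnorm f <= M%:E)%E <-> (forall x, rnorm (f x) <= M * rnorm x).
Proof.
move=> M0; split=> [h x|h].
  have [x0|x0] := eqVneq (rnorm x) 0.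
    by rewrite (rnorm_eq0 x0) linear0 !rnorm0 mulr0.
  have x_gt0 : 0 < rnorm x by rewrite lt_neqAle eq_sym x0 rnorm_ge0.
  have : ((rnorm (f ((rnorm x)^-1%:C *: x)))%:E <= opnorm f)%E.
    apply: ereal_sup_ubound; exists ((rnorm x)^-1%:C *: x) => //=.
    by rewrite rnormZr ger0_norm ?invr_ge0 ?rnorm_ge0// mulVf.
  move=> /le_trans/(_ h); rewrite lee_fin linearZ rnormZr.
  rewrite ger0_norm ?invr_ge0 ?rnorm_ge0// mulrC ler_pdivrMr//.
apply: ge_ereal_sup => _ [x /= x1 <-]; rewrite lee_fin (le_trans (h x))//.
by rewrite ler_piMr.
Qed.

End bounded_linear.

Lemma cvg_image {R : realType} (V W : normedModType R[i]) (F : V -> W)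
  (S : Type) (G : set_system S) (FG : Filter G) (f : S -> V) l :
  continuous F -> f x @[x --> G] --> l -> F (f x) @[x --> G] --> F l.
Proof. by move=> Fc c; exact: (@continuous_cvg _ _ _ _ _ f F l (Fc l) c). Qed.

(** * Simple functions *)

Section finite_valued.
Context {R : realType}.
Local Notation mu := (@lebesgue_measure R).

(** [simple_fun] with an arbitrary value type: grid indices, booleans and pairs of values then obey
    the same lemmas, and [simple_fun g] unfolds to [finite_valued g]. *)
Definition finite_valued {I : choiceType} (q : R -> I) : Prop :=
  finite_set (range q) /\ forall i, measurable (q @^-1` [set i]).

Definition values {I : choiceType} (q : R -> I) : {fset I} :=
  fset_set (range q).

Lemma in_values {I : choiceType} (q : R -> I) t :
  finite_valued q -> q t \in values q.
Proof. by case=> qf _; rewrite /values in_fset_set// inE; exists t. Qed.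

Lemma finite_valued_preimage {I : choiceType} (q : R -> I) (P : set I) :
  finite_valued q -> measurable (q @^-1` P).
Proof.
move=> [qf qm].
have -> : q @^-1` P = \bigcup_(i in range q `&` P) (q @^-1` [set i]).
  apply/seteqP; split=> [t Pt|t [i [_ Pi] /= qi]].
    by exists (q t) => //; split => //; exists t.
  by rewrite qi.
apply: fin_bigcup_measurable => //; exact: finite_setIl.
Qed.

Lemma finite_valued_comp {I J : choiceType} (F : I -> J) (q : R -> I) :
  finite_valued q -> finite_valued (F \o q).
Proof.
move=> hq; split=> [|j]; last exact: (finite_valued_preimage (F @^-1` [set j])).
apply: (sub_finite_set _ (finite_image F (proj1 hq))) => _ [t _ <-].
by exists (q t) => //; exists t.
Qed.

Lemma finite_valued_pair {I J : choiceType} (q : R -> I) (q' : R -> J) :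
  finite_valued q -> finite_valued q' -> finite_valued (fun t => (q t, q' t)).
Proof.
move=> [qf qm] [qf' qm']; split.
  apply: (@sub_finite_set _ _ (range q `*` range q')); last exact: finite_setX.
  by move=> _ [t _ <-]; split; exists t.
move=> [i j]; have -> : (fun t => (q t, q' t)) @^-1` [set (i, j)] =
    q @^-1` [set i] `&` q' @^-1` [set j].
  by apply/seteqP; split=> t /= [-> ->].
exact: measurableI.
Qed.

Lemma measurable_finite_valued {I : choiceType} d (T : measurableType d)
  (q : R -> I) (F : I -> T) D : finite_valued q ->
  measurable_fun D (fun t => F (q t)).
Proof.
move=> hq; apply: (@measurable_funS _ _ _ _ setT) => //.
move=> _ B mB; rewrite setTI.
exact: (finite_valued_preimage (F @^-1` B)).
Qed.

Variable D : set R.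
Hypothesis mD : measurable D.
Hypothesis fD : (mu D < +oo)%E.

Let mass (A : set R) : R := fine (mu (D `&` A)).

Lemma fin_num_muI (A : set R) : measurable A -> mu (D `&` A) \is a fin_num.
Proof.
move=> mA; rewrite ge0_fin_numE//; apply: le_lt_trans fD.
by apply: le_measure; rewrite ?inE//; exact: measurableI.
Qed.

(** The fibre of [F \o q] over [j] is the disjoint union of the fibres of [q] over the finitely many
    [i] with [F i = j]. *)
Lemma mass_comp {I J : choiceType} (F : I -> J) (q : R -> I) (j : J) :
  finite_valued q ->
  mass ((F \o q) @^-1` [set j]) =
  \sum_(i <- values q | F i == j) mass (q @^-1` [set i]).
Proof.
move=> hq; pose S := [fset i in values q | F i == j]%fset.
rewrite /mass.
have -> : D `&` (F \o q) @^-1` [set j] =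
    \big[setU/set0]_(i <- S) (D `&` q @^-1` [set i]).
  rewrite -bigcup_fset; apply/seteqP; split=> [t [Dt /= Fqt]|t [i /= iS [Dt ->]]].
    by exists (q t) => //=; rewrite !inE /= in_values//= Fqt.
  by split => //=; move: iS; rewrite !inE /= => /andP[_ /eqP].
have mDq i : measurable (D `&` q @^-1` [set i]).
  by apply: measurableI => //; case: hq.
rewrite measure_fbigsetU//=; last 2 first.
- by move=> i _; exact: mDq.
- by move=> i k _ _ [t [[_ /= <-] [_ /= <-]]].
rewrite -sum_fine; last by move=> i _; apply: fin_num_muI; case: hq.
by rewrite big_fset.
Qed.

Lemma integral_finite_valued {I : choiceType} (k : I -> R) (q : R -> I) :
  finite_valued q -> (forall i, 0 <= k i) ->
  (\int[mu]_(t in D) (k (q t))%:E)%E =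
  (\sum_(i <- values q) mass (q @^-1` [set i]) * k i)%:E.
Proof.
move=> hq k0.
have mq i : measurable (q @^-1` [set i]) by case: hq.
transitivity (\int[mu]_(t in D)
    \sum_(i <- values q) (k i * \1_(q @^-1` [set i]) t)%:E)%E.
  apply: eq_integral => t _; rewrite (bigD1_seq (q t))/= ?in_values ?fset_uniq//.
  rewrite indicE mem_set// mulr1 big1 ?adde0// => i iq.
  by rewrite indicE memNset ?mulr0// => /= /esym/eqP; apply/negP.
have mi i : measurable_fun D (fun t => (k i * \1_(q @^-1` [set i]) t)%:E).
  exact/measurable_EFinP/measurable_funM.
rewrite ge0_integral_sum//; last first.
- by move=> i t _; rewrite lee_fin mulr_ge0.
rewrite -sumEFin; apply: eq_bigr => i _.
have mi1 : measurable_fun D (fun x => (\1_(q @^-1` [set i]) x : R)%:E).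
  exact/measurable_EFinP.
transitivity ((k i)%:E * \int[mu]_(x in D) (\1_(q @^-1` [set i]) x)%:E)%E.
  under eq_integral do rewrite EFinM.
  by apply: ge0_integralZl_EFin => // x _; rewrite lee_fin.
transitivity ((k i)%:E * mu (q @^-1` [set i] `&` D))%E.
  by rewrite -(@integral_indic _ _ _ mu D mD _ (mq i)).
by rewrite setIC muleC EFinM fineK// fin_num_muI.
Qed.

Lemma mass_ge0 A : 0 <= mass A.
Proof. exact/fine_ge0. Qed.

Context {V : completeNormedModType R[i]}.

(** [simple_integral] groups points by their value, which hides additivity. Summing over the values
    of an index [q] instead lets several functions of the same [q], for instance of a pair, be
    integrated over one partition. *)
Lemma simple_integral_comp {I : choiceType} (F : I -> V) (q : R -> I) :
  finite_valued q ->
  simple_integral D (fun t => F (q t)) =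
  \sum_(i <- values q) (mass (q @^-1` [set i]))%:C *: F i.
Proof.
move=> hq; rewrite (partition_big_imfset _ F)/= /simple_integral.
rewrite (fsbigE (F @` values q)%fset)//=.
- rewrite big_mkcond/=; apply: eq_bigr => v _; rewrite in_setT.
  rewrite -/(mass _) (mass_comp F)// rmorph_sum scaler_suml.
  by apply: eq_bigr => i /eqP <-.
- move=> v _ vS; rewrite [X in mu X](_ : _ = set0) ?measure0 ?scale0r//.
  apply/seteqP; split => // t [_ /= tv]; move: vS; rewrite -tv => /imfsetP; apply.
  by exists (q t) => //=; exact: in_values.
Qed.

Lemma rnorm_simple_integral_comp {I : choiceType} (F : I -> V) (q : R -> I) :
  finite_valued q ->
  ((rnorm (simple_integral D (fun t => F (q t))))%:E <=
   \int[mu]_(t in D) (rnorm (F (q t)))%:E)%E.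
Proof.
move=> hq; rewrite (integral_finite_valued (k := fun i => rnorm (F i)))//; last first.
  by move=> i; exact: rnorm_ge0.
rewrite lee_fin simple_integral_comp//; apply: (le_trans (rnorm_sum _ _ _)).
by apply: ler_sum => i _; rewrite rnormZr ger0_norm// mass_ge0.
Qed.

End finite_valued.

(** * Bochner integral *)

Section lower_integral.
Import HBNNSimple.

(* The integral of a nonnegative function is a supremum over the simple
   functions below it, so no measurability of [f] and [g] is required. *)
Lemma le_integral_ae d (T : measurableType d) {R : realType}
  (mu : {measure set T -> \bar R}) (D : set T) (f g : T -> \bar R) :
  (forall t, D t -> 0 <= f t)%E -> (forall t, D t -> 0 <= g t)%E ->
  (\forall t \ae mu, D t -> (f t <= g t)%E) ->
  (\int[mu]_(t in D) f t <= \int[mu]_(t in D) g t)%E.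
Proof.
move=> f0 g0 [N [mN muN fgN]].
rewrite [X in (X <= _)%E]ge0_integralE// [X in (_ <= X)%E]ge0_integralE//.
apply: ge_ereal_sup => _ [h /= hf <-].
apply: ereal_sup_ubound => /=.
exists (proj_nnsfun h (measurableC mN)) => [t|].
  have -> : proj_nnsfun h (measurableC mN) t = h t * \1_(~` N) t by [].
  rewrite indicE; have [tN|tN] := pselect (N t).
    rewrite memNset ?mulr0; last by move=> /(_ tN).
    by rewrite patchE; case: ifPn => // /set_mem /g0.
  rewrite mem_set// mulr1; apply: (le_trans (hf t)).
  rewrite !patchE; case: ifPn => // /set_mem Dt.
  by apply: contrapT => h'; apply/tN/fgN => /= /(_ Dt).
rewrite -!integralT_nnsfun; apply: ae_eq_integral => //.
- exact/measurable_EFinP.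
- exact/measurable_EFinP.
exists N; split => // t /= ht; apply: contrapT => tN; apply: ht => _.
by rewrite mindicE mem_set// mulr1.
Qed.

End lower_integral.

Lemma eq_integral_ae d (T : measurableType d) {R : realType}
  (mu : {measure set T -> \bar R}) (D : set T) (f g : T -> \bar R) :
  (forall t, D t -> 0 <= f t)%E -> (forall t, D t -> 0 <= g t)%E ->
  (\forall t \ae mu, D t -> f t = g t) ->
  (\int[mu]_(t in D) f t = \int[mu]_(t in D) g t)%E.
Proof.
move=> f0 g0 fg; apply/eqP; rewrite eq_le; apply/andP; split.
  by apply: le_integral_ae => //; apply: filterS fg => t h /h ->.
by apply: le_integral_ae => //; apply: filterS fg => t h /h ->.
Qed.

#[local] Instance ae_lebesgue_filter {R : realType} :
  Filter (almost_everywhere (@lebesgue_measure R)).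
Proof. exact: ae_filter_ringOfSetsType. Qed.

Section strong_measurability.
Context {R : realType}.
Local Notation mu := (@lebesgue_measure R).
Implicit Types V W : completeNormedModType R[i].

Lemma strongly_measurable_ae V D (f g : R -> V) :
  (\forall t \ae mu, D t -> f t = g t) ->
  strongly_measurable D f -> strongly_measurable D g.
Proof.
move=> fg [h [hs hf]]; exists h; split => //.
by apply: filterS2 fg hf => t e c Dt; rewrite -e//; exact: c.
Qed.

(** [f] is constrained only almost everywhere on [D], so its norm need not be measurable. The upper
    limit of the norms of the simple approximants is, and it agrees with the norm of [f] where they
    converge. *)
Lemma strongly_measurable_rnorm V D (f : R -> V) : strongly_measurable D f ->
  exists h : R -> \bar R, [/\ measurable_fun setT h, forall t, (0 <= h t)%E &
    \forall t \ae mu, D t -> h t = (rnorm (f t))%:E].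
Proof.
move=> [g [gs gf]].
exists (fun t => maxe 0%E (limn_esup (fun n => (rnorm (g n t))%:E))); split.
- apply: measurable_maxe => //; apply: measurable_fun_limn_esup => n.
  by apply: (measurable_finite_valued (fun v => (rnorm v)%:E)); exact: gs.
- by move=> t; rewrite le_max lexx.
- apply: filterS gf => t h /h /cvg_rnorm c.
  have /cvg_limn_einf_sup[_ ->] : (rnorm (g n t))%:E @[n --> \oo] --> (rnorm (f t))%:E.
    by apply: cvg_EFin => //; exact: nearW.
  by rewrite max_r// lee_fin rnorm_ge0.
Qed.

Lemma strongly_measurable_comp V W D (F : V -> W) (f : R -> V) :
  continuous F -> strongly_measurable D f -> strongly_measurable D (F \o f).
Proof.
move=> Fc [g [gs gf]]; exists (fun n => F \o g n); split.
  by move=> n; exact: finite_valued_comp (gs n).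
by apply: filterS gf => t h /h c; exact: cvg_image.
Qed.

Lemma strongly_measurableD V D (f g : R -> V) :
  strongly_measurable D f -> strongly_measurable D g ->
  strongly_measurable D (fun t => f t + g t).
Proof.
move=> [f' [f's f'f]] [g' [g's g'g]].
exists (fun n t => f' n t + g' n t); split.
  move=> n; exact: (finite_valued_comp (fun vw : V * V => vw.1 + vw.2)
    (finite_valued_pair (f's n) (g's n))).
by apply: filterS2 f'f g'g => t h h' Dt; apply: cvgD; [exact: h|exact: h'].
Qed.

Lemma simple_fun_restrict V (g : R -> V) D : measurable D -> simple_fun g ->
  simple_fun (fun t => if t \in D then g t else 0).
Proof.
move=> mD gs.
have Ds : finite_valued (fun t => t \in D).
  split; first exact: finite_finset.
  move=> b; rewrite (_ : _ @^-1` _ = if b then D else ~` D).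
    by case: b => //; exact: measurableC.
  apply/seteqP; case: b; split=> t /=.
  - by move/set_mem.
  - by move/mem_set.
  - by move=> h /mem_set; rewrite h.
  - by move=> h; rewrite memNset.
exact: (finite_valued_comp (fun vb : V * bool => if vb.2 then vb.1 else 0)
  (finite_valued_pair gs Ds)).
Qed.

(** The approximants are set to zero outside [D] as well, so they converge there trivially and [E]
    may be any set. *)
Lemma strongly_measurable_restrict V D E (f : R -> V) : measurable D ->
  strongly_measurable D f ->
  strongly_measurable E (fun t => if t \in D then f t else 0).
Proof.
move=> mD [g [gs gf]].
exists (fun n t => if t \in D then g n t else 0); split.
  by move=> n; exact: simple_fun_restrict.
apply: filterS gf => t h _; case: ifPn => [/set_mem /h //|_].
exact: cvg_cst.
Qed.

Lemma strongly_measurableS V D E (f : R -> V) : E `<=` D ->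
  strongly_measurable D f -> strongly_measurable E f.
Proof.
move=> ED [g [gs gf]]; exists g; split => //.
by apply: filterS gf => t h /ED /h.
Qed.

Lemma strongly_measurable_simple V D (f : R -> V) : simple_fun f ->
  strongly_measurable D f.
Proof.
by move=> fs; exists (fun=> f); split => //; apply: nearW => t _; exact: cvg_cst.
Qed.

Lemma simple_fun_cst V (v : V) : simple_fun (fun _ : R => v).
Proof.
split; first by apply: (sub_finite_set _ (finite_set1 v)) => _ [t _ <-].
move=> w; have [->|wv] := eqVneq w v.
  by rewrite (_ : _ @^-1` _ = setT)//; apply/seteqP; split.
rewrite (_ : _ @^-1` _ = set0)//; apply/seteqP; split => // t /= vw.
by rewrite vw eqxx in wv.
Qed.

Lemma strongly_measurable_cst V D (v : V) :
  strongly_measurable D (fun _ : R => v).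
Proof. exact/strongly_measurable_simple/simple_fun_cst. Qed.

Lemma strongly_measurable_sum V D (I : Type) (r : seq I) (F : I -> R -> V) :
  (forall i, strongly_measurable D (F i)) ->
  strongly_measurable D (fun t => \sum_(i <- r) F i t).
Proof.
move=> h; elim: r => [|i r ih].
  under eq_fun do rewrite big_nil; exact: strongly_measurable_cst.
under eq_fun do rewrite big_cons; exact: strongly_measurableD.
Qed.

End strong_measurability.

Section bochner_theory.
Context {R : realType}.
Local Notation mu := (@lebesgue_measure R).
Implicit Types V W : completeNormedModType R[i].
Variable D : set R.
Hypothesis mD : measurable D.
Hypothesis fD : (mu D < +oo)%E.

Lemma simple_fun_integrable V (g : R -> V) :
  simple_fun g -> simple_integrable D g.
Proof.
move=> gs; split => // v _; apply: le_lt_trans fD.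
apply: le_measure; rewrite ?inE//; apply: measurableI => //.
by case: gs => _; exact.
Qed.

Lemma is_bochner_integral_ae V (f g : R -> V) v :
  (\forall t \ae mu, D t -> f t = g t) ->
  is_bochner_integral D f v -> is_bochner_integral D g v.
Proof.
move=> fg [fm [h [hs hf hv]]]; split; first exact: strongly_measurable_ae fm.
exists h; split => //.
rewrite (_ : (fun n => _) = (fun n =>
    (\int[mu]_(t in D) (rnorm (f t - h n t))%:E)%E))//.
apply/funext => n; apply: eq_integral_ae.
- by move=> t _; rewrite lee_fin rnorm_ge0.
- by move=> t _; rewrite lee_fin rnorm_ge0.
- by apply: filterS fg => t e /e ->.
Qed.

(* Strong measurability provides measurable majorants, which compensates for
   the lack of subadditivity of the integral on nonmeasurable functions. *)
Lemma integral_rnorm_leD V1 V2 V3 (a b : R) (f : R -> V1) (g : R -> V2)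
  (h : R -> V3) : 0 <= a -> 0 <= b ->
  strongly_measurable D f -> strongly_measurable D g ->
  (forall t, rnorm (h t) <= a * rnorm (f t) + b * rnorm (g t)) ->
  (\int[mu]_(t in D) (rnorm (h t))%:E <=
   a%:E * \int[mu]_(t in D) (rnorm (f t))%:E +
   b%:E * \int[mu]_(t in D) (rnorm (g t))%:E)%E.
Proof.
move=> a0 b0 /strongly_measurable_rnorm[f' [mf' f'0 f'f]].
move=> /strongly_measurable_rnorm[g' [mg' g'0 g'g]] hfg.
have mf'D : measurable_fun D f' := measurable_funTS mf'.
have mg'D : measurable_fun D g' := measurable_funTS mg'.
rewrite -(@eq_integral_ae _ _ _ mu D f' (fun t => (rnorm (f t))%:E))//; last first.
  by move=> t _; rewrite lee_fin rnorm_ge0.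
rewrite -(@eq_integral_ae _ _ _ mu D g' (fun t => (rnorm (g t))%:E))//; last first.
  by move=> t _; rewrite lee_fin rnorm_ge0.
have maf' : measurable_fun D (fun t => a%:E * f' t)%E.
  by apply: emeasurable_funM => //; exact: measurable_cst.
have mbg' : measurable_fun D (fun t => b%:E * g' t)%E.
  by apply: emeasurable_funM => //; exact: measurable_cst.
rewrite -ge0_integralZl// -ge0_integralZl// -ge0_integralD//; last 2 first.
- by move=> t _; rewrite mule_ge0.
- by move=> t _; rewrite mule_ge0.
apply: le_integral_ae.
- by move=> t _; rewrite lee_fin rnorm_ge0.
- by move=> t _; rewrite adde_ge0// mule_ge0.
- by apply: filterS2 f'f g'g => t e e' Dt; rewrite e// e'// -!EFinM -EFinD lee_fin.
Qed.

Lemma strongly_measurableB_simple V (f g : R -> V) : strongly_measurable D f ->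
  simple_fun g -> strongly_measurable D (fun t => f t - g t).
Proof.
move=> fm gs; apply: strongly_measurableD => //.
apply/strongly_measurable_simple.
exact: (finite_valued_comp (fun v => - v) gs).
Qed.

Lemma is_bochner_integralD V (f g : R -> V) v w :
  is_bochner_integral D f v -> is_bochner_integral D g w ->
  is_bochner_integral D (fun t => f t + g t) (v + w).
Proof.
move=> [fm [f' [f's f'f f'v]]] [gm [g' [g's g'g g'w]]].
split; first exact: strongly_measurableD.
have fg's n := finite_valued_pair (f's n).1 (g's n).1.
pose F (vw : V * V) := vw.1 + vw.2.
exists (fun n t => f' n t + g' n t); split.
- by move=> n; apply: simple_fun_integrable; exact: (finite_valued_comp F (fg's n)).
- have : ((\int[mu]_(t in D) (rnorm (f t - f' n t))%:E)%E +
      (\int[mu]_(t in D) (rnorm (g t - g' n t))%:E)%E)%E @[n --> \oo] --> (0 + 0)%E.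
    exact: cvgeD.
  rewrite adde0; apply: squeeze_cvge; last exact: cvg_cst.
  apply: nearW => n; apply/andP; split.
    by apply: integral_ge0 => t _; rewrite lee_fin rnorm_ge0.
  rewrite -[X in (_ <= X + _)%E]mul1e -[X in (_ <= _ + X)%E]mul1e.
  apply: (integral_rnorm_leD (a := 1) (b := 1)) => //.
  + by apply: strongly_measurableB_simple => //; exact: (f's n).1.
  + by apply: strongly_measurableB_simple => //; exact: (g's n).1.
  + by move=> t; rewrite !mul1r opprD addrACA rnormD.
(* Both approximants are functions of the pair [(f' n, g' n)], so the three integrals are sums over
   the same cells and add termwise. *)
- rewrite (_ : (fun n => _) = (fun n =>
      simple_integral D (f' n) + simple_integral D (g' n))); last first.
    apply/funext => n.
    rewrite (simple_integral_comp mD fD F (fg's n)).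
    rewrite (simple_integral_comp mD fD fst (fg's n)).
    rewrite (simple_integral_comp mD fD snd (fg's n)) -big_split/=.
    by apply: eq_bigr => i _; rewrite -scalerDr.
  exact: cvgD.
Qed.

Lemma is_bochner_integral_linear V W (L : {linear V -> W}) (f : R -> V) v :
  continuous L ->
  is_bochner_integral D f v -> is_bochner_integral D (fun t => L (f t)) (L v).
Proof.
move=> Lc [fm [g [gs gf gv]]].
have [M M0 LM] := linear_rnorm_bounded Lc.
split; first exact: strongly_measurable_comp.
exists (fun n t => L (g n t)); split.
- move=> n; apply: simple_fun_integrable.
  exact: (finite_valued_comp L (gs n).1).
- have : (M%:E * (\int[mu]_(t in D) (rnorm (f t - g n t))%:E)%E)%E
      @[n --> \oo] --> (M%:E * 0)%E by exact: cvgeZl.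
  rewrite mule0; apply: squeeze_cvge; last exact: cvg_cst.
  apply: nearW => n; apply/andP; split.
    by apply: integral_ge0 => t _; rewrite lee_fin rnorm_ge0.
  have m := strongly_measurableB_simple fm (gs n).1.
  (* The two-term estimate is applied with both functions equal and second coefficient 0. *)
  rewrite -[X in (_ <= X)%E]adde0.
  rewrite -(mul0e (\int[mu]_(t in D) (rnorm (f t - g n t))%:E)%E).
  apply: (integral_rnorm_leD (ltW M0) (lexx 0) m m) => t.
  by rewrite -linearB mul0r addr0.
- rewrite (_ : (fun n => _) = (fun n => L (simple_integral D (g n)))); last first.
    apply/funext => n.
    rewrite (simple_integral_comp mD fD L (gs n).1).
    rewrite (simple_integral_comp mD fD id (gs n).1) linear_sum.
    by apply: eq_bigr => i _; rewrite linearZ.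
  exact: cvg_image.
Qed.

Lemma is_bochner_integral0 V : is_bochner_integral D (fun=> 0 : V) (0 : V).
Proof.
split; first exact: strongly_measurable_cst.
exists (fun _ _ => 0); split.
- by move=> n; apply: simple_fun_integrable; exact: simple_fun_cst.
- rewrite integral0_eq; first exact: cvg_cst.
  by move=> t _; rewrite subr0 rnorm0.
- rewrite (simple_integral_comp mD fD id (simple_fun_cst 0)).
  suff -> : \sum_(i <- values (fun _ : R => 0 : V))
    (fine (mu (D `&` (fun _ : R => 0 : V) @^-1` [set i])))%:C *: i = 0.
    exact: cvg_cst.
  rewrite big_seq big1// => v.
  rewrite /values in_fset_set; last by case: (@simple_fun_cst R V 0).
  by rewrite inE => -[t _ <-]; rewrite scaler0.
Qed.

(** The norm of the [n]-th simple integral is at most the integral of [k] plus that of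
    [rnorm (f t - g n t)], which tends to 0. The majorant [k] supplies the measurability that
    [rnorm (f t)] may lack. *)
Lemma rnorm_is_bochner_integral V (f : R -> V) v (k : R -> \bar R) :
  measurable_fun D k -> (forall t, D t -> (0 <= k t)%E) ->
  (\forall t \ae mu, D t -> ((rnorm (f t))%:E <= k t)%E) ->
  is_bochner_integral D f v ->
  ((rnorm v)%:E <= \int[mu]_(t in D) k t)%E.
Proof.
move=> mk k0 fk [fm [g [gs gf gv]]].
have : ((\int[mu]_(t in D) k t) + (\int[mu]_(t in D) (rnorm (f t - g n t))%:E)%E)%E
    @[n --> \oo] --> ((\int[mu]_(t in D) k t) + 0)%E.
  apply: cvgeD => //; last exact: cvg_cst.
  by rewrite fin_num_adde_defl.
rewrite adde0 => h.
have {}gv : (rnorm (simple_integral D (g n)))%:E @[n --> \oo] --> (rnorm v)%:E.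
  by apply: cvg_EFin; [exact: nearW|exact: cvg_rnorm].
apply: (lee_cvg_to gv h); apply: nearW => n.
apply: (le_trans (rnorm_simple_integral_comp mD fD id (gs n).1)).
have [e [me e0 ee]] := strongly_measurable_rnorm
  (strongly_measurableB_simple fm (gs n).1).
rewrite -(@eq_integral_ae _ _ _ mu D e (fun t => (rnorm (f t - g n t))%:E))//; last first.
  by move=> t _; rewrite lee_fin rnorm_ge0.
have meD : measurable_fun D e := measurable_funTS me.
rewrite -ge0_integralD//; apply: le_integral_ae.
- by move=> t _; rewrite lee_fin rnorm_ge0.
- by move=> t Dt; rewrite adde_ge0// k0.
- apply: filterS2 fk ee => t fkt et Dt; rewrite et//.
  apply: (@le_trans _ _ ((rnorm (f t))%:E + (rnorm (f t - g n t))%:E)%E).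
    rewrite -EFinD lee_fin -{1}(subKr (f t) (g n t)).
    by rewrite (le_trans (rnormB _ _)).
  by rewrite leeD2r// fkt.
Qed.

(** The difference of two integrals of [f] is an integral of the zero function, hence is bounded by
    the integral of the majorant 0. *)
Lemma is_bochner_integral_unique V (f : R -> V) v w :
  is_bochner_integral D f v -> is_bochner_integral D f w -> v = w.
Proof.
move=> fv fw; apply/eqP; rewrite -subr_eq0; apply/eqP/rnorm_eq0/le_anti.
rewrite rnorm_ge0 andbT -lee_fin.
have Nc : continuous (-%R : V -> V) by exact: opp_continuous.
have fvw := is_bochner_integralD fv (is_bochner_integral_linear Nc fw).
rewrite -[X in (_ <= X)%E](integral0 mu D).
apply: (rnorm_is_bochner_integral (k := cst 0%E) _ _ _ fvw) => //.
by apply: nearW => t _; rewrite subrr rnorm0.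
Qed.

Lemma bochner_integralE V (f : R -> V) v :
  is_bochner_integral D f v -> bochner_integral D f = v.
Proof.
move=> fv; rewrite /bochner_integral; case: xgetP => [w -> fw|/(_ v)//].
exact: is_bochner_integral_unique fw fv.
Qed.

End bochner_theory.

Lemma is_bochner_integral_restrict {R : realType}
  (V : completeNormedModType R[i]) (D E : set R) (f : R -> V) v :
  measurable D -> measurable E -> D `<=` E -> (lebesgue_measure E < +oo)%E ->
  is_bochner_integral D f v ->
  is_bochner_integral E (fun t => if t \in D then f t else 0) v.
Proof.
move=> mD mE DE fE [fm [g [gs gf gv]]].
split; first exact: strongly_measurable_restrict.
exists (fun n t => if t \in D then g n t else 0); split.
- move=> n; apply: simple_fun_integrable => //.
  by apply: simple_fun_restrict => //; case: (gs n).
- rewrite (_ : (fun n => _) = (fun n =>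
    (\int[lebesgue_measure]_(t in D) (rnorm (f t - g n t))%:E)%E))//.
  apply/funext => n; rewrite integral_mkcond [RHS]integral_mkcond.
  apply: eq_integral => t _; rewrite !patchE.
  case: ifPn => [tE|]; case: ifPn => [tD|tD] //; first by rewrite subr0 rnorm0.
  by move/negP; case; apply/mem_set/DE/set_mem.
- rewrite (_ : (fun n => _) = (fun n => simple_integral D (g n)))//.
  apply/funext => n; apply: eq_fsbigr => w _.
  (* The value 0 is the only one whose fibre changes under the extension, and it is weighted by the
     vector 0. *)
  have [->|w0] := eqVneq w 0; first by rewrite !scaler0.
  congr (_%:C *: _); congr (fine (_ _)); apply/seteqP; split=> t /=.
    case=> Et; case: ifPn => [/set_mem Dt <-//|_ w0'].
    by rewrite -w0' eqxx in w0.
  by move=> [Dt <-]; split; [exact: DE|rewrite mem_set].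
Qed.

(** * Integral of continuous functions *)

(** The covering balls have half the continuity radius, which leaves the other half for the move
    from [t] to [t']; hence only [t] has to lie in the segment. *)
Lemma uniform_continuity_segment {R : realType} (V : normedModType R[i])
  (f : R -> V) (a b e : R) : continuous f -> 0 < e ->
  exists2 d : R, 0 < d & forall t t', a <= t <= b -> `|t - t'| < d ->
    rnorm (f t - f t') < e.
Proof.
move=> fc e0; have e20 : 0 < e / 2 by rewrite divr_gt0.
have /compact_near_coveringP := @segment_compact R a b.
move=> /(_ R (0 : R)^'+ (fun d t => forall t', `|t - t'| < d ->
  rnorm (f t - f t') < e) _) [|d /= d0 hd].
  move=> t _; have /cvg_rnormP/(_ _ e20)[d /= d0 hd] := fc t.
  have d20 : 0 < d / 2 by rewrite divr_gt0.
  exists (ball t (d / 2), [set x | 0 < x < d / 2]) => /=.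
    split; first exact: nbhsx_ballx.
    by exists (d / 2) => //= x /=; rewrite sub0r normrN => xd x0;
      rewrite x0 (le_lt_trans (ler_norm _)).
  move=> [y x] /= [ty /andP[x0 xd]] t' yt'.
  rewrite (le_lt_trans (rnorm_triangle (f t) _ _))// (splitr e) ltrD//.
    by apply: hd; apply: lt_trans ty _; rewrite gtr_pMr// invf_lt1// ltr1n.
  rewrite rnorm_distC; apply: hd => /=.
  by rewrite (le_lt_trans (ler_distD y _ _))// (splitr d) ltrD// (lt_trans yt').
exists (d / 2); first by rewrite divr_gt0.
move=> t t' tab; apply: hd => //=; last by rewrite divr_gt0.
by rewrite sub0r normrN gtr0_norm ?divr_gt0// gtr_pMr// invf_lt1// ltr1n.
Qed.

(** * Uniform partitions of a segment *)

Section grid.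
Context {R : realType}.
Implicit Types (a b t : R) (n : nat).
Local Notation mu := (@lebesgue_measure R).

Definition mesh a b n : R := (b - a) / n.+1%:R.
Definition grid a b n (i : nat) : R := a + i%:R * mesh a b n.
(** Index among [n.+1] cells that are half-open on the right; the cap at [n] puts the end point [b]
    into the last one. *)
Definition grid_index a b n t : nat :=
  minn n (Num.truncn ((t - a) / mesh a b n)).

Lemma mesh_ge0 a b n : a <= b -> 0 <= mesh a b n.
Proof. by move=> ab; rewrite divr_ge0// subr_ge0. Qed.

Lemma mesh_gt0 a b n : a < b -> 0 < mesh a b n.
Proof. by move=> ab; rewrite divr_gt0// subr_gt0. Qed.

Lemma mesh_sum a b n : n.+1%:R * mesh a b n = b - a.
Proof. by rewrite /mesh mulrC divfK. Qed.

Lemma gridS a b n i : grid a b n i.+1 = grid a b n i + mesh a b n.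
Proof. by rewrite /grid -addrA -natr1 mulrDl mul1r. Qed.

Lemma grid0 a b n : grid a b n 0 = a.
Proof. by rewrite /grid mul0r addr0. Qed.

Lemma grid_end a b n : grid a b n n.+1 = b.
Proof. by rewrite /grid mesh_sum subrKC. Qed.

Lemma grid_itv a b n i : a <= b -> (i <= n.+1)%N -> a <= grid a b n i <= b.
Proof.
move=> ab ni; rewrite lerDl mulr_ge0 ?mesh_ge0//= -[leRHS](grid_end a b n).
by rewrite lerD2l ler_wpM2r ?mesh_ge0// ler_nat.
Qed.

Lemma mesh_cvg0 a b e : 0 < e -> a <= b ->
  exists N, forall n, (N <= n)%N -> mesh a b n < e.
Proof.
move=> e0 ab; have [N hN] : exists N : nat, (b - a) / e < N%:R.
  by exists (Num.truncn ((b - a) / e)).+1; rewrite truncnS_gt.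
exists N => n Nn; rewrite /mesh ltr_pdivrMr// mulrC -ltr_pdivrMr//.
by apply: (lt_le_trans hN); rewrite ler_nat (leq_trans Nn).
Qed.

Lemma grid_index_itv a b n t : a < b -> a <= t <= b ->
  grid a b n (grid_index a b n t) <= t <= grid a b n (grid_index a b n t).+1.
Proof.
move=> ab /andP[at_ tb]; have h0 := mesh_gt0 n ab.
have x0 : 0 <= (t - a) / mesh a b n by rewrite divr_ge0 ?subr_ge0// ltW.
have /andP[x1 x2] := truncn_itv x0.
move: x1; rewrite ler_pdivlMr// lerBrDl => x1.
move: x2; rewrite ltr_pdivrMr// ltrBlDl => x2.
rewrite /grid_index; case: (leqP n (Num.truncn ((t - a) / mesh a b n))) => nx.
  rewrite grid_end tb andbT; apply: le_trans x1.
  by rewrite /grid lerD2l ler_wpM2r ?(ltW h0)// ler_nat.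
by rewrite /grid x1/= ltW.
Qed.

Lemma grid_index_eq a b n t j : a < b -> a <= t -> (j <= n)%N ->
  grid a b n j <= t -> (t < grid a b n j.+1 \/ (j = n)) ->
  grid_index a b n t = j.
Proof.
move=> ab at_ jn jt tj; have h0 := mesh_gt0 n ab.
have x0 : 0 <= (t - a) / mesh a b n by rewrite divr_ge0 ?subr_ge0// ltW.
have jx : (j <= Num.truncn ((t - a) / mesh a b n))%N.
  by rewrite truncn_ge_nat// ler_pdivlMr// lerBrDl.
rewrite /grid_index; case: tj => [tj|jn']; last first.
  by rewrite [RHS]jn'; apply/minn_idPl; rewrite -{1}jn'.
have xj : (Num.truncn ((t - a) / mesh a b n) < j.+1)%N.
  by rewrite ltnNge truncn_ge_nat// ler_pdivlMr// lerBrDl -ltNge.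
have -> : Num.truncn ((t - a) / mesh a b n) = j.
  by apply/eqP; rewrite eqn_leq jx andbT.
exact/minn_idPr.
Qed.

Lemma grid_index_le a b n t : (grid_index a b n t <= n)%N.
Proof. exact: geq_minl. Qed.

Lemma finite_valued_grid_index a b n : a < b ->
  finite_valued (grid_index a b n).
Proof.
move=> ab; have h0 := mesh_gt0 n ab; split.
  apply: (sub_finite_set _ (finite_II n.+1)) => _ [t _ <-] /=.
  by rewrite ltnS grid_index_le.
move=> j.
(* A superlevel set of the index is everything, empty, or a half-line starting at a grid point; a
   fibre is the difference of two of them. *)
have ge j' : measurable [set t | (j' <= grid_index a b n t)%N].
  case: j' => [|j']; first by rewrite (_ : mkset _ = setT)//; apply/seteqP; split.
  have [jn|jn] := leqP j'.+1 n; last first.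
    rewrite (_ : mkset _ = set0)//; apply/seteqP; split => // t /=.
    by rewrite leqNgt ltnS (leq_trans (grid_index_le _ _ _ _))// -ltnS.
  rewrite (_ : mkset _ = `[grid a b n j'.+1, +oo[%classic).
    exact: measurable_itv.
  apply/seteqP; split => t /=; rewrite in_itv/= andbT leq_min jn/=.
    have [x0|x0] := leP 0 ((t - a) / mesh a b n).
      by rewrite truncn_ge_nat// ler_pdivlMr// lerBrDl.
    have /truncn0Pn -> // : ~~ (1 <= (t - a) / mesh a b n).
    by rewrite -ltNge (lt_trans x0).
  move=> jt; have x1 : j'.+1%:R <= (t - a) / mesh a b n.
    by rewrite ler_pdivlMr// lerBrDl.
  by rewrite truncn_ge_nat// (le_trans _ x1).
rewrite (_ : _ @^-1` _ = [set t | (j <= grid_index a b n t)%N] `\`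
    [set t | (j.+1 <= grid_index a b n t)%N]); first exact: measurableD.
apply/seteqP; split => t /=; first by move=> ->; rewrite leqnn ltnn.
by move=> [jt /negP]; rewrite -leqNgt => tj; apply/eqP; rewrite eqn_leq tj.
Qed.

Lemma grid_cell_measure a b n j : a < b -> (j <= n)%N ->
  mu (`[a, b]%classic `&` grid_index a b n @^-1` [set j]) = (mesh a b n)%:E.
Proof.
move=> ab jn; have h0 := mesh_gt0 n ab.
have gj : grid a b n j < grid a b n j.+1 by rewrite gridS ltrDl.
(* The right end is open except in the last cell, where [j != n] is false and [b] is included. *)
rewrite (_ : _ `&` _ = [set` Interval (BLeft (grid a b n j))
    (BSide (j != n) (grid a b n j.+1))]).
  rewrite lebesgue_measure_itv/= lte_fin gj gridS -EFinB; congr (_%:E).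
  by rewrite addrC addKr.
apply/seteqP; split => t /=.
  rewrite in_itv/= => -[tab tj]; have := grid_index_itv n ab tab.
  rewrite tj => /andP[jt tj']; rewrite itv_boundlr/= !bnd_simp jt/=.
  case: (eqVneq j n) => jn' /=; rewrite bnd_simp// lt_neqAle tj' andbT.
  apply/eqP => te; suff : grid_index a b n t = j.+1.
    by rewrite tj => /eqP; rewrite (ltn_eqF (ltnSn j)).
  have jn1 : (j < n)%N by rewrite ltn_neqAle jn'.
  move/andP : tab => [at_ tb].
  apply: grid_index_eq => //; first by rewrite te.
  by left; rewrite te [ltRHS]gridS ltrDl.
rewrite itv_boundlr/= !bnd_simp => /andP[jt tj].
have /andP[aj _] := grid_itv (ltW ab) (leqW jn).
have at_ : a <= t by exact: le_trans jt.
have /andP[_ jb] : a <= grid a b n j.+1 <= b by apply: grid_itv; rewrite ?ltW.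
have [jn'|jn'] := eqVneq j n.
  move: tj; rewrite jn' eqxx/= bnd_simp grid_end => tb.
  split; first by rewrite in_itv/= at_.
  by apply: grid_index_eq => //; [rewrite -{2}jn'|right].
move: tj; rewrite jn' bnd_simp => tj; split.
  by rewrite in_itv/= at_ ltW// (lt_le_trans tj).
by apply: grid_index_eq => //; left.
Qed.

End grid.

Lemma cvge_to0 {R : realType} (u : nat -> \bar R) : (forall n, (0 <= u n)%E) ->
  (forall e : R, 0 < e -> exists N, forall n, (N <= n)%N -> (u n <= e%:E)%E) ->
  u n @[n --> \oo] --> 0%E.
Proof.
move=> u0 ue.
have fin e n : (u n <= e%:E)%E -> u n \is a fin_num.
  by move=> h; rewrite ge0_fin_numE// (le_lt_trans h)// ltry.
apply/fine_cvgP; split.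
  have [N hN] := ue _ ltr01; exists N => // n /= /hN; exact: fin.
apply/cvgrPdist_le => e /ue[N hN]; exists N => // n /= /hN h.
rewrite sub0r normrN ger0_norm ?fine_ge0// -lee_fin fineK//; exact: fin h.
Qed.

(** * Riemann integral of continuous functions as a Bochner integral *)

Section riemann.
Context {R : realType} {V : completeNormedModType R[i]}.
Local Notation mu := (@lebesgue_measure R).
Implicit Types (f : R -> V) (a b t : R) (n : nat).

Definition riemann_sum f a b n : V :=
  (mesh a b n)%:C *: \sum_(i < n.+1) f (grid a b n i).

Definition riemann_integral f a b : V := lim (riemann_sum f a b n @[n --> \oo]).

(** A left Riemann sum is the integral of the step function that freezes [f] at the left end of each
    cell; this ties Riemann sums to the Bochner integral. *)
Lemma simple_integral_grid f a b n : a < b ->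
  simple_integral `[a, b] (fun t => f (grid a b n (grid_index a b n t))) =
  riemann_sum f a b n.
Proof.
move=> ab; have qf := finite_valued_grid_index n ab.
have fab : (mu `[a, b] < +oo)%E.
  by rewrite lebesgue_measure_itv/=; case: ifP => _; rewrite ?ltry// -EFinB ltry.
rewrite (simple_integral_comp _ fab (fun i => f (grid a b n i)) qf)//.
rewrite /riemann_sum scaler_sumr -fsbig_finite; last by case: qf.
rewrite [RHS](fsbig_ord _ n.+1 (fun i => (mesh a b n)%:C *: f (grid a b n i))).
rewrite (@fsbig_widen _ _ _ _ _ `I_n.+1).
- by apply: eq_fsbigr => j /set_mem /= jn; rewrite grid_cell_measure.
- by move=> _ [t _ <-] /=; rewrite ltnS grid_index_le.
- move=> j [_ /= jr]; rewrite (_ : _ `&` _ = set0) ?measure0 ?scale0r//.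
  by apply/seteqP; split => // t [_ /= tj]; apply: jr; exists t.
Qed.

Lemma mu_segment_fin a b : (mu `[a, b] < +oo)%E.
Proof.
by rewrite lebesgue_measure_itv/=; case: ifP => _; rewrite ?ltry// -EFinB ltry.
Qed.

Lemma grid_approx f a b e : continuous f -> a < b -> 0 < e ->
  exists N, forall n t, (N <= n)%N -> a <= t <= b ->
    rnorm (f t - f (grid a b n (grid_index a b n t))) < e.
Proof.
move=> fc ab e0; have [d d0 fd] := uniform_continuity_segment a b fc e0.
have [N hN] := mesh_cvg0 d0 (ltW ab).
exists N => n t Nn tab; apply: fd => //.
have /andP[h1 h2] := grid_index_itv n ab tab.
rewrite ger0_norm ?subr_ge0//; apply: le_lt_trans (hN n Nn).
by rewrite lerBlDl -gridS.
Qed.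

(** Uniform approximation by frozen step functions yields everything at once: their integrals are
    Cauchy, so the limit exists, and they witness Bochner integrability with that limit. For [a = b]
    all sums vanish and the segment is a null set. *)
Lemma riemann_integral_spec f a b : continuous f -> a <= b ->
  riemann_sum f a b n @[n --> \oo] --> riemann_integral f a b /\
  is_bochner_integral `[a, b] f (riemann_integral f a b).
Proof.
move=> fc; rewrite le_eqVlt => /predU1P[ab|ab].
  have rs0 n : riemann_sum f a b n = 0.
    by rewrite /riemann_sum /mesh ab subrr mul0r scale0r.
  have r0 : riemann_integral f a b = 0.
    by rewrite /riemann_integral (funext rs0); apply: lim_cst.
  rewrite r0 (funext rs0); split; first exact: cvg_cst.
  apply: is_bochner_integral_ae (is_bochner_integral0 _ (mu_segment_fin _ _) V) => //.
  exists [set a]; split => //; first exact: lebesgue_measure_set1.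
  move=> t /= h; apply: contrapT => ta; apply: h; rewrite -ab in_itv/=.
  by move=> /le_anti /esym.
pose g n t := f (grid a b n (grid_index a b n t)).
have gs n : simple_fun (g n).
  exact: (finite_valued_comp (fun i => f (grid a b n i))
    (finite_valued_grid_index n ab)).
have gint n : simple_integral `[a, b] (g n) = riemann_sum f a b n.
  exact: simple_integral_grid.
have ba0 : 0 < b - a by rewrite subr_gt0.
have bound k e : 0 <= e -> (forall t, a <= t <= b -> rnorm (k t : V) <= e) ->
    (\int[mu]_(t in `[a, b]) (rnorm (k t))%:E <= (e * (b - a))%:E)%E.
  move=> e0 ke.
  apply: (@le_trans _ _ (\int[mu]_(t in `[a, b]) (cst e%:E t))%E).
    apply: le_integral_ae => [t _|t _|].
    - by rewrite lee_fin rnorm_ge0.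
    - by rewrite lee_fin.
    - by apply: nearW => t /=; rewrite in_itv/= lee_fin => /ke.
  rewrite integral_cst//= lebesgue_measure_itv/= lte_fin ab.
  by rewrite -EFinB -EFinM.
have cv : cvg (riemann_sum f a b n @[n --> \oo]).
  apply: cvg_of_cauchy => e e0.
  (* Each of the two step functions is this close to [f], so their integrals differ by at most
     [e / 2]. *)
  have e'0 : 0 < e / (2 * (b - a)) / 2.
    by rewrite !divr_gt0// mulr_gt0.
  have [N hN] := grid_approx fc ab e'0.
  exists N => n m Nn Nm; rewrite -!gint.
  have q := finite_valued_pair (gs n) (gs m).
  have ms := measurable_itv `[a, b]; have fs := mu_segment_fin a b.
  have -> : simple_integral `[a, b] (g n) - simple_integral `[a, b] (g m) =
      simple_integral `[a, b] (fun t => g n t - g m t).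
    rewrite (simple_integral_comp ms fs fst q) (simple_integral_comp ms fs snd q).
    rewrite (simple_integral_comp ms fs (fun vw : V * V => vw.1 - vw.2) q).
    by rewrite -sumrB; apply: eq_bigr => i _; rewrite -scalerBr.
  rewrite -lte_fin; apply: le_lt_trans.
    exact: (rnorm_simple_integral_comp ms fs (fun vw : V * V => vw.1 - vw.2) q).
  apply: (@le_lt_trans _ _ ((e / (2 * (b - a)) * (b - a))%:E)).
    apply: bound; first by rewrite divr_ge0 ?mulr_ge0 ?ltW.
    move=> t tab; apply: (le_trans (rnorm_triangle (f t) _ _)).
    rewrite [leRHS]splitr lerD// ltW ?hN// rnorm_distC; exact: hN.
  rewrite lte_fin invfM mulrA divfK ?gt_eqF//.
  by rewrite gtr_pMr// invf_lt1// ltr1n.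
split; first exact: cv.
split.
  exists g; split => //; apply: nearW => t; rewrite /= in_itv/= => tab.
  apply/cvg_rnormP => e e0; have [N hN] := grid_approx fc ab e0.
  by exists N => // n /= Nn; rewrite rnorm_distC; exact: hN.
exists g; split.
- by move=> n; apply: simple_fun_integrable (gs n) => //; exact: mu_segment_fin.
- apply: cvge_to0 => [n|e e0].
    by apply: integral_ge0 => t _; rewrite lee_fin rnorm_ge0.
  have e'0 : 0 < e / (b - a) by rewrite divr_gt0.
  have [N hN] := grid_approx fc ab e'0; exists N => n Nn.
  rewrite -[X in (_ <= X%:E)%E](divfK (lt0r_neq0 ba0)).
  by apply: bound => [|t tab]; rewrite ltW// hN.
- by under eq_fun do rewrite gint; exact: cv.
Qed.

End riemann.

Section riemann_theory.
Context {R : realType} {V : completeNormedModType R[i]}.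
Implicit Types (f g : R -> V) (a b c t : R) (n : nat).

Lemma riemann_sum_cvg f a b : continuous f -> a <= b ->
  riemann_sum f a b n @[n --> \oo] --> riemann_integral f a b.
Proof. by move=> fc ab; case: (riemann_integral_spec fc ab). Qed.

Lemma is_bochner_riemann f a b : continuous f -> a <= b ->
  is_bochner_integral `[a, b] f (riemann_integral f a b).
Proof. by move=> fc ab; case: (riemann_integral_spec fc ab). Qed.

Lemma riemann_integral_lim f a b v :
  riemann_sum f a b n @[n --> \oo] --> v -> riemann_integral f a b = v.
Proof. by move=> h; apply: cvg_lim h. Qed.

Lemma riemann_integralD f g a b : continuous f -> continuous g -> a <= b ->
  riemann_integral (fun t => f t + g t) a b =
  riemann_integral f a b + riemann_integral g a b.
Proof.
move=> fc gc ab; apply: riemann_integral_lim.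
rewrite (_ : riemann_sum _ a b = fun n => riemann_sum f a b n + riemann_sum g a b n).
  by apply: cvgD; exact: riemann_sum_cvg.
by apply/funext => n; rewrite /riemann_sum big_split scalerDr.
Qed.

Lemma riemann_integral_linear (W : completeNormedModType R[i])
  (L : {linear V -> W}) f a b : continuous L -> continuous f -> a <= b ->
  riemann_integral (fun t => L (f t)) a b = L (riemann_integral f a b).
Proof.
move=> Lc fc ab; apply: cvg_lim => //.
rewrite (_ : riemann_sum _ a b = fun n => L (riemann_sum f a b n)).
  by apply: cvg_image => //; exact: riemann_sum_cvg.
apply/funext => n; rewrite /riemann_sum [RHS]linearZ.
by congr (_ *: _); rewrite linear_sum.
Qed.

Lemma riemann_integral_shift f a b h :
  riemann_integral (fun t => f (t + h)) a b = riemann_integral f (a + h) (b + h).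
Proof.
rewrite /riemann_integral (_ : riemann_sum _ a b = riemann_sum f (a + h) (b + h))//.
apply/funext => n; rewrite /riemann_sum /mesh opprD addrACA subrr addr0.
congr (_ *: _); apply: eq_bigr => i _.
by rewrite /grid /mesh opprD addrACA subrr addr0 addrAC.
Qed.

(** Moves the dependence on [t] from the end point into the integrand, where
    [riemann_integral_continuous] can handle it. *)
Lemma riemann_integral_scale f t : continuous f ->
  riemann_integral f 0 t = t%:C *: riemann_integral (fun s => f (t * s)) 0 1.
Proof.
move=> fc; apply: riemann_integral_lim.
have ftc : continuous (fun s => f (t * s)).
  by move=> s; apply: (@continuous_comp _ _ _ (fun s => t * s) f);
    [exact: mulrl_continuous|exact: fc].
rewrite (_ : riemann_sum f 0 t = fun n => t%:C *: riemann_sum (fun s => f (t * s)) 0 1 n).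
  by apply: cvgZr; exact: riemann_sum_cvg.
apply/funext => n; rewrite /riemann_sum scalerA -rmorphM /mesh !subr0 div1r.
congr (_ *: _); apply: eq_bigr => i _.
by rewrite /grid /mesh !add0r !subr0 div1r mulrCA.
Qed.

Lemma rnorm_riemann_integral f a b (K : R) : continuous f -> a <= b ->
  (forall n, rnorm (riemann_sum f a b n) <= K) ->
  rnorm (riemann_integral f a b) <= K.
Proof.
move=> fc ab h; have c := cvg_rnorm eventually_filter (riemann_sum_cvg fc ab).
by rewrite -(cvg_lim _ c)//; apply: limr_le; [exact: cvgP c|exact: nearW].
Qed.

Lemma rnorm_riemann_sum f a b (k : R -> R) n : a <= b ->
  (forall t, a <= t <= b -> rnorm (f t) <= k t) ->
  rnorm (riemann_sum f a b n) <= \sum_(i < n.+1) mesh a b n * k (grid a b n i).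
Proof.
move=> ab fk; rewrite rnormZr ger0_norm ?mesh_ge0// -mulr_sumr.
rewrite ler_wpM2l ?mesh_ge0// (le_trans (rnorm_sum _ _ _))//.
by apply: ler_sum => i _; apply/fk/grid_itv => //; rewrite ltnW.
Qed.

Lemma rnorm_riemann_integral_cst f a b (K : R) : continuous f -> a <= b ->
  (forall t, a <= t <= b -> rnorm (f t) <= K) ->
  rnorm (riemann_integral f a b) <= (b - a) * K.
Proof.
move=> fc ab fK; apply: rnorm_riemann_integral => // n.
apply: (le_trans (rnorm_riemann_sum n ab fK)).
by rewrite sumr_const card_ord -[X in X <= _]mulr_natl mulrA mesh_sum.
Qed.

(** By [1 + l * h <= expR (l * h)], each term of a left Riemann sum of [c * expR (l * s)] is at most
    the increment of the primitive [c / l * expR (l * s)], and the increments telescope. *)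
Lemma rnorm_riemann_integral_exp f t (c l : R) : continuous f -> 0 <= t ->
  0 <= c -> 0 < l ->
  (forall s, 0 <= s <= t -> rnorm (f s) <= c * expR (l * s)) ->
  rnorm (riemann_integral f 0 t) <= c / l * expR (l * t).
Proof.
move=> fc t0 c0 l0 fe; apply: rnorm_riemann_integral => // n.
apply: (le_trans (rnorm_riemann_sum n t0 fe)).
apply: (@le_trans _ _ (\sum_(i < n.+1)
    (c / l * expR (l * grid 0 t n i.+1) - c / l * expR (l * grid 0 t n i)))).
  apply: ler_sum => i _; rewrite gridS; move: (grid 0 t n i) => s.
  move: (mesh 0 t n) (mesh_ge0 n t0) => h h0; rewrite mulrDr expRD.
  have -> : h * (c * expR (l * s)) = c / l * expR (l * s) * (l * h).
    by field; rewrite gt_eqF.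
  rewrite [c / l * (_ * _)]mulrA -[X in _ <= _ - X]mulr1 -mulrBr ler_wpM2l//.
    by rewrite mulr_ge0 ?expR_ge0// divr_ge0// ltW.
  by rewrite lerBrDl expR_ge1Dx.
rewrite -(big_mkord xpredT (fun i => c / l * expR (l * grid 0 t n i.+1)
  - c / l * expR (l * grid 0 t n i))) telescope_sumr// grid_end.
by rewrite gerBl mulr_ge0 ?expR_ge0// divr_ge0// ltW.
Qed.

(** The grids of the three segments do not match, so additivity is taken from the Bochner integral:
    both pieces are extended by zero to [[a, c]] and overlap only at [b], a null set. *)
Lemma riemann_integral_cat f a b c : continuous f -> a <= b -> b <= c ->
  riemann_integral f a c = riemann_integral f a b + riemann_integral f b c.
Proof.
move=> fc ab bc; have ac := le_trans ab bc.
have sub1 : `[a, b] `<=` `[a, c].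
  by move=> t /=; rewrite !in_itv/= => /andP[-> /le_trans ->].
have sub2 : `[b, c] `<=` `[a, c].
  by move=> t /=; rewrite !in_itv/= => /andP[/(le_trans ab) -> ->].
have fin := mu_segment_fin a c.
have r1 := is_bochner_integral_restrict (measurable_itv _) (measurable_itv _)
  sub1 fin (is_bochner_riemann fc ab).
have r2 := is_bochner_integral_restrict (measurable_itv _) (measurable_itv _)
  sub2 fin (is_bochner_riemann fc bc).
have r12 := is_bochner_integralD (measurable_itv _) fin r1 r2.
apply: (is_bochner_integral_unique (measurable_itv _) fin (is_bochner_riemann fc ac)).
apply: is_bochner_integral_ae r12; exists [set b]; split => //.
  exact: lebesgue_measure_set1.
move=> t /= h; apply: contrapT => tb; apply: h; rewrite in_itv/= => /andP[at_ tc].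
rewrite !mem_setE !in_itv/= at_ tc/= andbT.
case: (ltgtP t b) => [tb'|tb'|//]; first by rewrite addr0.
by rewrite add0r.
Qed.

(** Tube argument: by compactness of [[0, 1]], [F t s] is close to [F t0 s] for all [s] at once when
    [t] is near [t0]. *)
Lemma riemann_integral_continuous (F : R -> R -> V) :
  continuous (fun ts : R * R => F ts.1 ts.2) ->
  continuous (fun t => riemann_integral (F t) 0 1).
Proof.
move=> Fc t0; apply/cvg_rnormP => e e0.
have F1 t : continuous (F t).
  move=> s; apply: (@continuous_comp _ _ _ (fun s => (t, s)) (fun ts => F ts.1 ts.2)).
    exact: (cvg_pair (cvg_cst _) cvg_id).
  exact: Fc.
have e20 : 0 < e / 2 by rewrite divr_gt0.
have e40 : 0 < e / 2 / 2 by rewrite divr_gt0.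
have /compact_near_coveringP := @segment_compact R 0 1.
move=> /(_ R (nbhs t0) (fun t s => rnorm (F t s - F t0 s) < e / 2) _) near01.
suff : \forall t \near t0, `[0, 1] `<=` (fun s => rnorm (F t s - F t0 s) < e / 2).
  apply: filterS => t ht.
  have -> : riemann_integral (F t) 0 1 - riemann_integral (F t0) 0 1 =
      riemann_integral (fun s => F t s - F t0 s) 0 1.
    rewrite riemann_integralD//; last by move=> s; apply: continuousN; exact: F1.
    congr (_ + _); apply/esym.
    have Nc : continuous (-%R : V -> V) by exact: opp_continuous.
    exact: (riemann_integral_linear Nc (F1 t0) ler01).
  apply: (@le_lt_trans _ _ ((1 - 0) * (e / 2))).
    apply: rnorm_riemann_integral_cst => //.
      by move=> s; apply: continuousB; exact: F1.
    by move=> s s01; apply/ltW/ht; rewrite /= in_itv.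
  by rewrite subr0 mul1r gtr_pMr// invf_lt1// ltr1n.
apply: near01 => s _.
have /cvg_rnormP/(_ _ e40)[[A B] /= [At Bs] AB] := Fc (t0, s).
  exists (B, A) => //= -[y x] /= [By Ax].
  rewrite (le_lt_trans (rnorm_triangle (F t0 s) _ _))//.
  rewrite (splitr (e / 2)) ltrD//; first exact: (AB (x, y)).
  rewrite rnorm_distC; apply: (AB (t0, y)); split => //=.
  exact: nbhs_singleton.
Qed.

End riemann_theory.

(** * Limits of strongly measurable functions *)

Section limits_of_strongly_measurable.
Context {R : realType} {V : completeNormedModType R[i]}.
Local Notation mu := (@lebesgue_measure R).
Variable D : set R.
Hypothesis mD : measurable D.
Hypothesis fD : (mu D < +oo)%E.

(** Almost uniform convergence is obtained for real functions, namely measurable versions [h n] of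
    [rnorm (f t - g n t)], which tend to 0 almost everywhere on [D]. *)
Lemma simple_approx (f : R -> V) (e d : R) : strongly_measurable D f ->
  0 < e -> 0 < d ->
  exists g, exists B : set R, [/\ simple_fun g, measurable B, (mu B <= d%:E)%E &
    \forall t \ae mu, D t -> ~ B t -> rnorm (f t - g t) < e].
Proof.
move=> fm e0 d0; have [g [gs gf]] := fm.
have /choice[h hP] n : exists h : R -> R, measurable_fun setT h /\
    \forall t \ae mu, D t -> h t = rnorm (f t - g n t).
  have [h [mh h0 hE]] := strongly_measurable_rnorm (strongly_measurableB_simple fm (gs n)).
  exists (fine \o h); split.
    exact: measurableT_comp.
  by apply: filterS hE => t hE Dt /=; rewrite hE.
have hE : \forall t \ae mu, forall n, D t -> h n t = rnorm (f t - g n t).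
  by apply: ae_foralln => n; case: (hP n).
have hcvg : \forall t \ae mu, D t -> h n t @[n --> \oo] --> (0 : R).
  apply: filterS2 hE gf => t hE gf Dt.
  under eq_fun do rewrite hE//.
  apply/cvgrPdist_lt => x x0; have /cvg_rnormP/(_ _ x0) := gf Dt.
  apply: filterS => n; rewrite sub0r normrN ger0_norm ?rnorm_ge0//.
  by rewrite rnorm_distC.
have [||B [mB Bd hB]] := @ae_pointwise_almost_uniform _ _ _ mu h (cst 0) D d _ _ mD fD hcvg d0.
- by move=> n; apply: measurable_funTS; case: (hP n).
- exact: measurable_cst.
pose S : set (R -> R) := [set k | forall t, (D `\` B) t -> `|k t| < e].
have : @nbhs _ {uniform` D `\` B -> R} (cst 0) S.
  apply/uniform_nbhs; exists [set xy | ball xy.1 e xy.2]; split.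
    exact: (entourage_ball _ (PosNum e0)).
  move=> k hk t DBt; have := hk t DBt.
  by rewrite /= /ball/= sub0r normrN.
move/hB => [N _ /(_ N (leqnn N)) hN].
exists (g N), B; split => //; first exact: ltW.
apply: filterS hE => t /(_ N) hE Dt nBt; rewrite -hE//.
by apply: le_lt_trans (hN t _) => //; exact: ler_norm.
Qed.

(* Egorov's theorem followed by the Borel-Cantelli lemma. *)
Lemma strongly_measurable_lim (f : nat -> R -> V) (g : R -> V) :
  (forall n, strongly_measurable D (f n)) ->
  (\forall t \ae mu, D t -> f n t @[n --> \oo] --> g t) ->
  strongly_measurable D g.
Proof.
move=> fm fg.
have /choice[hB hBP] n : exists hB : (R -> V) * set R,
    [/\ simple_fun hB.1, measurable hB.2,
        (mu hB.2 <= (1 / (2 ^ n.+1)%:R)%:E)%E &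
      \forall t \ae mu, D t -> ~ hB.2 t -> rnorm (f n t - hB.1 t) < n.+1%:R^-1].
  have d0 : 0 < 1 / (2 ^ n.+1)%:R :> R by rewrite divr_gt0// ltr0n expn_gt0.
  have e0 : 0 < n.+1%:R^-1 :> R by rewrite invr_gt0.
  by have [h [B [hs mB Bd hBP]]] := simple_approx (fm n) e0 d0; exists (h, B).
exists (fun n => (hB n).1); split; first by move=> n; case: (hBP n).
(* The bad sets have summable measures, at most [1 / 2 ^ n.+1], so almost every point lies in only
   finitely many of them. *)
have lim0 : mu (lim_sup_set (fun n => (hB n).2)) = 0%E.
  apply: lim_sup_set_cvg0 => [n|]; first by case: (hBP n).
  apply: (@le_lt_trans _ _ (\sum_(0 <= n <oo) (1 / (2 ^ n.+1)%:R : R)%:E)%E).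
    by apply: lee_nneseries => n _ //; case: (hBP n).
  by apply: le_lt_trans (epsilon_trick0 xpredT ler01) _; rewrite ltry.
have mlim : measurable (lim_sup_set (fun n => (hB n).2)).
  apply: bigcap_measurable => // n _; apply: bigcup_measurable => k _.
  by case: (hBP k).
have aelim : \forall t \ae mu, ~ lim_sup_set (fun n => (hB n).2) t.
  by exists (lim_sup_set (fun n => (hB n).2)); split => // t /= /contrapT.
have aef : \forall t \ae mu, forall n, D t -> ~ (hB n).2 t ->
    rnorm (f n t - (hB n).1 t) < n.+1%:R^-1.
  by apply: ae_foralln => n; case: (hBP n).
apply: filterS3 aelim aef fg => t tlim tf tg Dt.
have [N hN] : exists N, forall n, (N <= n)%N -> ~ (hB n).2 t.
  apply: contrapT => h; apply: tlim => N _; apply: contrapT => h'.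
  by apply: h; exists N => n Nn Bn; apply: h'; exists n.
apply/cvg_rnormP => e e0; have e20 : 0 < e / 2 by rewrite divr_gt0.
have /cvg_rnormP/(_ _ e20) [M _ hM] := tg Dt.
have [K _ hK] := near_infty_natSinv_lt (PosNum e20).
exists (maxn N (maxn M K)) => // n /=; rewrite !geq_max => /and3P[Nn Mn Kn].
rewrite (le_lt_trans (rnorm_triangle (f n t) _ _))// (splitr e) ltrD//.
  by rewrite rnorm_distC (lt_trans (tf n Dt (hN n Nn)))//; exact: hK.
exact: hM.
Qed.

End limits_of_strongly_measurable.

(** [Delta] is measurable only when applied to a fixed vector. With [g] frozen on grid cells,
    [Delta t (g t)] becomes a finite sum of such functions cut to cells; continuity of each
    [Delta t] carries the limit. *)
Lemma strongly_measurable_operator_comp {R : realType}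
  (V W : completeNormedModType R[i]) (Delta : R -> {linear V -> W})
  (g : R -> V) (a b : R) : a < b ->
  (forall t, a <= t <= b -> continuous (Delta t)) ->
  (forall y, strongly_measurable `[a, b] (fun t => Delta t y)) ->
  continuous g ->
  strongly_measurable `[a, b] (fun t => Delta t (g t)).
Proof.
move=> ab Dc Dm gc.
pose G n t := Delta t (g (grid a b n (grid_index a b n t))).
apply: (@strongly_measurable_lim _ _ _ (measurable_itv _) (mu_segment_fin a b) G).
  move=> n.
  pose S j t := Delta t (if grid_index a b n t == j then g (grid a b n j) else 0).
  have -> : G n = fun t => \sum_(j <- iota 0 n.+1) S j t.
    apply/funext => t; rewrite /G /S -linear_sum; congr (Delta t _).
    have m : grid_index a b n t \in iota 0 n.+1.
      by rewrite mem_iota add0n ltnS grid_index_le.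
    rewrite (bigD1_seq _ m (iota_uniq _ _)) eqxx big1.
      exact/esym/addr0.
    by move=> j /negbTE; rewrite eq_sym => ->.
  apply: strongly_measurable_sum => j.
  have -> : S j = fun t => if t \in grid_index a b n @^-1` [set j]
      then Delta t (g (grid a b n j)) else 0.
    apply/funext => t; rewrite /S; case: eqP => [tj|tj].
      by rewrite mem_set.
    by rewrite memNset// linear0.
  apply: (strongly_measurable_ae (f := fun t =>
    if t \in `[a, b] `&` grid_index a b n @^-1` [set j]
    then Delta t (g (grid a b n j)) else 0)).
    apply: nearW => t tab; case: ifPn => [/set_mem[_ tj]|]; first by rewrite mem_set.
    rewrite in_setI => /nandP[|/negbTE -> //].
    by rewrite mem_set.
  have mq := (finite_valued_grid_index n ab).2 j.
  apply: strongly_measurable_restrict; first exact: measurableI.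
  by apply: strongly_measurableS (Dm (g (grid a b n j))) => t [].
apply: nearW => t /=; rewrite in_itv/= => tab.
apply: cvg_image; first exact: Dc.
apply/cvg_rnormP => e e0; have [N hN] := grid_approx gc ab e0.
by exists N => // n /= Nn; rewrite rnorm_distC hN.
Qed.

(** * Integral inequalities on segments *)

Section real_integrals.
Context {R : realType}.
Local Notation mu := (@lebesgue_measure R).
Implicit Types (f g h : R -> R) (a b c : R).

Lemma integral_expR_linear (k m a b : R) : k != 0 -> a <= b ->
  (\int[mu]_(t in `[a, b]) (expR (k * t + m))%:E)%E =
  ((expR (k * b + m) - expR (k * a + m)) / k)%:E.
Proof.
move=> k0; rewrite le_eqVlt => /predU1P[->|ab].
  by rewrite set_itv1 integral_set1 subrr mul0r.
pose F (t : R) : R := k^-1 * expR (k * t + m).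
have dF (t : R) : is_derive t 1 F (expR (k * t + m)).
  rewrite /F; apply: is_derive_eq.
  by rewrite addr0 /GRing.scale/= mulr1 mulrCA mulVf// mulr1.
have cF : continuous F.
  by move=> t; apply/differentiable_continuous/derivable1_diffP; case: (dF t).
rewrite (@continuous_FTC2 _ _ F)//.
- by rewrite /F -EFinB -mulrBr mulrC.
- apply: continuous_subspaceT => t.
  apply: (@continuous_comp _ _ _ (fun t => k * t + m) expR).
    apply: continuousD; last exact: cst_continuous.
    exact: mulrl_continuous.
  exact: continuous_expR.
- split.
  + by move=> t _; case: (dF t).
  + exact/cvg_at_right_filter/cF.
  + exact/cvg_at_left_filter/cF.
- by move=> t _; rewrite derive1E; case: (dF t).
Qed.

Lemma measurable_continuous_EFin D f : continuous f ->
  measurable_fun D (fun t => (f t)%:E).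
Proof.
move=> fc; apply/measurable_EFinP; apply: measurable_funTS.
exact: continuous_measurable_fun.
Qed.

Lemma integral_segment_cat f a b c : a <= b -> b <= c ->
  measurable_fun setT (fun t => (f t)%:E) -> (forall t, 0 <= f t) ->
  (\int[mu]_(t in `[a, c]) (f t)%:E)%E =
  (\int[mu]_(t in `[a, b]) (f t)%:E + \int[mu]_(t in `[b, c]) (f t)%:E)%E.
Proof.
move=> ab bc mf f0.
rewrite -(@integral_itv_obnd_cbnd R b); last exact: measurable_funTS.
have U : `[a, c]%classic = `[a, b]%classic `|` `]b, c]%classic.
  apply/seteqP; split => t /=; rewrite !in_itv/=.
    by move=> /andP[-> ->]; rewrite andbT; case: (leP t b) => _; [left|right].
  move=> [/andP[-> tb]|/andP[bt ->]]; first by rewrite (le_trans tb).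
  by rewrite andbT (le_trans ab)// ltW.
rewrite U ge0_integral_setU//.
- exact: measurable_funTS.
- by move=> t _; rewrite lee_fin.
- apply/disj_setPS => t /=; rewrite !in_itv/= => -[/andP[_ tb] /andP[bt _]].
  by move: tb; rewrite leNgt bt.
Qed.

(* Pigeonhole: a sequence of adjacent intervals cannot all carry mass [m]. *)
Lemma small_integral_cell f a (l m K : R) n : 0 <= l ->
  measurable_fun setT (fun t => (f t)%:E) -> (forall t, 0 <= f t) ->
  (forall b, a <= b -> (\int[mu]_(t in `[a, b]) (f t)%:E <= K%:E)%E) ->
  K < n%:R * m ->
  exists2 i, (i < n)%N &
    (\int[mu]_(t in `[(a + i%:R * l)%R, (a + i.+1%:R * l)%R]) (f t)%:E <= m%:E)%E.
Proof.
move=> l0 mf f0 fK Kn; apply: contrapT => H.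
have {}H i : (i < n)%N ->
    (m%:E <= \int[mu]_(t in `[(a + i%:R * l)%R, (a + i.+1%:R * l)%R]) (f t)%:E)%E.
  by move=> ni; rewrite leNgt; apply/negP => /ltW h; apply: H; exists i.
have lower j : (j <= n)%N ->
    ((j%:R * m)%:E <= \int[mu]_(t in `[a, (a + j%:R * l)%R]) (f t)%:E)%E.
  elim: j => [_|j ih jn]; first by rewrite mul0r integral_ge0// => t _; rewrite lee_fin.
  rewrite (@integral_segment_cat f a (a + j%:R * l))//.
  - rewrite -[in leLHS]natr1 mulrDl mul1r EFinD.
    by apply: leeD; [exact: ih (ltnW jn)|exact: H].
  - by rewrite lerDl mulr_ge0.
  - by rewrite lerD2l ler_wpM2r// ler_nat.
have := fK (a + n%:R * l); rewrite lerDl mulr_ge0// => /(_ isT).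
by move=> /(le_trans (lower n (leqnn n))); rewrite lee_fin leNgt Kn.
Qed.

(** Truncating the functions to the segment reduces this to Minkowski's inequality on the line. The
    bounds are put on integrals of [p]-th powers, the form in which they occur later; [LF] and [inv]
    translate to norms. *)
Lemma minkowski_segment (p : R) f g h a b (al be : R) : 1 <= p ->
  0 <= al -> 0 <= be ->
  continuous f -> continuous g -> continuous h ->
  (forall t, 0 <= f t) -> (forall t, 0 <= g t) -> (forall t, 0 <= h t) ->
  (forall t, a <= t <= b -> h t <= f t + g t) ->
  (\int[mu]_(t in `[a, b]) (f t `^ p)%:E <= (al `^ p)%:E)%E ->
  (\int[mu]_(t in `[a, b]) (g t `^ p)%:E <= (be `^ p)%:E)%E ->
  (\int[mu]_(t in `[a, b]) (h t `^ p)%:E <= ((al + be) `^ p)%:E)%E.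
Proof.
move=> p1 al0 be0 fc gc hc f0 g0 h0 hfg fal gbe.
have p0 : 0 < p by exact: lt_le_trans p1.
have pn0 : p != 0 by rewrite gt_eqF.
pose F (k : R -> R) (t : R) : R := if t \in `[a, b]%classic then k t else 0.
have mF k : continuous k -> measurable_fun setT (F k).
  move=> kc; apply: measurable_fun_ifT => //.
  - apply: (measurable_fun_bool true); rewrite setTI.
    rewrite (_ : _ @^-1` _ = `[a, b]%classic); first exact: measurable_itv.
    by apply/seteqP; split => t /=; [move/set_mem|move/mem_set].
  - exact: continuous_measurable_fun.
have LF k : (forall t, 0 <= k t) ->
    ('N[mu]_p%:E[EFin \o F k] `^ p = \int[mu]_(t in `[a, b]) (k t `^ p)%:E)%E.
  move=> k0; rewrite (poweR_Lnorm _ _ pn0) [RHS]integral_mkcond; congr (integral _ _ _).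
  apply/funext => t; rewrite /F !patchE /=; case: ifPn => _.
    by rewrite ger0_norm.
  by rewrite normr0 powR0.
have L0 k : (0 <= 'N[mu]_p%:E[EFin \o F k])%E by exact: Lnorm_ge0.
have inv k K : (forall t, 0 <= k t) -> 0 <= K ->
    (\int[mu]_(t in `[a, b]) (k t `^ p)%:E <= (K `^ p)%:E)%E ->
    ('N[mu]_p%:E[EFin \o F k] <= K%:E)%E.
  move=> k0 K0; rewrite -(LF _ k0); move: (L0 k).
  case: ('N[mu]_p%:E[EFin \o F k])%E => [r r0||//]; last first.
    by rewrite poweRyr// leye_eq.
  rewrite poweR_EFin !lee_fin => h1; rewrite leNgt; apply/negP => Kr.
  move: h1; rewrite leNgt => /negP; apply.
  by rewrite gt0_ltr_powR// nnegrE// -lee_fin.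
rewrite -(LF _ h0) -poweR_EFin; apply: gt0_ler_poweR; first exact: ltW.
- by rewrite in_itv/= L0 leey.
- by rewrite in_itv/= lee_fin addr_ge0//= leey.
apply: (@le_trans _ _ ('N[mu]_p%:E[EFin \o (F f \+ F g)%R])%E).
  have Fh0 : (0 <= 'N[mu]_p%:E[EFin \o F h])%E by exact: Lnorm_ge0.
  rewrite unlock /=; apply: gt0_ler_poweR.
  - by rewrite invr_ge0 ltW.
  - by rewrite in_itv/= integral_ge0 ?leey// => t _; exact: poweR_ge0.
  - by rewrite in_itv/= integral_ge0 ?leey// => t _; exact: poweR_ge0.
  apply: le_integral_ae => [t _|t _|].
  - by rewrite lee_fin powR_ge0.
  - by rewrite lee_fin powR_ge0.
  - apply: nearW => t _ /=; rewrite lee_fin.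
    apply: ge0_ler_powR; rewrite ?nnegrE ?normr_ge0//; first exact: ltW.
    rewrite /F; case: ifPn => [/set_mem|_]; last by rewrite addr0.
    by rewrite /= in_itv/= => /hfg h1; rewrite !ger0_norm ?addr_ge0.
apply: le_trans.
  by apply: minkowski_EFin p1; exact: mF.
by rewrite EFinD leeD ?inv.
Qed.

End real_integrals.

Section lebesgue_norm.
Context {R : realType} {V : completeNormedModType R[i]}.
Local Notation mu := (@lebesgue_measure R).
Local Notation Rplus := (`[0, +oo[%classic : set R).

Lemma Lpnorm_le (p K : R) (f : R -> V) : 1 <= p -> 0 <= K ->
  (Lpnorm p f <= K%:E)%E <->
  (\int[mu]_(t in Rplus) (rnorm (f t) `^ p)%:E <= (K `^ p)%:E)%E.
Proof.
move=> p1 K0; have p0 : 0 < p by exact: lt_le_trans p1.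
have pn0 : p != 0 by rewrite gt_eqF.
have LE : (Lpnorm p f `^ p = \int[mu]_(t in Rplus) (rnorm (f t) `^ p)%:E)%E.
  rewrite (poweR_Lnorm _ _ pn0) [RHS]integral_mkcond; apply: eq_integral => t _.
  rewrite !patchE /=; case: ifPn => _ /=.
    by rewrite ger0_norm ?rnorm_ge0.
  by rewrite normr0 powR0.
have : (0 <= Lpnorm p f)%E by exact: Lnorm_ge0.
rewrite -LE; case: (Lpnorm p f) => [r||//].
  rewrite poweR_EFin !lee_fin => r0; split => [rK|].
    by apply: ge0_ler_powR; rewrite ?nnegrE// ltW.
  move=> h; rewrite leNgt; apply/negP => Kr.
  by move: h; rewrite leNgt gt0_ltr_powR// nnegrE.
by move=> _; rewrite poweRyr// !leye_eq.
Qed.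

End lebesgue_norm.

(** * Stability under small feedback *)

(** Evolution families are continuous only within the triangle [0 <= s <= t]; composing with a map
    that lands there recovers plain continuity. *)
Lemma continuous_within_comp (S1 S2 S3 : topologicalType) (A : set S2)
  (f : S2 -> S3) (h : S1 -> S2) : {within A, continuous f} -> continuous h ->
  (forall t, A (h t)) -> continuous (fun t => f (h t)).
Proof.
move=> /subspace_continuousP fc hc Ah t P /(fc _ (Ah t)) h1.
have /hc h2 : nbhs (h t) [set z | A z -> P (f z)] by exact: h1.
have : \forall z \near t, A (h z) -> P (f (h z)) by exact: h2.
by apply: filterS => z; exact.
Qed.

Lemma linear_unit_ball {R : realType} (V W : normedModType R[i])
  (f : {linear V -> W}) (K : R) : 0 <= K ->
  (forall x, rnorm x <= 1 -> rnorm (f x) <= K) ->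
  forall x, rnorm (f x) <= K * rnorm x.
Proof.
move=> K0 h; apply/(opnorm_le f K0); apply: ge_ereal_sup => _ [x /= x1 <-].
by rewrite lee_fin h.
Qed.

Lemma le_integral_restrict d (T : measurableType d) {R : realType}
  (mu : {measure set T -> \bar R}) (D E : set T) (f g : T -> \bar R) :
  (forall t, D t -> 0 <= f t)%E -> (forall t, E t -> 0 <= g t)%E ->
  (\forall t \ae mu, D t -> (f t <= if t \in E then g t else 0)%E) ->
  (\int[mu]_(t in D) f t <= \int[mu]_(t in E) g t)%E.
Proof.
move=> f0 g0 fg; rewrite integral_mkcond [leRHS]integral_mkcond.
apply: le_integral_ae => [t _|t _|].
- by rewrite patchE; case: ifPn => // /set_mem /f0.
- by rewrite patchE; case: ifPn => // /set_mem /g0.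
- apply: filterS fg => t fg _; rewrite !patchE; case: ifPn => [/set_mem /fg //|_].
  by case: ifPn => // /set_mem /g0.
Qed.

Section powR_integrals.
Context {R : realType}.
Local Notation mu := (@lebesgue_measure R).
Implicit Types (f : R -> R).

Lemma measurable_powR_EFin D (p : R) f : continuous f ->
  measurable_fun D (fun t => (f t `^ p)%:E).
Proof.
move=> fc; apply/measurable_EFinP; apply: measurable_funTS.
apply: (measurableT_comp (measurable_powR p)).
exact: continuous_measurable_fun.
Qed.

Lemma integral_powRZ (p k a b : R) f : 0 <= k -> continuous f ->
  (forall t, 0 <= f t) ->
  (\int[mu]_(t in `[a, b]) ((k * f t) `^ p)%:E =
   (k `^ p)%:E * \int[mu]_(t in `[a, b]) (f t `^ p)%:E)%E.
Proof.
move=> k0 fc f0; rewrite -ge0_integralZl_EFin//.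
- by congr integral; apply/funext => t; rewrite powRM// EFinM.
- by move=> t _; rewrite lee_fin powR_ge0.
- exact: measurable_powR_EFin.
- exact: powR_ge0.
Qed.

Lemma integral_powR_fin (p a b : R) f : 0 <= p -> a <= b -> continuous f ->
  (forall t, 0 <= f t) ->
  ((\int[mu]_(t in `[a, b]) (f t `^ p)%:E)%E \is a fin_num).
Proof.
move=> p0 ab fc f0; have [c cab fmax] := EVT_max ab (continuous_subspaceT fc).
rewrite ge0_fin_numE; last first.
  by apply: integral_ge0 => t _; rewrite lee_fin powR_ge0.
apply: (@le_lt_trans _ _ (\int[mu]_(t in `[a, b]) (cst (f c `^ p)%:E t))%E).
  apply: le_integral_ae => [t _|t _|].
  - by rewrite lee_fin powR_ge0.
  - by rewrite lee_fin powR_ge0.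
  - apply: nearW => t tab; rewrite lee_fin; apply: ge0_ler_powR; rewrite ?nnegrE//.
    exact: fmax.
rewrite integral_cst//=; have := mu_segment_fin a b; rewrite -ge0_fin_numE//.
by move=> /fineK <-; rewrite -EFinM ltry.
Qed.

End powR_integrals.

Section semigroup_theory.
Context {R : realType} {X : completeNormedModType R[i]}.
Variable T : R -> {linear X -> X}.
Hypothesis T_semigroup : C0_semigroup T.
Variables M w : R.
Hypothesis M0 : 0 <= M.
Hypothesis TM : forall t x, 0 <= t -> rnorm (T t x) <= M * expR (w * t) * rnorm x.
Hypothesis w0 : w <= 0.

Lemma semigroup_bound t x : 0 <= t -> rnorm (T t x) <= M * rnorm x.
Proof.
move=> t0; apply: (le_trans (TM _ t0)); rewrite ler_wpM2r ?rnorm_ge0//.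
by rewrite ler_piMr// -expR0 ler_expR mulr_le0_ge0.
Qed.

(** For [0 <= a <= b], [T b x - T a x = T a (T (b - a) x - x)], so continuity at every time follows
    from right continuity at 0 and the uniform bound [M]. Freezing time below 0 gives a function
    continuous on all of [R]. *)
Lemma semigroup_continuous x : continuous (fun t : R => T (Num.max 0 t) x).
Proof.
have [_ T0 TD Tc] := T_semigroup.
move=> t0; apply/cvg_rnormP => e e0.
have M1 : 0 < M + 1 by rewrite ltr_wpDl.
have e'0 : 0 < e / (M + 1) by rewrite divr_gt0.
have /cvg_rnormP/(_ _ e'0)[d /= d0 hd] := Tc x.
have diff a b : 0 <= a -> a <= b -> b - a < d -> rnorm (T b x - T a x) < e.
  move=> a0 ab bad; have [<-|ab'] := eqVneq a b.
    by rewrite subrr rnorm0.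
  have ba0 : 0 < b - a by rewrite subr_gt0 lt_neqAle ab'.
  have -> : T b x = T a (T (b - a) x) by rewrite -TD ?subrKC// ltW.
  rewrite -linearB (le_lt_trans (semigroup_bound _ a0))//.
  have : rnorm (T (b - a) x - x) < e / (M + 1).
    by apply: hd => //=; rewrite sub0r normrN gtr0_norm.
  rewrite ltr_pdivlMr// mulrC; apply: le_lt_trans.
  by rewrite ler_wpM2r ?rnorm_ge0// lerDl.
exists d => //= t tt0.
have mx : `|Num.max 0 t - Num.max 0 t0| < d.
  apply: le_lt_trans tt0; rewrite distrC.
  have := ler_norm (t0 - t); have := ler_norm (t - t0); rewrite [in X in X -> _]distrC.
  move: `|t0 - t| => k h1 h2; rewrite ler_norml !maxEle.
  by case: (leP 0 t0); case: (leP 0 t) => ??; lra.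
case: (leP (Num.max 0 t0) (Num.max 0 t)) => h.
  apply: diff => //; first by rewrite le_max lexx.
  by apply: le_lt_trans mx; exact: ler_norm.
rewrite rnorm_distC; apply: diff; [by rewrite le_max lexx|exact: ltW|].
by apply: le_lt_trans mx; rewrite distrC; exact: ler_norm.
Qed.

End semigroup_theory.

Section stability.
Context {R : realType} {X U Y : completeNormedModType R[i]}.
Local Notation mu := (@lebesgue_measure R).
Local Notation Rplus := (`[0, +oo[%classic : set R).
Variables (T : R -> {linear X -> X}) (B : {linear U -> X}) (C : {linear X -> Y}).
Hypothesis T_semigroup : C0_semigroup T.
Variables M w b c : R.
Hypothesis M1 : 1 <= M.
Hypothesis w0 : w < 0.
Hypothesis TM : forall t x, 0 <= t -> rnorm (T t x) <= M * expR (w * t) * rnorm x.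
Hypothesis B_bounded : continuous B.
Hypothesis b0 : 0 < b.
Hypothesis Bb : forall u, rnorm (B u) <= b * rnorm u.
Hypothesis C_bounded : continuous C.
Hypothesis c0 : 0 < c.
Hypothesis Cc : forall x, rnorm (C x) <= c * rnorm x.
Variables (Delta : R -> {linear Y -> U}) (r : R) (W : R -> R -> {linear X -> X}).
Hypothesis r0 : 0 <= r.
Hypothesis Delta_Linf : Linf_s Delta.
Hypothesis Delta_r : (Linfnorm Delta <= r%:E)%E.
Hypothesis W_perturbed : perturbed_family T B C Delta W.

Let M0 : 0 <= M. Proof. exact: le_trans M1. Qed.

(** One null set serves all [y], because the essential supremum is that of the operator norm; this
    matters when [y] is the output at the same time [t]. *)
Lemma Delta_ae : \forall t \ae mu, 0 <= t -> forall y, rnorm (Delta t y) <= r * rnorm y.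
Proof.
have := ess_sup_ge mu ((fun t => opnorm (Delta t)) \_ Rplus).
apply: filterS => t h t0; apply/(opnorm_le (Delta t) r0).
apply: le_trans Delta_r; move: h; rewrite patchE mem_set//=.
by rewrite in_itv/= t0.
Qed.

(** Constant before time [s], so that it is continuous on the whole line, as the integration lemmas
    require. *)
Definition output s x t : Y := C (W (Num.max s t) s x).

Lemma output_continuous s x : 0 <= s -> continuous (output s x).
Proof.
move=> s0 t; apply: cvg_image => //.
have [[_ _ _ Wc] _] := W_perturbed.
apply: (@continuous_within_comp _ _ _ _ (fun ts : R * R => W ts.1 ts.2 x)
  (fun t => (Num.max s t, s)) (Wc x)).
  move=> t'; suff mc : Num.max s t'' @[t'' --> t'] --> Num.max s t'.
    exact: (cvg_pair mc (cvg_cst s)).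
  apply: (@continuous_comp _ _ _ (fun t => (s, t)) (fun st : R * R => Num.max st.1 st.2)).
    exact: (cvg_pair (cvg_cst _) cvg_id).
  exact: max_continuous.
by move=> t' /=; split => //; rewrite le_max lexx.
Qed.

Lemma output_ge s x t : s <= t -> output s x t = C (W t s x).
Proof. by move=> st; rewrite /output max_r. Qed.

(** The equation is restarted at time [sg] from the state [W sg s x]; by the evolution law the
    output fed back is still that of the orbit issued from [s]. *)
Lemma perturbed_between s sg t x : 0 <= s -> s <= sg -> sg <= t ->
  exists2 v, is_bochner_integral `[sg, t]
      (fun tau => T (t - tau) (B (Delta tau (output s x tau)))) v &
    W t s x = T (t - sg) (W sg s x) + v.
Proof.
move=> s0 ssg sgt; have [[_ _ WD _] Weq] := W_perturbed.
have sg0 := le_trans s0 ssg.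
have [[v hv] E] := Weq (W sg s x) t sg sg0 sgt.
exists v.
  apply: is_bochner_integral_ae hv; apply: nearW => tau /=.
  rewrite in_itv/= => /andP[sgtau taut].
  by rewrite output_ge ?(le_trans ssg)// -(WD tau sg s).
rewrite (WD t sg s)// E; congr (_ + _).
by apply: bochner_integralE hv => //; exact: mu_segment_fin.
Qed.

Definition output_norm s x t : R := rnorm (output s x t).

Lemma output_norm_ge0 s x t : 0 <= output_norm s x t.
Proof. exact: rnorm_ge0. Qed.

Lemma output_norm_continuous s x : 0 <= s -> continuous (output_norm s x).
Proof. by move=> s0 t; apply: cvg_rnorm; exact: output_continuous. Qed.

(** The link from output to state: decay of the free semigroup together with smallness of the output
    makes the state small. *)
Lemma perturbed_output_bound s sg t x : 0 <= s -> s <= sg -> sg <= t ->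
  ((rnorm (W t s x))%:E <= (M * expR (w * (t - sg)) * rnorm (W sg s x))%:E +
   \int[mu]_(tau in `[sg, t])
     (M * b * r * (expR (w * (t - tau)) * output_norm s x tau))%:E)%E.
Proof.
move=> s0 ssg sgt; have [v hv ->] := perturbed_between x s0 ssg sgt.
rewrite (le_trans (_ : _ <= (rnorm (T (t - sg) (W sg s x)))%:E + (rnorm v)%:E)%E)//.
  by rewrite -EFinD lee_fin rnormD.
apply: leeD; first by rewrite lee_fin TM// subr_ge0.
have k0 tau : 0 <= M * b * r * (expR (w * (t - tau)) * output_norm s x tau).
  by rewrite !mulr_ge0 ?expR_ge0 ?rnorm_ge0// ltW.
apply: (rnorm_is_bochner_integral (measurable_itv _) (mu_segment_fin _ _) _ _ _ hv).
- apply: measurable_continuous_EFin => tau.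
  apply: cvgM; first exact: cvg_cst.
  apply: cvgM; last exact: output_norm_continuous.
  apply: (@continuous_comp _ _ _ (fun tau => w * (t - tau)) expR).
    apply: cvgM; first exact: cvg_cst.
    by apply: cvgB; [exact: cvg_cst|exact: cvg_id].
  exact: continuous_expR.
- by move=> tau _; rewrite lee_fin.
- apply: filterS Delta_ae => tau h; rewrite /= in_itv/= => /andP[sgtau taut].
  rewrite lee_fin (le_trans (TM _ _)) ?subr_ge0//.
  have tau0 : 0 <= tau by rewrite (le_trans s0)// (le_trans ssg).
  rewrite [leRHS](_ : _ = M * expR (w * (t - tau)) * (b * (r * output_norm s x tau))); last by ring.
  rewrite ler_wpM2l// ?mulr_ge0 ?expR_ge0// (le_trans (Bb _))// ler_wpM2l// ?(ltW b0)//.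
  exact: h.
Qed.

Lemma W_id s x : 0 <= s -> W s s x = x.
Proof. by move=> s0; have [[_ Wid _ _] _] := W_perturbed; exact: Wid. Qed.

(** Serves the case of infinite gain, where [r_stab] must still be shown to be at least 0; [r = 0]
    switches off the integral term. *)
Lemma exp_stable_of_zero : r = 0 -> exp_stable_family W.
Proof.
move=> rE; exists M, w; split => // t s s0 st.
apply/opnorm_le => [|x]; first by rewrite mulr_ge0 ?expR_ge0.
rewrite -lee_fin (le_trans (perturbed_output_bound x s0 (lexx s) st))// W_id//.
rewrite integral0_eq ?adde0// => tau _.
by rewrite rE mulr0 mul0r.
Qed.

(** * Output bound and decay under the gain condition [r * l < 1] *)

Section finite_gain.
Variables p l : R.
Hypothesis p1 : 1 <= p.
Hypothesis l0 : 0 <= l.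
Hypothesis gain : (Lp_opnorm p (io_operator T B C) <= l%:E)%E.
Hypothesis rl1 : r * l < 1.

Let p0 : 0 < p. Proof. exact: lt_le_trans p1. Qed.

(** The L^p norm over [[s, +oo[] of [c * M * expR (w * (t - s))], which dominates the free output of
    a unit vector. *)
Definition free_gain : R := (((c * M) `^ p) / - (w * p)) `^ p^-1.

Lemma free_output_bound s x N : 0 <= s -> s <= N -> rnorm x <= 1 ->
  (\int[mu]_(t in `[s, N]) (rnorm (C (T (Num.max 0 (t - s)) x)) `^ p)%:E <=
   (free_gain `^ p)%:E)%E.
Proof.
move=> s0 sN x1; have wp0 : w * p < 0 by rewrite nmulr_rlt0.
apply: (@le_trans _ _ (\int[mu]_(t in `[s, N])
    ((c * M) `^ p * expR (w * p * t + - (w * p * s)))%:E)%E).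
  apply: le_integral_ae => [t _|t _|].
  - by rewrite lee_fin powR_ge0.
  - by rewrite lee_fin mulr_ge0 ?powR_ge0 ?expR_ge0.
  - apply: nearW => t /=; rewrite in_itv/= => /andP[st tN].
    have -> : expR (w * p * t + - (w * p * s)) = expR (w * (t - s)) `^ p.
      by rewrite -expRM; congr expR; ring.
    rewrite lee_fin -powRM ?mulr_ge0 ?expR_ge0// ?(ltW c0)//.
    apply: ge0_ler_powR; rewrite ?nnegrE ?rnorm_ge0 ?(ltW p0)//.
      by rewrite !mulr_ge0 ?expR_ge0// ltW.
    rewrite max_r ?subr_ge0// (le_trans (Cc _))// -mulrA ler_wpM2l// ?(ltW c0)//.
    rewrite (le_trans (TM _ _)) ?subr_ge0//.
    by rewrite ler_piMr// mulr_ge0 ?expR_ge0.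
have mE : measurable_fun `[s, N]%classic (fun t => (expR (w * p * t + - (w * p * s)))%:E).
  apply: measurable_continuous_EFin => t.
  apply: (@continuous_comp _ _ _ (fun t => w * p * t + - (w * p * s)) expR).
    by apply: continuousD; [exact: mulrl_continuous|exact: cst_continuous].
  exact: continuous_expR.
under eq_integral do rewrite EFinM.
rewrite ge0_integralZl_EFin//; last exact: powR_ge0.
rewrite integral_expR_linear// ?lt_eqF// -EFinM lee_fin /free_gain.
rewrite -powRrM mulVf ?gt_eqF// powRr1; last first.
  by rewrite divr_ge0 ?powR_ge0// oppr_ge0 ltW.
rewrite ler_wpM2l ?powR_ge0// subrr expR0 invrN.
by rewrite -[X in X / _]opprB mulNr -mulrN ler_piMl ?oppr_ge0 ?invr_le0 ?(ltW wp0).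
Qed.

(** Up to time [N] the cut of the input at [N] is invisible, by causality, so the operator
    reproduces the feedback term of Duhamel's formula. The factor [a^-1] serves to bring the input
    into the unit ball over which the operator norm is a supremum. *)
Lemma io_operator_output s x N a t : 0 <= s -> 0 < a -> s <= t <= N ->
  io_operator T B C (fun tau => if tau \in `[s, N]%classic
    then (a^-1)%:C *: Delta tau (output s x tau) else 0) t =
  (a^-1)%:C *: (output s x t - C (T (Num.max 0 (t - s)) x)).
Proof.
move=> s0 a0 /andP[st tN]; have [v hv Wv] := perturbed_between x s0 (lexx s) st.
rewrite W_id// in Wv.
have -> : output s x t - C (T (Num.max 0 (t - s)) x) = C v.
  by rewrite output_ge// max_r ?subr_ge0// Wv linearD addrC addKr.
rewrite -linearZ /io_operator; congr (C _).
have sub : `[s, t] `<=` `[0, t].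
  by move=> tau /=; rewrite !in_itv/= => /andP[/(le_trans s0) -> ->].
pose k : R[i] := (a^-1)%:C.
have kc : continuous ( *:%R k : X -> X).
  apply: (linear_rnorm_continuous (M := `|a^-1|)) => z; rewrite rnormZr//.
apply: bochner_integralE => //; first exact: mu_segment_fin.
have := is_bochner_integral_linear (measurable_itv _) (mu_segment_fin s t) kc hv.
move=> /(is_bochner_integral_restrict (measurable_itv _) (measurable_itv _) sub
  (mu_segment_fin 0 t)).
apply: is_bochner_integral_ae; apply: nearW => tau; rewrite /= in_itv/= => /andP[tau0 taut].
rewrite !mem_setE !in_itv/= taut (le_trans taut tN) !andbT.
by case: ifP => _; [rewrite !linearZ|rewrite !linear0].
Qed.

Lemma output_Lp_bound s x N : 0 <= s -> s < N -> rnorm x <= 1 ->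
  (\int[mu]_(t in `[s, N]) (output_norm s x t `^ p)%:E <=
   ((free_gain / (1 - r * l)) `^ p)%:E)%E.
Proof.
move=> s0 sN x1; have sN' := ltW sN.
have pn0 : p != 0 by rewrite gt_eqF.
pose eta := output_norm s x.
have etac : continuous eta by exact: output_norm_continuous.
have eta0 t : 0 <= eta t by exact: output_norm_ge0.
(* Finite because the output is continuous on a compact segment; an infinite [q] could not be
   absorbed. *)
have Ifin := integral_powR_fin (ltW p0) sN' etac eta0.
pose I := fine (\int[mu]_(t in `[s, N]) (eta t `^ p)%:E)%E.
have IE : (\int[mu]_(t in `[s, N]) (eta t `^ p)%:E)%E = I%:E by rewrite fineK.
have I0 : 0 <= I.
  by apply: fine_ge0; apply: integral_ge0 => t _; rewrite lee_fin powR_ge0.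
pose q := I `^ p^-1.
have q0 : 0 <= q by exact: powR_ge0.
have qI : q `^ p = I by rewrite /q -powRrM mulVf// powRr1.
have g0 : 0 <= free_gain by exact: powR_ge0.
have root y z : 0 <= y -> 0 <= z -> y `^ p <= z `^ p -> y <= z.
  move=> y0 z0 yz; rewrite leNgt; apply/negP => zy.
  by move: yz; rewrite leNgt gt0_ltr_powR// nnegrE.
(* [a] stands for [r * q], the bound for the norm of the fed-back input. It is left free because it
   is divided by, whereas [r * q] may be 0. *)
have key a : 0 < a -> r * q <= a -> q <= a * l + free_gain.
  move=> a0 rqa.
  pose u tau := if tau \in `[s, N]%classic
    then (a^-1)%:C *: Delta tau (output s x tau) else 0.
  have um : strongly_measurable Rplus u.
    have [Dc Dm _] := Delta_Linf; apply: strongly_measurable_restrict => //.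
    have kc : continuous ( *:%R (a^-1)%:C : U -> U).
      apply: (linear_rnorm_continuous (M := `|a^-1|)) => z; rewrite rnormZr//.
    apply: (strongly_measurable_comp kc).
    apply: strongly_measurable_operator_comp => //.
    - by move=> t /andP[st _]; apply: Dc; exact: le_trans st.
    - move=> y; apply: strongly_measurableS (Dm y) => t /=.
      by rewrite !in_itv/= => /andP[/(le_trans s0) ->].
    - exact: output_continuous.
  have uL : (Lpnorm p u <= 1%:E)%E.
    apply/Lpnorm_le => //; rewrite powR1.
    apply: (@le_trans _ _ (\int[mu]_(t in `[s, N]) ((r / a * eta t) `^ p)%:E)%E).
      apply: le_integral_restrict => [t _|t _|].
      - by rewrite lee_fin powR_ge0.
      - by rewrite lee_fin powR_ge0.
      - apply: filterS Delta_ae => t h; rewrite /= in_itv/= andbT => t0.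
        rewrite /u; case: ifPn => _; last by rewrite rnorm0 powR0.
        rewrite lee_fin; apply: ge0_ler_powR; rewrite ?nnegrE ?(ltW p0) ?rnorm_ge0//.
          by rewrite mulr_ge0// divr_ge0// ltW.
        rewrite rnormZr gtr0_norm ?invr_gt0// [r / a]mulrC -mulrA.
        rewrite ler_wpM2l ?invr_ge0 ?(ltW a0)//.
        exact: h.
    rewrite integral_powRZ// ?divr_ge0 ?(ltW a0)// IE -EFinM lee_fin -qI.
    rewrite -powRM ?divr_ge0 ?(ltW a0)//.
    suff : (r / a * q) `^ p <= 1 `^ p by rewrite powR1.
    apply: ge0_ler_powR; rewrite ?nnegrE ?(ltW p0)// ?mulr_ge0 ?invr_ge0 ?(ltW a0)//.
    by rewrite mulrAC ler_pdivrMr// mul1r.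
  have : (Lpnorm p (io_operator T B C u) <= l%:E)%E.
    by apply: le_trans gain; apply: ereal_sup_ubound; exists u.
  move/(Lpnorm_le _ p1 l0) => ioL.
  pose free t := C (T (Num.max 0 (t - s)) x).
  have freec : continuous free.
    move=> t; apply: cvg_image => //.
    apply: (@continuous_comp _ _ _ (fun t => t - s) (fun t => T (Num.max 0 t) x)).
      by apply: cvgB; [exact: cvg_id|exact: cvg_cst].
    exact: (semigroup_continuous T_semigroup M0 TM (ltW w0)).
  pose f t := rnorm (output s x t - free t).
  have fc : continuous f.
    move=> t; apply: cvg_rnorm; apply: cvgB; last exact: freec.
    exact: output_continuous.
  have f0 t : 0 <= f t by exact: rnorm_ge0.
  have fL : (\int[mu]_(t in `[s, N]) ((a^-1 * f t) `^ p)%:E <= (l `^ p)%:E)%E.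
    apply: le_trans ioL; apply: le_integral_restrict => [t _|t _|].
    - by rewrite lee_fin powR_ge0.
    - by rewrite lee_fin powR_ge0.
    - apply: nearW => t; rewrite /= in_itv/= => stN.
      rewrite mem_setE in_itv/= (le_trans s0) ?(andP stN).1//=.
      rewrite lee_fin /u io_operator_output// rnormZr gtr0_norm ?invr_gt0//.
  have fal : (\int[mu]_(t in `[s, N]) (f t `^ p)%:E <= ((a * l) `^ p)%:E)%E.
    rewrite powRM ?(ltW a0)// EFinM.
    have -> : (\int[mu]_(t in `[s, N]) (f t `^ p)%:E =
        (a `^ p)%:E * \int[mu]_(t in `[s, N]) ((a^-1 * f t) `^ p)%:E)%E.
      rewrite integral_powRZ ?invr_ge0 ?(ltW a0)// muleA -EFinM.
      by rewrite -powRM ?invr_ge0 ?(ltW a0)// mulfV ?gt_eqF// powR1 mul1e.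
    by apply: lee_wpmul2l => //; rewrite lee_fin powR_ge0.
  have freeL := free_output_bound s0 sN' x1.
  have al0 : 0 <= a * l by rewrite mulr_ge0// ltW.
  (* The output is the sum of the forced part, of norm at most [a * l], and of the free part. *)
  have := @minkowski_segment _ p f (fun t => rnorm (free t)) eta s N (a * l) free_gain
    p1 al0 g0 fc _ etac f0 _ eta0 _ fal freeL.
  rewrite IE lee_fin -qI => h; apply: root => //; first by rewrite addr_ge0.
  apply: h => [t|t|t _].
  - by apply: cvg_rnorm; exact: freec.
  - exact: rnorm_ge0.
  - by rewrite /eta /output_norm /f -{1}(subrK (free t) (output s x t)) rnormD.
have l10 : 0 < l + 1 by rewrite ltr_wpDl.
have rl10 : 0 < 1 - r * l by rewrite subr_gt0.
have qg : q <= free_gain / (1 - r * l).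
  rewrite ler_pdivlMr//; apply/ler_addgt0Pr => e e0.
  (* Taking [a = r * q + e / (l + 1)] keeps [a] positive and costs at most [e], since
     [e / (l + 1) * l <= e]. *)
  have e'0 : 0 < e / (l + 1) by rewrite divr_gt0.
  have := key (r * q + e / (l + 1)).
  rewrite ltr_wpDl ?mulr_ge0// lerDl (ltW e'0) => /(_ isT isT).
  have : e / (l + 1) * l <= e.
    by rewrite mulrAC ler_pdivrMr// ler_wpM2l ?(ltW e0)// lerDl.
  nra.
rewrite -/eta IE lee_fin -qI; apply: ge0_ler_powR; rewrite ?nnegrE ?(ltW p0)//.
by rewrite divr_ge0// ltW.
Qed.

Definition output_gain : R := (free_gain / (1 - r * l)) `^ p.

Lemma output_Lp_bound_le s x N : 0 <= s -> s <= N -> rnorm x <= 1 ->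
  (\int[mu]_(t in `[s, N]) (output_norm s x t `^ p)%:E <= output_gain%:E)%E.
Proof.
move=> s0 sN x1; have sN1 : s < N + 1 by rewrite (le_lt_trans sN)// ltrDl.
apply: le_trans (output_Lp_bound s0 sN1 x1).
apply: ge0_subset_integral => //.
- by apply: measurable_powR_EFin; exact: output_norm_continuous.
- by move=> t _; rewrite lee_fin powR_ge0.
- move=> t /=; rewrite !in_itv/= => /andP[-> tN]; rewrite (le_trans tN)//.
  by rewrite lerDl.
Qed.

(** The Duhamel integral is estimated by [e * y <= e + y ^ p] for [0 <= e <= 1] (distinguish
    [y <= 1] and [y > 1]), which treats all [p >= 1] alike: the exponential contributes [(- w)^-1]
    and the output [output_gain]. *)
Definition family_bound : R := M + M * b * r * ((- w)^-1 + output_gain).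

Lemma output_gain_ge0 : 0 <= output_gain. Proof. exact: powR_ge0. Qed.

Lemma family_bound_gt0 : 0 < family_bound.
Proof.
rewrite ltr_pwDl ?(lt_le_trans ltr01 M1)//.
rewrite mulr_ge0 ?addr_ge0 ?output_gain_ge0//.
  by rewrite !mulr_ge0// ltW.
by rewrite invr_ge0 oppr_ge0 ltW.
Qed.

Lemma family_bounded s t x : 0 <= s -> s <= t ->
  rnorm (W t s x) <= family_bound * rnorm x.
Proof.
move=> s0 st; apply: linear_unit_ball; first exact: ltW family_bound_gt0.
move=> {}x x1; rewrite -lee_fin (le_trans (perturbed_output_bound x s0 (lexx s) st))//.
rewrite W_id// /family_bound EFinD; apply: leeD.
  rewrite lee_fin -mulrA ler_piMr// mulr_ile1 ?expR_ge0 ?rnorm_ge0//.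
  by rewrite -expR0 ler_expR mulr_le0_ge0 ?(ltW w0) ?subr_ge0.
have mbr0 : 0 <= M * b * r by rewrite !mulr_ge0// ltW.
have ec : continuous (fun tau => expR (- w * tau + w * t)).
  move=> tau.
  apply: (@continuous_comp _ _ _ (fun tau => - w * tau + w * t) expR).
    by apply: continuousD; [exact: mulrl_continuous|exact: cst_continuous].
  exact: continuous_expR.
have etac : continuous (output_norm s x) by exact: output_norm_continuous.
apply: (@le_trans _ _ (\int[mu]_(tau in `[s, t]) ((M * b * r)%:E *
    ((expR (- w * tau + w * t))%:E + (output_norm s x tau `^ p)%:E)))%E).
  apply: le_integral_ae => [tau _|tau _|].
  - by rewrite lee_fin !mulr_ge0 ?expR_ge0 ?rnorm_ge0// ltW.
  - by rewrite mule_ge0 ?adde_ge0 ?lee_fin ?expR_ge0 ?powR_ge0.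
  - apply: nearW => tau /=; rewrite in_itv/= => /andP[stau taut].
    rewrite -EFinD -EFinM lee_fin ler_wpM2l//.
    have -> : - w * tau + w * t = w * (t - tau) by ring.
    have : expR (w * (t - tau)) <= 1.
      by rewrite -expR0 ler_expR mulr_le0_ge0 ?(ltW w0) ?subr_ge0.
    have := expR_ge0 (w * (t - tau)); have := output_norm_ge0 s x tau.
    have := powR_ge0 (output_norm s x tau) p.
    have : 1 <= output_norm s x tau -> output_norm s x tau <= output_norm s x tau `^ p.
      by move=> h; rewrite -{1}(powRr1 (output_norm_ge0 s x tau)) ler_powR.
    move: (output_norm s x tau) (_ `^ _) (expR _) => y yp e h yp0 y0 e0 e1.
    case: (leP 1 y) => [/h|]; nra.
rewrite ge0_integralZl_EFin//; last 2 first.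
- by move=> tau _; rewrite adde_ge0// lee_fin ?expR_ge0 ?powR_ge0.
- by apply: emeasurable_funD;
    [exact: measurable_continuous_EFin|exact: measurable_powR_EFin].
rewrite [X in (_ <= X)%E]EFinM; apply: lee_wpmul2l; first by rewrite lee_fin.
rewrite ge0_integralD//; last 3 first.
- exact: measurable_continuous_EFin.
- by move=> tau _; rewrite lee_fin powR_ge0.
- exact: measurable_powR_EFin.
rewrite EFinD; apply: leeD; last exact: output_Lp_bound_le.
rewrite integral_expR_linear// ?oppr_eq0 ?lt_eqF// lee_fin.
rewrite mulNr addNr expR0 ler_piMl//; first by rewrite invr_ge0 oppr_ge0 ltW.
Qed.

(* Of [n] adjacent cells of length [el] after [s] one carries little output, so
   that across it the orbit decays almost like the free one. *)
Lemma family_contraction :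
  exists2 L, 0 < L & forall s x, 0 <= s -> rnorm (W (s + L) s x) <= 2^-1 * rnorm x.
Proof.
pose K := family_bound; have K0 : 0 < K by exact: family_bound_gt0.
pose c1 := M * b * r; have c10 : 0 <= c1 by rewrite !mulr_ge0// ltW.
have Mgt0 : 0 < M by exact: lt_le_trans M1.
(* Three budgets add up to 1/2: the free part over a cell gets 1/4, the two parts of the output
   integral 1/8 each. For this [A], [expR (- A) <= A^-1] gives exactly the 1/4. *)
pose A := 4 * M * K * K; have A0 : 0 < A by rewrite !mulr_gt0.
pose el := A / - w; have el0 : 0 < el by rewrite divr_gt0// oppr_gt0.
have expA : K * (M * expR (w * el) * K) <= 4^-1.
  have -> : w * el = - A by rewrite /el; field; rewrite lt_eqF.
  have h1 := expR_ge1Dx A; have e0 := expR_gt0 A.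
  rewrite expRN [leLHS](_ : _ = 4^-1 * (A / expR A)); last first.
    by rewrite /A; field; rewrite gt_eqF.
  rewrite ler_piMr// ler_pdivrMr// mul1r (le_trans _ h1)// lerDr//.
have Kc1 : 0 <= K * c1 by rewrite mulr_ge0// ltW.
have small z : 0 <= z -> exists2 d, 0 < d & K * (c1 * (d * z)) <= 8^-1.
  move=> z0; have h : 0 < K * c1 * z + 1 by rewrite ltr_wpDl// mulr_ge0.
  exists (8 * (K * c1 * z + 1))^-1; first by rewrite invr_gt0 mulr_gt0.
  rewrite [leLHS](_ : _ = 8^-1 * (K * c1 * z / (K * c1 * z + 1))); last first.
    by field; rewrite gt_eqF.
  by rewrite ler_piMr// ler_pdivrMr// mul1r lerDl.
have [d d0 dE] := small el (ltW el0).
(* Chosen for [y <= d + D * y ^ p]: if [y > d], then [y / d <= (y / d) ^ p]. So a small integral of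
   [y ^ p] over the cell makes the integral of [y] small, up to [d * el]. *)
pose D := d * d^-1 `^ p; have D0 : 0 <= D by rewrite mulr_ge0 ?powR_ge0// ltW.
have [m m0 mE'] := small D D0.
have mE : K * (c1 * (D * m)) <= 8^-1 by rewrite [D * m]mulrC.
(* If all of [n] cells carried more than [m], the total output would exceed [output_gain]. *)
pose n := (Num.truncn (output_gain / m)).+1.
have nm : output_gain < n%:R * m by rewrite -ltr_pdivrMr// truncnS_gt.
exists (n%:R * el); first by rewrite mulr_gt0// ltr0n.
move=> s x0 s0; apply: linear_unit_ball => // x x1; clear x0.
have etac : continuous (output_norm s x) by exact: output_norm_continuous.
have [i ni cell] : exists2 i, (i < n)%N & (\int[mu]_(t in
    `[(s + i%:R * el)%R, (s + i.+1%:R * el)%R]) (output_norm s x t `^ p)%:E <= m%:E)%E.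
  apply: (small_integral_cell (ltW el0) _ _ _ nm).
  - exact: measurable_powR_EFin.
  - by move=> t; exact: powR_ge0.
  - by move=> N sN; exact: output_Lp_bound_le.
pose sg := s + i%:R * el; pose ta := s + i.+1%:R * el.
have taE : ta - sg = el by rewrite /ta /sg -natr1; ring.
have ssg : s <= sg by rewrite lerDl mulr_ge0// ltW.
have sgta : sg <= ta by rewrite -subr_ge0 taE ltW.
have taL : ta <= s + n%:R * el by rewrite lerD2l ler_wpM2r ?(ltW el0)// ler_nat.
have Wta : rnorm (W ta s x) <= M * expR (w * el) * K + c1 * (d * el + D * m).
  rewrite -lee_fin EFinD (le_trans (perturbed_output_bound x s0 ssg sgta))// taE.
  apply: leeD.
    rewrite lee_fin ler_wpM2l ?mulr_ge0 ?expR_ge0//.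
    by rewrite (le_trans (family_bounded x s0 ssg))// ler_piMr// ltW.
  apply: (@le_trans _ _ (\int[mu]_(tau in `[sg, ta]) (c1%:E *
      ((cst d%:E tau) + D%:E * (output_norm s x tau `^ p)%:E)))%E).
    apply: le_integral_ae => [tau _|tau _|].
    - by rewrite lee_fin !mulr_ge0 ?expR_ge0 ?rnorm_ge0// ltW.
    - by rewrite mule_ge0 ?adde_ge0 ?mule_ge0 ?lee_fin ?powR_ge0// ltW.
    - apply: nearW => tau /=; rewrite in_itv/= => /andP[sgtau tauta].
      change ((M * b * r * (expR (w * (ta - tau)) * output_norm s x tau))%:E <=
        (c1 * (d + D * output_norm s x tau `^ p))%:E)%E.
      rewrite lee_fin ler_wpM2l//.
      have y0 := output_norm_ge0 s x tau.
      rewrite (le_trans (_ : _ <= output_norm s x tau))//.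
        by rewrite ler_piMl// -expR0 ler_expR mulr_le0_ge0 ?(ltW w0) ?subr_ge0.
      case: (leP (output_norm s x tau) d) => [yd|dy].
        by rewrite (le_trans yd)// lerDl mulr_ge0 ?powR_ge0.
      rewrite (le_trans (_ : _ <= D * output_norm s x tau `^ p)) ?lerDr ?(ltW d0)//.
      rewrite /D -mulrA -powRM ?invr_ge0 ?(ltW d0)// -ler_pdivrMl//.
      rewrite -{1}(powRr1 (_ : 0 <= d^-1 * output_norm s x tau)) ?mulr_ge0 ?invr_ge0 ?(ltW d0)//.
      by rewrite ler_powR// mulrC ler_pdivlMr// mul1r ltW.
  have mp : measurable_fun `[sg, ta]%classic (fun tau => (output_norm s x tau `^ p)%:E).
    exact: measurable_powR_EFin.
  have mDp : measurable_fun `[sg, ta]%classic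
      (fun tau => D%:E * (output_norm s x tau `^ p)%:E)%E.
    by apply: emeasurable_funM => //; exact: measurable_cst.
  rewrite ge0_integralZl_EFin//; last 2 first.
  - by move=> tau _; rewrite adde_ge0 ?mule_ge0 ?lee_fin ?powR_ge0// ltW.
  - by apply: emeasurable_funD => //; exact: measurable_cst.
  rewrite [X in (_ <= X)%E]EFinM; apply: lee_wpmul2l; first by rewrite lee_fin.
  rewrite ge0_integralD//; last 2 first.
  - by move=> tau _; rewrite lee_fin ltW.
  - by move=> tau _; rewrite mule_ge0 ?lee_fin ?powR_ge0.
  rewrite EFinD; apply: leeD.
    rewrite integral_cst//= lebesgue_measure_itv/= lte_fin -EFinB taE.
    by case: ifP => _; rewrite ?mule0 ?lee_fin// mulr_ge0// ltW.
  rewrite ge0_integralZl_EFin//; last by move=> tau _; rewrite lee_fin powR_ge0.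
  by rewrite [X in (_ <= X)%E]EFinM; apply: lee_wpmul2l => //; rewrite lee_fin.
(* The position of the good cell depends on [s] and [x]; from its end the uniform bound [K] carries
   the estimate to the common time [s + n%:R * el]. *)
have [[_ _ WD _] _] := W_perturbed.
have ta0 : 0 <= ta by rewrite (le_trans s0)// (le_trans ssg).
rewrite (WD _ ta s)//; last exact: le_trans sgta.
apply: (le_trans (family_bounded _ ta0 taL)); rewrite -/K.
apply: (@le_trans _ _ (K * (M * expR (w * el) * K + c1 * (d * el + D * m)))).
  by rewrite ler_wpM2l// ltW.
rewrite mulrDr [c1 * (_ + _)]mulrDr [K * (_ + _)]mulrDr.
move: expA dE mE.
by move: (K * (_ * K)) (K * (c1 * (d * _))) (K * (c1 * (D * m))) => y1 y2 y3; lra.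
Qed.

Lemma exp_stable_of_gain : exp_stable_family W.
Proof.
have [L L0 LW] := family_contraction; pose K := family_bound.
have K0 : 0 < K by exact: family_bound_gt0.
have [[_ _ WD _] _] := W_perturbed.
have iter n s x : 0 <= s -> rnorm (W (s + n%:R * L) s x) <= 2^-1 ^+ n * rnorm x.
  move=> s0; elim: n => [|n ih]; first by rewrite mul0r addr0 W_id// expr0 mul1r.
  have nL : 0 <= n%:R * L by rewrite mulr_ge0// ltW.
  have E : s + n.+1%:R * L = s + n%:R * L + L by rewrite -natr1; ring.
  rewrite E (WD _ (s + n%:R * L) s)//; last 2 first.
  - by rewrite lerDl.
  - by rewrite lerDl ltW.
  rewrite (le_trans (LW _ _ _)) ?addr_ge0// exprS -mulrA ler_wpM2l//.
have ln20 : 0 < ln (2 : R) by rewrite ln_gt0// ltr1n.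
(* Halving in each period [L] means the rate [ln 2 / L]; the factor 2 pays for the incomplete last
   period, since [2^-1 ^+ n = 2 * 2^-1 ^+ n.+1]. *)
exists (Num.max 1 (2 * K)), (- (ln 2 / L)); split.
- by rewrite le_max lexx.
- by rewrite oppr_lt0 divr_gt0.
move=> t s s0 st; apply/opnorm_le => [|x].
  by rewrite mulr_ge0 ?expR_ge0// le_max ler01.
pose n := Num.truncn ((t - s) / L).
have ts0 : 0 <= (t - s) / L by rewrite divr_ge0 ?subr_ge0// ltW.
have /andP[n1 n2] := truncn_itv ts0.
have nt : s + n%:R * L <= t by rewrite -lerBrDl -ler_pdivlMr.
have nL : 0 <= n%:R * L by rewrite mulr_ge0// ltW.
rewrite (WD t (s + n%:R * L) s)//; last by rewrite lerDl.
apply: (le_trans (family_bounded _ _ nt)); first by rewrite addr_ge0.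
apply: (@le_trans _ _ (K * (2^-1 ^+ n * rnorm x))).
  by rewrite ler_wpM2l ?(ltW K0)// iter.
rewrite mulrA ler_wpM2r ?rnorm_ge0//.
apply: (@le_trans _ _ (2 * K * expR (- (ln 2 / L) * (t - s)))); last first.
  by rewrite ler_wpM2r ?expR_ge0// le_max lexx orbT.
rewrite mulrAC mulrC ler_wpM2r ?(ltW K0)//.
have -> : 2^-1 ^+ n = 2 * expR (- (ln 2) * n.+1%:R) :> R.
  rewrite expRM powR_mulrn ?expR_ge0// expRN lnK ?posrE//.
  by rewrite exprS mulrA mulfV// mul1r.
rewrite ler_wpM2l// ler_expR !mulNr lerN2 -mulrA ler_wpM2l ?(ltW ln20)//.
by rewrite mulrC ltW.
Qed.

End finite_gain.

End stability.

(** * Norming functionals *)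

Section hahn_banach.
Context {R : realType} {V : normedModType R[i]}.
Implicit Types (z y : V) (a c k : R) (G : set (V * R)).

(** Partial functionals are represented by their graphs, ordered by inclusion, so that Zorn's lemma
    can take unions of chains. Scalars are real here; the complex functional is built afterwards. *)
Definition linear_graph G := forall k z z' a a', G (z, a) -> G (z', a') ->
  G (k%:C *: z + z', k * a + a').

Definition dominated_graph G := forall z a, G (z, a) -> a <= rnorm z.

(** The last clause is conditional so that the empty graph, which is the union of the empty chain,
    qualifies. *)
Definition extends_line y G :=
  [/\ linear_graph G, dominated_graph G & forall za, G za -> G (y, rnorm y)].

Lemma extends_line_base y :
  extends_line y [set za | exists k, za = (k%:C *: y, k * rnorm y)].
Proof.
split.
- move=> k z z' a a' [m [-> ->]] [m' [-> ->]]; exists (k * m + m').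
  by rewrite rmorphD rmorphM scalerDl scalerA mulrDl mulrA.
- move=> z a [k [-> ->]]; rewrite rnormZr ler_wpM2r ?rnorm_ge0//.
  exact: ler_norm.
- by move=> _ _; exists 1; rewrite mul1r scale1r.
Qed.

(** A value [c] at [z] keeps the graph dominated if it lies between all [a - rnorm (z' - z)] and all
    [rnorm (z' + z) - a]. The triangle inequality leaves room, and [c] is the supremum of the lower
    bounds. Other multiples of [z] reduce to the coefficients 1 and -1 by scaling. *)
Lemma extends_line_step y G z : extends_line y G -> G (y, rnorm y) ->
  (forall a, ~ G (z, a)) -> exists G', [/\ extends_line y G', G `<=` G' &
    exists a, G' (z, a)].
Proof.
move=> [Glin Gdom _] Gy Gz.
have G0 : G (0, 0).
  have := Glin (-1) _ _ _ _ Gy Gy.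
  by rewrite rmorphN1 scaleN1r addNr mulN1r addNr.
have GZ k z' a : G (z', a) -> G (k%:C *: z', k * a).
  by move=> h; have := Glin k _ _ _ _ h G0; rewrite !addr0.
pose S := [set s | exists z' a, G (z', a) /\ s = a - rnorm (z' - z)].
have bound z1 a1 z2 a2 : G (z1, a1) -> G (z2, a2) ->
    a1 - rnorm (z1 - z) <= rnorm (z2 + z) - a2.
  move=> h1 h2; have := Gdom _ _ (Glin 1 _ _ _ _ h1 h2).
  have -> : 1%:C *: z1 + z2 = (z1 - z) + (z2 + z).
    by rewrite scale1r [z2 + z]addrC addrA subrK.
  by have := rnormD (z1 - z) (z2 + z); lra.
have Ssup : has_sup S.
  split; first by exists (0 - rnorm (0 - z)), 0, 0.
  exists (rnorm (0 + z) - 0) => _ [z' [a [h ->]]]; exact: bound.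
pose c := sup S.
have c1 z' a : G (z', a) -> a - rnorm (z' - z) <= c.
  by move=> h; apply: ub_le_sup; [case: Ssup|exists z', a].
have c2 z' a : G (z', a) -> c <= rnorm (z' + z) - a.
  move=> h; apply: ge_sup; first by case: Ssup.
  by move=> _ [z1 [a1 [h1 ->]]]; exact: bound.
exists [set za | exists z' a k, G (z', a) /\ za = (z' + k%:C *: z, a + k * c)].
split; first split.
- move=> k _ _ _ _ [z1 [a1 [k1 [h1 [-> ->]]]]] [z2 [a2 [k2 [h2 [-> ->]]]]].
  exists (k%:C *: z1 + z2), (k * a1 + a2), (k * k1 + k2); split; first exact: Glin.
  congr pair; last by ring.
  by rewrite scalerDr scalerA addrACA -scalerDl -rmorphM -rmorphD.
- move=> _ _ [z' [a [k [h [-> ->]]]]].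
  case: (ltgtP k 0) => [k0|k0|->]; last first.
  + by rewrite mul0r addr0 scale0r addr0; exact: Gdom.
  + have := c2 _ _ (GZ k^-1 _ _ h).
    have -> : k^-1%:C *: z' + z = k^-1%:C *: (z' + k%:C *: z).
      by rewrite scalerDr scalerA -rmorphM mulVf ?gt_eqF// scale1r.
    rewrite rnormZr gtr0_norm ?invr_gt0// -mulrBr mulrC ler_pdivlMr//.
    by rewrite lerBrDl [c * k]mulrC.
  + have := c1 _ _ (GZ (- k^-1) _ _ h).
    have -> : (- k^-1)%:C *: z' - z = (- k^-1)%:C *: (z' + k%:C *: z).
      by rewrite scalerDr scalerA -rmorphM mulNr mulVf ?lt_eqF// rmorphN1 scaleN1r.
    rewrite rnormZr gtr0_norm ?oppr_gt0 ?invr_lt0// -mulrBr -invrN mulrC.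
    rewrite ler_pdivrMr ?oppr_gt0//.
    by rewrite lerBlDr mulrN -lerBlDl opprK [c * k]mulrC.
- by move=> _ _; exists y, (rnorm y), 0; rewrite scale0r !mul0r !addr0.
- by move=> [z' a] h; exists z', a, 0; rewrite scale0r !mul0r !addr0.
- by exists c, 0, 0, 1; rewrite scale1r mul1r !add0r.
Qed.

Lemma real_hahn_banach y : exists f : V -> R,
  [/\ forall k z z', f (k%:C *: z + z') = k * f z + f z',
      forall z, f z <= rnorm z & f y = rnorm y].
Proof.
have [|A [[Alin Adom Ay] Amax]] := @Zorn_bigcup _ (extends_line y).
  move=> F FP Ftot; split.
  - move=> k z z' a a' [G1 FG1 h1] [G2 FG2 h2].
    have [G12|G21] := Ftot _ _ FG1 FG2.
      by exists G2 => //; have [l _ _] := FP _ FG2; apply: l => //; exact: G12.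
    by exists G1 => //; have [l _ _] := FP _ FG1; apply: l => //; exact: G21.
  - by move=> z a [G FG h]; have [_ d _] := FP _ FG; exact: d h.
  - by move=> za [G FG h]; exists G => //; have [_ _ d] := FP _ FG; exact: d h.
(* A maximal graph is not empty, since the line through [y] properly extends the empty one. *)
have {}Ay : A (y, rnorm y).
  apply: contrapT => nAy; apply: (Amax _ _ (extends_line_base y)).
  have A0 za : ~ A za by move=> /Ay.
  split; first by move=> za /A0.
  move=> /(_ (y, rnorm y)) h; apply: nAy; apply: h; exists 1.
  by rewrite scale1r mul1r.
have total z : exists a, A (z, a).
  apply: contrapT => nA.
  have [|A' [A'P AA' [a A'z]]] := extends_line_step (And3 Alin Adom (fun _ _ => Ay)) Ay (z := z).
    by move=> a Aza; apply: nA; exists a.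
  apply: (Amax _ _ A'P); split => // /(_ _ A'z) h; apply: nA; by exists a.
have [f fA] := choice total.
have A0 : A (0, 0).
  have := Alin (-1) _ _ _ _ Ay Ay.
  by rewrite rmorphN1 scaleN1r addNr mulN1r addNr.
(* Two values at [z] put their difference above the vector 0, where domination forces it to be at
   most 0. *)
have Afun z a a' : A (z, a) -> A (z, a') -> a = a'.
  move=> h h'; have le u u' : A (z, u) -> A (z, u') -> u <= u'.
    move=> hu hu'; have := Alin (-1) _ _ _ _ hu' hu.
    rewrite rmorphN1 scaleN1r addNr mulN1r => /Adom.
    by rewrite rnorm0 addrC subr_le0.
  by apply: le_anti; rewrite !le.
exists f; split.
- by move=> k z z'; apply: Afun (fA _) _; apply: Alin.
- by move=> z; apply: Adom.
- exact: Afun (fA _) Ay.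
Qed.

(* The complex functional with real part [f] is [z |-> f z - i f (i z)]; its
   modulus at [z] is the value of [f] at a rotation of [z]. *)
Lemma hahn_banach y : exists phi : V -> R[i],
  [/\ forall (al : R[i]) z z', phi (al *: z + z') = al * phi z + phi z',
      forall z, complex.Re `|phi z| <= rnorm z & phi y = (rnorm y)%:C].
Proof.
have [f [flin fle fy]] := real_hahn_banach y.
have f0 : f 0 = 0.
  by have := flin 1 0 0; rewrite scaler0 addr0 mul1r; lra.
have fD z z' : f (z + z') = f z + f z'.
  by have := flin 1 z z'; rewrite scale1r mul1r.
have fZ k z : f (k%:C *: z) = k * f z.
  by have := flin k z 0; rewrite !addr0 f0 addr0.
have fN z : f (- z) = - f z.
  by have := fZ (-1) z; rewrite rmorphN1 scaleN1r mulN1r.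
pose phi z : R[i] := Complex (f z) (- f ('i%C *: z)).
have phiD z z' : phi (z + z') = phi z + phi z'.
  by rewrite /phi scalerDr !fD opprD.
have phiZ (al : R[i]) z : phi (al *: z) = al * phi z.
  case: al => a b.
  have aE : (a +i* b)%C = a%:C + 'i%C * b%:C.
    by apply/eqP; rewrite eq_complex /=; apply/andP; split; apply/eqP; ring.
  rewrite aE scalerDl phiD mulrDl; congr (_ + _).
    rewrite /phi scalerA [_ * a%:C]mulrC -scalerA !fZ.
    by apply/eqP; rewrite eq_complex /=; apply/andP; split; apply/eqP; ring.
  have ii : 'i%C * ('i%C * b%:C) = (- b)%:C.
    by apply/eqP; rewrite eq_complex /=; apply/andP; split; apply/eqP; ring.
  rewrite /phi scalerA ii fZ ['i%C * _]mulrC -scalerA fZ.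
  by apply/eqP; rewrite eq_complex /=; apply/andP; split; apply/eqP; ring.
have phile z : complex.Re `|phi z| <= rnorm z.
  have [->|pz0] := eqVneq (phi z) 0; first by rewrite normr0 rnorm_ge0.
  pose u := `|phi z| / phi z.
  have nu : `|u| = 1 by rewrite /u normrM normfV normr_id mulfV// normr_eq0.
  have -> : complex.Re `|phi z| = f (u *: z).
    by rewrite -[RHS]/(complex.Re (phi (u *: z))) phiZ divfK.
  by apply: (le_trans (fle _)); rewrite rnormZ nu mul1r.
exists phi; split => //; first by move=> al z z'; rewrite phiD phiZ.
(* The real part of [phi y] already equals [rnorm y], the bound for its modulus, so the imaginary
   part vanishes. *)
have := phile y; rewrite normc_def /= fy => h.
apply/eqP; rewrite eq_complex /= fy eqxx /= oppr_eq0.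
have y0 := rnorm_ge0 y.
have : Num.sqrt (rnorm y ^+ 2 + (- f ('i%C *: y)) ^+ 2) ^+ 2 <= rnorm y ^+ 2.
  by rewrite ler_sqr ?nnegrE ?sqrtr_ge0.
rewrite sqr_sqrtr ?addr_ge0 ?sqr_ge0// gerDl sqrrN => h2.
by rewrite -sqrf_eq0 eq_le h2 sqr_ge0.
Qed.

End hahn_banach.

(** * Perturbation by a bounded operator *)

Lemma riemann_integral_eq {R : realType} (V : completeNormedModType R[i])
  (f g : R -> V) (a b : R) : a <= b -> (forall t, a <= t <= b -> f t = g t) ->
  riemann_integral f a b = riemann_integral g a b.
Proof.
move=> ab fg; rewrite /riemann_integral.
rewrite (_ : riemann_sum f a b = riemann_sum g a b)//; apply/funext => n.
congr (_ *: _); apply: eq_bigr => i _; apply: fg; apply: grid_itv => //.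
by rewrite ltnW.
Qed.

Lemma riemann_integral_nn {R : realType} (V : completeNormedModType R[i])
  (f : R -> V) (a : R) : riemann_integral f a a = 0.
Proof.
apply: riemann_integral_lim.
rewrite (_ : riemann_sum f a a = fun=> 0); first exact: cvg_cst.
by apply/funext => n; rewrite /riemann_sum /mesh subrr mul0r scale0r.
Qed.

Lemma cvg_scaler_real {R : realType} (V : normedModType R[i]) (S : Type)
  (F : set_system S) (FF : Filter F) (a : S -> R) (v : S -> V) (a0 : R) (v0 : V) :
  a s @[s --> F] --> a0 -> v s @[s --> F] --> v0 ->
  (a s)%:C *: v s @[s --> F] --> a0%:C *: v0.
Proof.
move=> aa0 vv0; rewrite -[X in _ --> X](addrK (a0%:C *: v0)).
have -> : (fun s => (a s)%:C *: v s) =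
    (fun s => (a s)%:C *: v0 + (a s)%:C *: (v s - v0)).
  by apply/funext => s; rewrite -scalerDr subrKC.
rewrite addrK -[X in _ --> X]addr0; apply: cvgD; first exact: cvg_real_complex.
apply/cvg_rnormP => e e0.
have k0 : 0 < `|a0| + 1 by rewrite ltr_wpDl.
have e'0 : 0 < e / (`|a0| + 1) by rewrite divr_gt0.
move/cvgrPdist_lt : aa0 => /(_ _ ltr01) h1.
move/cvg_rnormP : vv0 => /(_ _ e'0) h2.
apply: filterS2 h1 h2 => s h1 h2; rewrite subr0 rnormZr.
have ale : `|a s| <= `|a0| + 1.
  rewrite -{1}(subrK a0 (a s)) addrC (le_trans (ler_normD _ _))// lerD2l.
  by rewrite distrC ltW.
move: h2; rewrite ltr_pdivlMr// mulrC; apply: le_lt_trans.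
by rewrite ler_wpM2r ?rnorm_ge0.
Qed.

Section volterra.
Context {R : realType} {X : completeNormedModType R[i]}.
Variables (T : R -> {linear X -> X}) (K : {linear X -> X}).
Hypothesis T_semigroup : C0_semigroup T.
Variables M w k : R.
Hypothesis M1 : 1 <= M.
Hypothesis w0 : w <= 0.
Hypothesis TM : forall t x, 0 <= t -> rnorm (T t x) <= M * expR (w * t) * rnorm x.
Hypothesis k0 : 0 < k.
Hypothesis Kk : forall x, rnorm (K x) <= k * rnorm x.
Implicit Types (f g z : R -> X) (x y : X) (s t : R) (n : nat).

Let M0 : 0 <= M. Proof. exact: le_trans M1. Qed.
Let Mgt0 : 0 < M. Proof. exact: lt_le_trans M1. Qed.

(** Clamping time at 0 turns functions of [t >= 0] into continuous functions on all of [R], the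
    class for which the Riemann integral is set up. *)
Definition posp t : R := Num.max 0 t.

Lemma posp_ge0 t : 0 <= posp t. Proof. by rewrite le_max lexx. Qed.
Lemma pospE t : 0 <= t -> posp t = t. Proof. exact: max_r. Qed.
Lemma posp_id t : posp (posp t) = posp t. Proof. exact/pospE/posp_ge0. Qed.
Lemma posp_continuous : continuous posp.
Proof.
move=> t; apply: (@continuous_comp _ _ _ (fun t => (0 : R, t))
  (fun st : R * R => Num.max st.1 st.2)); last exact: max_continuous.
exact: (cvg_pair (cvg_cst _) cvg_id).
Qed.

Lemma semigroup_le t x : rnorm (T (posp t) x) <= M * rnorm x.
Proof. exact: (semigroup_bound M0 TM w0 _ (posp_ge0 t)). Qed.

Lemma K_continuous : continuous K.
Proof. exact: linear_rnorm_continuous Kk. Qed.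

(** Joint continuity: strong continuity moves the time at the fixed vector [v0], the uniform bound
    [M] moves the vector. *)
Lemma cvg_semigroup (S : Type) (F : set_system S) (FF : Filter F)
  (a : S -> R) (v : S -> X) a0 v0 : a s @[s --> F] --> a0 ->
  v s @[s --> F] --> v0 -> T (posp (a s)) (v s) @[s --> F] --> T (posp a0) v0.
Proof.
move=> aa0 vv0; apply/cvg_rnormP => e e0.
have e20 : 0 < e / 2 by rewrite divr_gt0.
have e30 : 0 < e / 2 / M by rewrite divr_gt0.
have Tc := semigroup_continuous T_semigroup M0 TM w0 (x := v0).
have : T (posp (a s)) v0 @[s --> F] --> T (posp a0) v0.
  by apply: (@cvg_comp _ _ _ a (fun t => T (posp t) v0) _ _ _ aa0); exact: Tc.
move=> /cvg_rnormP/(_ _ e20) h1.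
move/cvg_rnormP : vv0 => /(_ _ e30) h2.
apply: filterS2 h1 h2 => s h1 h2.
rewrite (le_lt_trans (rnorm_triangle (T (posp (a s)) v0) _ _))// (splitr e) ltrD//.
rewrite -linearB (le_lt_trans (semigroup_le _ _))//.
by move: h2; rewrite ltr_pdivlMr// mulrC.
Qed.

Definition volterra f t : X :=
  riemann_integral (fun s => T (posp (posp t - s)) (K (f s))) 0 (posp t).

Lemma volterra_integrand_continuous f t : continuous f ->
  continuous (fun s => T (posp (t - s)) (K (f s))).
Proof.
move=> fc s; apply: cvg_semigroup; first by apply: cvgB; [exact: cvg_cst|exact: cvg_id].
by apply: cvg_image; [exact: K_continuous|exact: fc].
Qed.

Lemma volterra_continuous f : continuous f -> continuous (volterra f).
Proof.
move=> fc.
pose G t s := T (posp (posp t - posp t * s)) (K (f (posp t * s))).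
have -> : volterra f = fun t => (posp t)%:C *: riemann_integral (G t) 0 1.
  apply/funext => t; rewrite /volterra riemann_integral_scale//.
  exact: volterra_integrand_continuous.
have Gc : continuous (fun ts : R * R => G ts.1 ts.2).
  move=> ts; have p1 : posp x.1 @[x --> ts] --> posp ts.1.
    by apply: (@cvg_comp _ _ _ fst posp _ _ _ cvg_fst); exact: posp_continuous.
  have p2 : posp x.1 * x.2 @[x --> ts] --> posp ts.1 * ts.2.
    by apply: cvgM => //; exact: cvg_snd.
  apply: cvg_semigroup; first exact: cvgB.
  apply: cvg_image; first exact: K_continuous.
  by apply: (@cvg_comp _ _ _ (fun x : R * R => posp x.1 * x.2) f _ _ _ p2); exact: fc.
move=> t; apply: cvg_scaler_real; first exact: posp_continuous.
exact: riemann_integral_continuous Gc t.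
Qed.

Lemma volterraD f g : continuous f -> continuous g ->
  volterra (fun t => f t + g t) = fun t => volterra f t + volterra g t.
Proof.
move=> fc gc; apply/funext => t.
rewrite -riemann_integralD ?posp_ge0//; [|exact: volterra_integrand_continuous..].
by apply: riemann_integral_eq => [|s _]; rewrite ?posp_ge0// !linearD.
Qed.

Lemma volterraZ (a : R[i]) f : continuous f ->
  volterra (fun t => a *: f t) = fun t => a *: volterra f t.
Proof.
move=> fc; apply/funext => t.
have ac : continuous ( *:%R a : X -> X).
  apply: (linear_rnorm_continuous (M := complex.Re `|a|)) => x; rewrite rnormZ//.
rewrite -(riemann_integral_linear ac) ?posp_ge0//.
  by apply: riemann_integral_eq => [|s _]; rewrite ?posp_ge0// !linearZ.
exact: volterra_integrand_continuous.
Qed.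

Lemma volterra_posp f t : volterra f (posp t) = volterra f t.
Proof. by rewrite /volterra posp_id. Qed.

Definition rate : R := 2 * (M * k).

Lemma rate_gt0 : 0 < rate. Proof. by rewrite !mulr_gt0. Qed.

(* The rate is chosen so that [volterra] halves the norm weighted by
   [expR (- rate * t)]. *)
Lemma volterra_half f N m : continuous f -> 0 <= m ->
  (forall t, 0 <= t <= N -> rnorm (f t) <= m * expR (rate * t)) ->
  forall t, 0 <= t <= N -> rnorm (volterra f t) <= m / 2 * expR (rate * t).
Proof.
move=> fc m0 fm t /andP[t0 tN]; rewrite /volterra pospE//.
have -> : m / 2 = M * k * m / rate.
  by rewrite /rate; field; rewrite !gt_eqF.
apply: rnorm_riemann_integral_exp => //.
- exact: volterra_integrand_continuous.
- by rewrite !mulr_ge0// ltW.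
- exact: rate_gt0.
move=> s /andP[s0 st]; rewrite (le_trans (semigroup_le _ _))//.
have -> : M * k * m * expR (rate * s) = M * (k * (m * expR (rate * s))).
  by rewrite !mulrA.
rewrite ler_wpM2l//.
rewrite (le_trans (Kk _))// ler_wpM2l// ?(ltW k0)// fm// s0; exact: le_trans tN.
Qed.

Lemma half_small (m e : R) : 0 < e -> exists n : nat, m * 2^-1 ^+ n < e.
Proof.
move=> e0; have m1 : 0 < `|m| + 1 by rewrite ltr_wpDl.
have : geometric m (2^-1 : R) n @[n --> \oo] --> (0 : R).
  by apply: cvg_geometric; rewrite ger0_norm// invf_lt1// ltr1n.
move=> /cvgrPdist_lt/(_ _ e0)[n _ /(_ n (leqnn n))]; rewrite sub0r normrN => h.
by exists n; exact: le_lt_trans (ler_norm _) h.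
Qed.

(** Starting from the maximum [m] of [rnorm (z t)] on the segment, repeated halving bounds the
    weighted norm of [z] by [m * 2^-1 ^+ n] for every [n]. *)
Lemma volterra_unique z N : continuous z ->
  (forall t, 0 <= t <= N -> z t = volterra z t) ->
  forall t, 0 <= t <= N -> z t = 0.
Proof.
move=> zc zV t tN; have N0 : 0 <= N by case/andP: tN => /le_trans; exact.
have nc : continuous (fun t => rnorm (z t)).
  by move=> s; apply: cvg_rnorm; exact: zc.
have [s0 _ smax] := EVT_max N0 (continuous_subspaceT nc).
pose m := rnorm (z s0); have m0 : 0 <= m by exact: rnorm_ge0.
have zm n s : 0 <= s <= N -> rnorm (z s) <= m * 2^-1 ^+ n * expR (rate * s).
  elim: n s => [|n ih] s sN.
    rewrite expr0 mulr1 (le_trans (smax s _)) ?in_itv//.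
    rewrite ler_peMr// -expR0 ler_expR mulr_ge0 ?(ltW rate_gt0)//.
    by case/andP: sN.
  rewrite zV// exprSr mulrA; apply: volterra_half sN => //.
  by rewrite mulr_ge0// exprn_ge0.
apply: rnorm_small_eq0 => e e0.
have [n hn] := half_small (m * expR (rate * t)) e0.
by rewrite (le_trans (zm n t tN))// ltW// mulrAC.
Qed.

(** The terms of the Dyson-Phillips series for the perturbation of [T] by [K]; each picard step
    contributes one more factor [K]. *)
Fixpoint picard x n : R -> X :=
  if n is n'.+1 then volterra (picard x n') else fun t => T (posp t) x.

Lemma picard_continuous x n : continuous (picard x n).
Proof.
elim: n => [|n ih] /=; last exact: volterra_continuous.
by move=> t; apply: cvg_semigroup; [exact: cvg_id|exact: cvg_cst].
Qed.

Lemma picard_posp x n t : picard x n (posp t) = picard x n t.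
Proof. by case: n => [|n] /=; rewrite ?posp_id// volterra_posp. Qed.

Lemma picard_bound x n t : 0 <= t ->
  rnorm (picard x n t) <= M * rnorm x * 2^-1 ^+ n * expR (rate * t).
Proof.
move=> t0; elim: n t t0 => [|n ih] t t0 /=.
  rewrite expr0 mulr1 (le_trans (semigroup_le _ _))// ler_peMr//.
    by rewrite mulr_ge0 ?rnorm_ge0.
  by rewrite -expR0 ler_expR mulr_ge0 ?(ltW rate_gt0).
rewrite exprSr mulrA; apply: (@volterra_half _ t).
- exact: picard_continuous.
- by rewrite !mulr_ge0 ?rnorm_ge0// exprn_ge0.
- by move=> s /andP[s0 _]; exact: ih.
- by rewrite t0 lexx.
Qed.

Definition picard_sum x n t : X := \sum_(i < n) picard x i t.

(** The factor 2 is the sum of the geometric series of the bounds in [picard_bound]. *)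
Definition growth x t : R := 2 * (M * rnorm x * expR (rate * posp t)).

Lemma growth_ge0 x t : 0 <= growth x t.
Proof. by rewrite !mulr_ge0 ?rnorm_ge0 ?expR_ge0. Qed.

Lemma picard_sum_cauchy x n j t :
  rnorm (picard_sum x (n + j) t - picard_sum x n t) <=
  growth x t * (2^-1 ^+ n - 2^-1 ^+ (n + j)).
Proof.
elim: j => [|j ih]; first by rewrite addn0 !subrr rnorm0 mulr0.
rewrite addnS {1}/picard_sum big_ord_recr /= addrAC (le_trans (rnormD _ _))//.
have : rnorm (picard x (n + j) t) <= growth x t / 2 * 2^-1 ^+ (n + j).
  rewrite -picard_posp (le_trans (picard_bound _ _ (posp_ge0 t)))//.
  by rewrite /growth [2 * _]mulrC mulfK// mulrAC.
move: ih; rewrite -/(picard_sum x (n + j) t) exprS.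
move: (2^-1 ^+ (n + j)) => u; lra.
Qed.

Lemma picard_sum_dist x n m t : (n <= m)%N ->
  rnorm (picard_sum x m t - picard_sum x n t) <= growth x t * 2^-1 ^+ n.
Proof.
move=> nm; rewrite -(subnKC nm) (le_trans (picard_sum_cauchy _ _ _ _))//.
by rewrite ler_wpM2l ?growth_ge0// gerBl exprn_ge0.
Qed.

Definition perturbed t x : X := lim (picard_sum x n t @[n --> \oo]).

Lemma perturbed_cvg t x : picard_sum x n t @[n --> \oo] --> perturbed t x.
Proof.
apply: cvg_of_cauchy => e e0; have e20 : 0 < e / 2 by rewrite divr_gt0.
have [N hN] := half_small (growth x t) e20.
exists N => n m Nn Nm; rewrite (le_lt_trans (rnorm_triangle (picard_sum x N t) _ _))//.
rewrite (splitr e) ltrD//; first exact: le_lt_trans (picard_sum_dist _ _ Nn) hN.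
by rewrite rnorm_distC; exact: le_lt_trans (picard_sum_dist _ _ Nm) hN.
Qed.

Lemma perturbed_tail x n t :
  rnorm (perturbed t x - picard_sum x n t) <= growth x t * 2^-1 ^+ n.
Proof.
apply/ler_addgt0Pr => e e0.
have /cvg_rnormP/(_ _ e0)[N _ hN] := @perturbed_cvg t x.
have := hN (maxn N n) (leq_maxl _ _).
have := picard_sum_dist x t (leq_maxr N n).
have := rnorm_triangle (picard_sum x (maxn N n) t) (perturbed t x) (picard_sum x n t).
by rewrite [X in _ <= X + _ -> _]rnorm_distC /=; lra.
Qed.

Lemma picard_sum_continuous x n : continuous (picard_sum x n).
Proof.
elim: n => [|n ih] t.
  rewrite (_ : picard_sum x 0 = fun=> 0); first exact: cvg_cst.
  by apply/funext => s; rewrite /picard_sum big_ord0.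
rewrite (_ : picard_sum x n.+1 = fun s => picard_sum x n s + picard x n s).
  by apply: cvgD; [exact: ih|exact: picard_continuous].
by apply/funext => s; rewrite /picard_sum big_ord_recr.
Qed.

Lemma perturbed_continuous x : continuous (fun t => perturbed t x).
Proof.
move=> t0; apply/cvg_rnormP => e e0.
have e30 : 0 < e / 2 / 2 by rewrite !divr_gt0.
(* [growth] increases with time, so its value at [posp t0 + 1] gives one [n] for all times near
   [t0]: the convergence is locally uniform. *)
have [n hn] := half_small (growth x (posp t0 + 1)) e30.
have tail t : posp t <= posp t0 + 1 ->
    rnorm (perturbed t x - picard_sum x n t) < e / 2 / 2.
  move=> tt0; apply: le_lt_trans hn; apply: (le_trans (perturbed_tail x n t)).
  rewrite ler_wpM2r ?exprn_ge0// ler_wpM2l// ler_wpM2l ?mulr_ge0 ?rnorm_ge0//.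
  rewrite ler_expR ler_wpM2l ?(ltW rate_gt0)// [leRHS]pospE//.
  by rewrite addr_ge0 ?posp_ge0.
have /cvg_rnormP/(_ _ (_ : 0 < e / 2))[|d /= d0 hd] := @picard_sum_continuous x n t0.
  by rewrite divr_gt0.
have /cvgrPdist_lt/(_ _ ltr01)[d' /= d'0 hd'] := @posp_continuous t0.
exists (Num.min d d') => /=; first by rewrite lt_min d0.
move=> t /=; rewrite lt_min => /andP[td td'].
have pt : posp t <= posp t0 + 1.
  have := hd' t td'; rewrite distrC ltr_norml => /andP[_]; lra.
have pt0 : posp t0 <= posp t0 + 1 by rewrite lerDl.
have h1 := tail _ pt; have h2 := tail _ pt0; have h3 := hd t td.
have h4 := rnorm_triangle (picard_sum x n t) (perturbed t x) (perturbed t0 x).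
have h5 := rnorm_triangle (picard_sum x n t0) (picard_sum x n t) (perturbed t0 x).
rewrite (rnorm_distC (picard_sum x n t0)) in h5; move: h1 h2 h3 h4 h5 => /=; lra.
Qed.

Lemma picard_sumS x n t :
  picard_sum x n.+1 t = T (posp t) x + volterra (picard_sum x n) t.
Proof.
elim: n => [|n ih].
  rewrite /picard_sum big_ord1 /=.
  rewrite (_ : volterra _ t = 0) ?addr0//.
  rewrite /volterra (@riemann_integral_eq _ _ _ (fun=> 0)) ?posp_ge0//.
    have zc : continuous (fun _ : R => 0 : X) by move=> s; exact: cvg_cst.
    apply: rnorm_small_eq0 => e e0.
    rewrite (le_trans (rnorm_riemann_integral_cst (K := 0) zc (posp_ge0 t) _))//.
      by move=> s _; rewrite rnorm0.
    by rewrite mulr0 ltW.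
  by move=> s _; rewrite big_ord0 !linear0.
rewrite /picard_sum big_ord_recr /= -/(picard_sum x n.+1 t) ih -addrA; congr (_ + _).
rewrite (_ : (fun s => _) = fun s => picard_sum x n s + picard x n s).
  rewrite volterraD//; [exact: picard_sum_continuous|exact: picard_continuous].
by apply/funext => s; rewrite /picard_sum big_ord_recr.
Qed.

(** Subtracting [picard_sumS] leaves the tail at [n.+1] and the image under [volterra] of the tail
    at [n]; both are of order [2^-1 ^+ n]. *)
Lemma perturbed_eq x t :
  perturbed t x = T (posp t) x + volterra (fun s => perturbed s x) t.
Proof.
apply/eqP; rewrite -subr_eq0; apply/eqP.
apply: rnorm_small_eq0 => e e0.
have [n hn] := half_small (growth x t * 2) e0.
have pc := @perturbed_continuous x; have sc := @picard_sum_continuous x n.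
have Nsc : continuous (fun s => - picard_sum x n s).
  by move=> s; apply: cvgN; exact: sc.
have dc : continuous (fun s => perturbed s x - picard_sum x n s).
  by move=> s; apply: cvgB; [exact: pc|exact: sc].
have E : volterra (fun s => perturbed s x - picard_sum x n s) t =
    volterra (fun s => perturbed s x) t - volterra (picard_sum x n) t.
  rewrite volterraD//; congr (_ + _).
  rewrite (_ : (fun s => - _) = fun s => (-1) *: picard_sum x n s).
    by rewrite volterraZ// scaleN1r.
  by apply/funext => s; rewrite scaleN1r.
have -> : perturbed t x - (T (posp t) x + volterra (fun s => perturbed s x) t) =
    (perturbed t x - picard_sum x n.+1 t) -
    volterra (fun s => perturbed s x - picard_sum x n s) t.
  by rewrite E picard_sumS !opprD opprK !addrA [RHS]addrAC subrK.
rewrite (le_trans (rnormB _ _))//.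
have h1 := perturbed_tail x n.+1 t.
have h2 : rnorm (volterra (fun s => perturbed s x - picard_sum x n s) t) <=
    2 * (M * rnorm x) * 2^-1 ^+ n / 2 * expR (rate * posp t).
  rewrite -volterra_posp; apply: (@volterra_half _ (posp t)) => //.
  - by rewrite !mulr_ge0 ?rnorm_ge0// exprn_ge0.
  - move=> s /andP[s0 _]; rewrite (le_trans (perturbed_tail x n s))//.
    by rewrite /growth pospE// mulrA mulrAC.
  - by rewrite posp_ge0 lexx.
have gE : growth x t = 2 * (M * rnorm x) * expR (rate * posp t).
  by rewrite /growth mulrA.
have g0 := growth_ge0 x t.
have u0 : 0 <= 2^-1 ^+ n :> R by rewrite exprn_ge0.
have {}h2 : rnorm (volterra (fun s => perturbed s x - picard_sum x n s) t) <=
    growth x t * 2^-1 ^+ n / 2.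
  by rewrite (le_trans h2)// gE mulrAC (mulrAC (2 * (M * rnorm x))).
move: h1 h2 hn u0; rewrite exprS; move: (2^-1 ^+ n) => u; nra.
Qed.

Lemma perturbed_posp x t : perturbed (posp t) x = perturbed t x.
Proof.
rewrite /perturbed (_ : (fun n => _) = (fun n => picard_sum x n t))//.
by apply/funext => n; apply: eq_bigr => i _; rewrite picard_posp.
Qed.

(** Identifies an orbit by its integral equation; linearity, the semigroup law and the eigenvector
    relation are all derived from this. *)
Lemma perturbed_unique x z N : continuous z ->
  (forall t, 0 <= t <= N -> z t = T t x + volterra z t) ->
  forall t, 0 <= t <= N -> z t = perturbed t x.
Proof.
move=> zc zeq t tN; apply/eqP; rewrite -subr_eq0; apply/eqP.
have pc := @perturbed_continuous x.
have Npc : continuous (fun s => - perturbed s x).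
  by move=> s; apply: cvgN; exact: pc.
apply: (@volterra_unique (fun t => z t - perturbed t x) N) => // [s|s sN].
  by apply: cvgB; [exact: zc|exact: pc].
rewrite volterraD//.
rewrite (_ : (fun s => - _) = fun s => (-1) *: perturbed s x); last first.
  by apply/funext => r; rewrite scaleN1r.
rewrite volterraZ// scaleN1r zeq// perturbed_eq pospE; last by case/andP: sN.
by rewrite opprD addrACA subrr add0r.
Qed.

Lemma perturbed_linear t : linear (perturbed t).
Proof.
move=> a x y; rewrite -[LHS]perturbed_posp -(perturbed_posp x) -(perturbed_posp y).
have xc := @perturbed_continuous x; have yc := @perturbed_continuous y.
have axc : continuous (fun s => a *: perturbed s x).
  by move=> s; apply: cvgZr; exact: xc.
apply/esym; apply: (@perturbed_unique _ (fun s => a *: perturbed s x + perturbed s y) (posp t)).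
- by move=> s; apply: cvgD; [exact: axc|exact: yc].
- move=> s /andP[s0 _]; rewrite volterraD// volterraZ// !perturbed_eq pospE//.
  by rewrite linearP scalerDr addrACA.
- by rewrite posp_ge0 lexx.
Qed.

Lemma perturbed_bound x t :
  rnorm (perturbed t x) <= 2 * (M * expR (rate * posp t)) * rnorm x.
Proof.
have := perturbed_tail x 0 t.
by rewrite /picard_sum big_ord0 subr0 expr0 mulr1 /growth mulrAC !mulrA.
Qed.

Lemma perturbed0 x : perturbed 0 x = x.
Proof.
rewrite perturbed_eq /volterra pospE// riemann_integral_nn addr0.
by have [_ T0 _ _] := T_semigroup; exact: T0.
Qed.

(** The translate of the orbit by [s] solves the equation started at [perturbed s x]: the integral
    over [[0, r + s]] is cut at [s], where the first piece is [T r] applied to the integral term of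
    [perturbed s x] and the second is a shift. *)
Lemma perturbed_add t s x : 0 <= t -> 0 <= s ->
  perturbed (t + s) x = perturbed t (perturbed s x).
Proof.
move=> t0 s0; have [_ _ TD _] := T_semigroup.
have pc := @perturbed_continuous x.
pose z r := perturbed (posp r + s) x.
have zc : continuous z.
  move=> r; have : posp r' + s @[r' --> r] --> posp r + s.
    by apply: cvgD; [exact: posp_continuous|exact: cvg_cst].
  by move=> h; apply: (@cvg_comp _ _ _ (fun r => posp r + s) (perturbed^~ x) _ _ _ h); exact: pc.
have -> : perturbed (t + s) x = z t by rewrite /z pospE.
apply: (@perturbed_unique _ z t) => //; last by rewrite t0 lexx.
move=> r /andP[r0 rt]; have rs0 : 0 <= r + s by rewrite addr_ge0.
rewrite /z pospE// perturbed_eq pospE// {1}/volterra pospE//.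
rewrite (@riemann_integral_cat _ _ _ 0 s); last 3 first.
- exact: volterra_integrand_continuous.
- exact: s0.
- by rewrite lerDr.
rewrite [perturbed s x]perturbed_eq linearD /volterra !pospE// TD//.
rewrite -riemann_integral_linear//; last 2 first.
- apply: (linear_rnorm_continuous (M := M)) => y.
  by rewrite -{1}(pospE r0) semigroup_le.
- exact: volterra_integrand_continuous.
rewrite addrA; congr (_ + _ + _).
  apply: riemann_integral_eq => // q /andP[q0 qs].
  by rewrite !pospE ?subr_ge0// -?TD ?subr_ge0// ?addrA// (le_trans qs)// lerDr.
pose F q := T (posp (r + s - q)) (K (perturbed q x)).
transitivity (riemann_integral (fun q => F (q + s)) 0 r).
  by rewrite riemann_integral_shift add0r.
apply: riemann_integral_eq => // q /andP[q0 qr]; rewrite /F.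
by rewrite (pospE q0) opprD addrACA subrr addr0.
Qed.

End volterra.

(** * Eigenvectors of the perturbed generator *)

Section complex_exponential.
Context {R : realType}.
Implicit Types (s t h : R).

Definition cexp t : R[i] := Complex (cos t) (sin t).

Lemma cexp0 : cexp 0 = 1.
Proof. by rewrite /cexp cos0 sin0. Qed.

Lemma cexpD s t : cexp (s + t) = cexp s * cexp t.
Proof.
apply/eqP; rewrite eq_complex /= cosD sinD; apply/andP; split; apply/eqP; ring.
Qed.

Lemma norm_cexp t : complex.Re `|cexp t| = 1.
Proof. by rewrite normc_def /= cos2Dsin2 sqrtr1. Qed.

Lemma norm_complex_le (a b : R) : complex.Re `|Complex a b| <= `|a| + `|b|.
Proof.
rewrite normc_def /=.
have ab0 : 0 <= `|a| + `|b| by rewrite addr_ge0.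
rewrite -(@ger0_norm _ (`|a| + `|b|))// -sqrtr_sqr ler_wsqrtr// sqrrD !real_normK ?num_real//.
by rewrite addrAC lerDl mulrn_wge0// mulr_ge0.
Qed.

Lemma is_derive_cvg_right (f : R -> R) (df : R) : is_derive (0 : R) (1 : R) f df ->
  h^-1 * (f h - f 0) @[h --> (0 : R)^'+] --> df.
Proof.
move=> [fd fE]; apply: cvg_dnbhs_at_right.
have c : h^-1 *: (f (h *: 1 + 0) - f 0) @[h --> (0 : R)^'] --> df by rewrite -fE; exact: fd.
by under eq_cvg do rewrite -[_ * _]/(_ *: _) -{1}[X in f X]addr0 -{1}[X in f (X + _)]mulr1.
Qed.

Lemma cexp_derivative {V : normedModType R[i]} s (x : V) :
  (h^-1)%:C *: (cexp (s * h) *: x - x) @[h --> (0 : R)^'+] --> Complex 0 s *: x.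
Proof.
have c : h^-1 * (cos (s * h) - 1) @[h --> (0 : R)^'+] --> (0 : R).
  have d : is_derive (0 : R) 1 (fun h => cos (s * h)) 0.
    by apply: is_derive_eq; rewrite mulr0 sin0 oppr0 mul0r.
  by have := is_derive_cvg_right d; rewrite mulr0 cos0.
have sn : h^-1 * sin (s * h) @[h --> (0 : R)^'+] --> s.
  have d : is_derive (0 : R) 1 (fun h => sin (s * h)) s.
    apply: is_derive_eq. rewrite /= mulr0 cos0 mul1r.
by rewrite -[_ *: _]/(s * 1) mulr1.
  have := is_derive_cvg_right d; rewrite mulr0 sin0.
  by under eq_cvg do rewrite subr0.
apply/cvg_rnormP => e e0.
have x1 : 0 < rnorm x + 1 by rewrite ltr_wpDl// rnorm_ge0.
have e'0 : 0 < e / (rnorm x + 1) / 2 by rewrite !divr_gt0.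
move/cvgrPdist_lt : c => /(_ _ e'0) h1; move/cvgrPdist_lt : sn => /(_ _ e'0) h2.
apply: filterS2 h1 h2 => h h1 h2.
have -> : (h^-1)%:C *: (cexp (s * h) *: x - x) - Complex 0 s *: x =
    Complex (h^-1 * (cos (s * h) - 1)) (h^-1 * sin (s * h) - s) *: x.
  rewrite -{2}(scale1r x) -scalerBl scalerA -scalerBl; congr (_ *: _).
  by apply/eqP; rewrite eq_complex /=; apply/andP; split; apply/eqP; ring.
rewrite rnormZ; apply: (@le_lt_trans _ _ (e / (rnorm x + 1) * rnorm x)).
  rewrite ler_wpM2r ?rnorm_ge0// (le_trans (norm_complex_le _ _))//.
  rewrite [leRHS]splitr lerD// ltW//; first by rewrite -[_ * _]subr0 distrC.
  by rewrite distrC.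
by rewrite mulrAC ltr_pdivrMr// ltr_pM2l// ltrDl.
Qed.

Lemma cexp_continuous {V : normedModType R[i]} s (x : V) :
  continuous (fun t => cexp (s * t) *: x).
Proof.
move=> t; apply/cvg_rnormP => e e0.
have x1 : 0 < rnorm x + 1 by rewrite ltr_wpDl// rnorm_ge0.
have e'0 : 0 < e / (rnorm x + 1) / 2 by rewrite !divr_gt0.
have m : s * t' @[t' --> t] --> s * t by exact: mulrl_continuous.
have /cvgrPdist_lt/(_ _ e'0) h1 : cos (s * t') @[t' --> t] --> cos (s * t).
  by apply: (@cvg_comp _ _ _ (fun t => s * t) cos _ _ _ m); exact: continuous_cos.
have /cvgrPdist_lt/(_ _ e'0) h2 : sin (s * t') @[t' --> t] --> sin (s * t).
  by apply: (@cvg_comp _ _ _ (fun t => s * t) sin _ _ _ m); exact: continuous_sin.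
apply: filterS2 h1 h2 => h h1 h2; rewrite -scalerBl rnormZ.
apply: (@le_lt_trans _ _ (e / (rnorm x + 1) * rnorm x)).
  rewrite ler_wpM2r ?rnorm_ge0//.
  have -> : cexp (s * h) - cexp (s * t) =
      Complex (cos (s * h) - cos (s * t)) (sin (s * h) - sin (s * t)) by [].
  rewrite (le_trans (norm_complex_le _ _))//.
  by rewrite [leRHS]splitr lerD// ltW// distrC.
by rewrite mulrAC ltr_pdivrMr// ltr_pM2l// ltrDl.
Qed.

End complex_exponential.

Section eigenvector.
Context {R : realType} {X : completeNormedModType R[i]}.
Variables (T : R -> {linear X -> X}) (K : {linear X -> X}).
Hypothesis T_semigroup : C0_semigroup T.
Variables M w k : R.
Hypothesis M1 : 1 <= M.
Hypothesis w0 : w <= 0.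
Hypothesis TM : forall t x, 0 <= t -> rnorm (T t x) <= M * expR (w * t) * rnorm x.
Hypothesis k0 : 0 < k.
Hypothesis Kk : forall x, rnorm (K x) <= k * rnorm x.
Variables (x Ax : X) (om : R).
Hypothesis Ax_gen : (h^-1)%:C *: (T h x - x) @[h --> (0 : R)^'+] --> Ax.
Hypothesis Kx : K x = Complex 0 om *: x - Ax.

Let M0 : 0 <= M. Proof. exact: le_trans M1. Qed.

(** Error of one step of length [h] when the Duhamel integral is replaced by a single left Riemann
    term. It is o(h) precisely because [K x] is [i om x - Ax]. *)
Let defect h : X := cexp (om * h) *: x - T h x - h%:C *: T h (K x).

Let defect_small : (h^-1)%:C *: defect h @[h --> (0 : R)^'+] --> (0 : X).
Proof.
have [_ _ _ Tc] := T_semigroup.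
have -> : 0 = Complex 0 om *: x - Ax - K x by rewrite Kx subrr.
have c1 := @cexp_derivative R X om x.
have c : (h^-1)%:C *: (cexp (om * h) *: x - x) - (h^-1)%:C *: (T h x - x) -
    T h (K x) @[h --> (0 : R)^'+] --> Complex 0 om *: x - Ax - K x.
  by apply: cvgB (Tc _); exact: cvgB c1 Ax_gen.
apply: cvg_trans c.
apply: near_eq_cvg; near=> h; have h0 : 0 < h by near: h; exact: nbhs_right_gt.
have hh : (h^-1)%:C * h%:C = 1 by rewrite -[LHS]rmorphM mulVf ?gt_eqF.
rewrite /defect [RHS]scalerBr scalerA hh scale1r; congr (_ - _).
by rewrite -scalerBr opprB addrA subrK.
Unshelve. all: by end_near. Qed.

Let orbit t : X := cexp (om * posp t) *: x.

Let orbit_continuous : continuous orbit.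
Proof.
move=> t; apply: (@cvg_comp _ _ _ posp (fun t => cexp (om * t) *: x) _ _ _ (@posp_continuous R t)).
exact: cexp_continuous.
Qed.

(** With [G i] the vector [T (t - g i) x] rotated by [cexp (om * g i)], the difference
    [orbit t - T t x] telescopes. Each increment matches a term of the Riemann sum up to a
    unimodular multiple of [T (t - g i.+1)] applied to the defect. *)
Let orbit_riemann t n : 0 <= t ->
  rnorm (riemann_sum (fun s => T (posp (t - s)) (K (orbit s))) 0 t n -
         (orbit t - T t x)) <= n.+1%:R * (M * rnorm (defect (mesh 0 t n))).
Proof.
move=> t0; have [_ T0 TD _] := T_semigroup; have h0 := mesh_ge0 n t0.
pose h := mesh 0 t n; pose g i := grid 0 t n i; rewrite -/h in h0 *.
have gS i : g i.+1 = g i + h by exact: gridS.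
have gb i : (i <= n.+1)%N -> 0 <= g i <= t by exact: grid_itv.
pose G i := cexp (om * g i) *: T (posp (t - g i)) x.
have -> : orbit t - T t x = \sum_(i < n.+1) (G i.+1 - G i).
  rewrite -(big_mkord xpredT (fun i => G i.+1 - G i)) telescope_sumr//.
  rewrite /G /g grid_end grid0 subrr subr0 !pospE// T0 mulr0 cexp0 scale1r.
  by rewrite /orbit pospE.
rewrite /riemann_sum scaler_sumr -sumrB (le_trans (rnorm_sum _ _ _))//.
rewrite [leRHS](_ : _ = \sum_(i < n.+1) M * rnorm (defect h)); last first.
  by rewrite sumr_const card_ord mulr_natl.
apply: ler_sum => i _; rewrite -/h -/(g i).
have /andP[gi0 git] := gb i (ltnW (ltn_ord i)).
have /andP[gS0 gSt] := gb i.+1 (ltn_ord i).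
have TgE y : T (posp (t - g i)) y = T (posp (t - g i.+1)) (T h y).
  rewrite !pospE ?subr_ge0// -TD ?subr_ge0//; congr (T _ y).
  by rewrite gS; ring.
pose c := cexp (om * g i); pose e := cexp (om * h).
have cS : cexp (om * g i.+1) = c * e by rewrite gS mulrDr cexpD.
have KE : K (orbit (g i)) = c *: K x by rewrite /orbit pospE// linearZ.
rewrite /G cS -/c KE !TgE; move: (T (posp (t - g i.+1))) (semigroup_le M1 w0 TM (t - g i.+1)).
move=> P PM.
have e1 : P (T h (c *: K x)) = c *: P (T h (K x)) by rewrite !linearZ.
have e2 : P (defect h) = e *: P x - P (T h x) - h%:C *: P (T h (K x)).
  by rewrite /defect !linearB !linearZ.
have -> : h%:C *: P (T h (c *: K x)) - (c * e *: P x - c *: P (T h x)) =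
    - (c *: P (defect h)).
  by rewrite e1 e2 !scalerBr !scalerA [h%:C * _]mulrC [RHS]opprB.
by rewrite rnormN rnormZ norm_cexp mul1r PM.
Qed.

Let orbit_eq t : 0 <= t -> orbit t = T t x + volterra T K orbit t.
Proof.
move=> t0; have [_ T0 _ _] := T_semigroup.
rewrite /volterra pospE//; move: t0; rewrite le_eqVlt => /predU1P[<-|t0].
  by rewrite riemann_integral_nn addr0 T0 /orbit pospE// mulr0 cexp0 scale1r.
rewrite (_ : riemann_integral _ 0 t = orbit t - T t x) ?subrKC//.
apply: riemann_integral_lim.
apply/cvg_rnormP => e e0.
have tM0 : 0 < t * M by rewrite mulr_gt0// (lt_le_trans ltr01 M1).
have e'0 : 0 < e / (t * M) by rewrite divr_gt0.
have /cvg_rnormP/(_ _ e'0)[d /= d0 hd] := defect_small.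
have [N hN] := mesh_cvg0 d0 (ltW t0).
exists N => // n /= /hN hn; have h0 := mesh_gt0 n t0.
apply: (le_lt_trans (orbit_riemann _ (ltW t0))).
have := hd (mesh 0 t n); rewrite /= sub0r normrN gtr0_norm// => /(_ hn h0).
rewrite subr0 rnormZr gtr0_norm ?invr_gt0// ltr_pdivlMr//.
(* The [n.+1] steps have total length [t], so errors that are small relative to the step add up to a
   small error. *)
have : n.+1%:R * mesh 0 t n = t by rewrite mesh_sum subr0.
move: (mesh 0 t n) h0 => m m0 mt; apply: le_lt_trans.
rewrite -mt le_eqVlt; apply/orP; left; apply/eqP; field.
by rewrite gt_eqF.
Qed.

Lemma perturbed_eigenvector t : 0 <= t ->
  perturbed T K t x = cexp (om * t) *: x.
Proof.
move=> t0; rewrite -[in RHS](pospE t0) -/(orbit t); apply/esym.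
apply: (perturbed_unique T_semigroup M1 w0 TM k0 Kk orbit_continuous (N := t)).
  by move=> s /andP[s0 _]; exact: orbit_eq.
by rewrite t0 lexx.
Qed.

End eigenvector.

(** * Bounds of the stability radius *)

Lemma exists_linear {K : pzRingType} {V W : lmodType K} (f : V -> W) :
  linear f -> exists g : {linear V -> W}, g =1 f.
Proof.
move=> fl; pose m := GRing.isLinear.Build K V W *:%R f fl.
by pose g : {linear V -> W} := HB.pack f m; exists g.
Qed.

Section constant_feedback.
Context {R : realType} {X U Y : completeNormedModType R[i]}.
Variables (T : R -> {linear X -> X}) (B : {linear U -> X}) (C : {linear X -> Y}).
Hypothesis T_semigroup : C0_semigroup T.
Variables M w : R.
Hypothesis M1 : 1 <= M.
Hypothesis w0 : w <= 0.
Hypothesis TM : forall t x, 0 <= t -> rnorm (T t x) <= M * expR (w * t) * rnorm x.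

Let mu := @lebesgue_measure R.

Lemma Linfnorm_cst_le (D : {linear Y -> U}) r : 0 <= r ->
  (forall y, rnorm (D y) <= r * rnorm y) ->
  (Linfnorm (fun _ : R => (D : Y -> U)) <= r%:E)%E.
Proof.
move=> r0 Dr; apply/ess_supP; apply: nearW => t; rewrite patchE.
by case: ifP => _; [exact/(opnorm_le _ r0)|rewrite lee_fin].
Qed.

(** A constant feedback keeps the system autonomous, so its evolution family is the perturbed
    semigroup at time [t - s]; the integral over [[s, t]] is the shift of one over [[0, t - s]]. *)
Lemma perturbed_family_cst (D : {linear Y -> U}) (K : {linear X -> X}) k
    (W : R -> R -> {linear X -> X}) : 0 < k ->
  (forall x, rnorm (K x) <= k * rnorm x) -> (forall x, K x = B (D (C x))) ->
  (forall t s, W t s =1 perturbed T K (t - s)) ->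
  perturbed_family T B C (fun=> D) W.
Proof.
move=> k0 Kk KE WE; split.
  split=> [t s _ _|t x _|t s r x r0 rs st|x].
  - apply: (@linear_rnorm_continuous _ _ _ _ (2 * (M * expR (rate M k * posp (t - s))))) => x.
    by rewrite WE (perturbed_bound T_semigroup M1 w0 TM k0 Kk).
  - by rewrite WE subrr (perturbed0 T_semigroup M1 w0 TM k0 Kk).
  - rewrite !WE -(perturbed_add T_semigroup M1 w0 TM k0 Kk) ?subr_ge0//.
    by rewrite subrKA.
  - rewrite (_ : (fun ts => _) = fun ts : R * R => perturbed T K (ts.1 - ts.2) x); last first.
      by apply/funext => ts; rewrite WE.
    apply: continuous_subspaceT => ts.
    apply: (@cvg_comp _ _ _ (fun ts : R * R => ts.1 - ts.2)
      (fun t => perturbed T K t x)); last first.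
      exact: (perturbed_continuous T_semigroup M1 w0 TM k0 Kk).
    by apply: cvgB; [exact: cvg_fst|exact: cvg_snd].
move=> x t s s0 st /=.
pose F tau := T (posp (t - tau)) (K (perturbed T K (tau - s) x)).
have Fc : continuous F.
  apply: (volterra_integrand_continuous T_semigroup M1 w0 TM Kk) => tau.
  apply: (@cvg_comp _ _ _ (fun tau => tau - s) (fun t => perturbed T K t x)); last first.
    exact: (perturbed_continuous T_semigroup M1 w0 TM k0 Kk).
  by apply: cvgB; [exact: cvg_id|exact: cvg_cst].
have FI : is_bochner_integral `[s, t] (fun tau => T (t - tau) (B (D (C (W tau s x)))))
    (riemann_integral F s t).
  apply: is_bochner_integral_ae (is_bochner_riemann Fc st); apply: nearW => tau.
  rewrite /= in_itv/= => /andP[_ taut].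
  by rewrite /F pospE ?subr_ge0// KE WE.
split; first by exists (riemann_integral F s t).
rewrite (bochner_integralE _ _ FI)//; last exact: mu_segment_fin.
rewrite WE (perturbed_eq T_semigroup M1 w0 TM k0 Kk) /volterra pospE ?subr_ge0//.
congr (_ + _); have := riemann_integral_shift F 0 (t - s) s.
rewrite add0r subrK => <-.
apply: (congr1 (fun G => riemann_integral G 0 (t - s))); apply/funext => sg.
by rewrite /F addrK (addrC sg) opprD addrA.
Qed.

End constant_feedback.

Lemma Lp_opnorm_ge0 {R : realType} {V W : completeNormedModType R[i]} (p : R)
  (F : (R -> V) -> (R -> W)) : 1 <= p -> (0 <= Lp_opnorm p F)%E.
Proof.
move=> p1; apply: (@le_trans _ _ (Lpnorm p (F (fun=> 0)))); first exact: Lnorm_ge0.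
apply: ereal_sup_ubound; exists (fun=> 0) => //; split; first exact: strongly_measurable_cst.
apply/Lpnorm_le => //.
rewrite rnorm0 powR0 ?gt_eqF ?(lt_le_trans ltr01)//.
by rewrite integral0 lee_fin powR_ge0.
Qed.

Section upper_bound.
Context {R : realType} {X U Y : completeNormedModType R[i]}.
Variables (T : R -> {linear X -> X}) (DA : set X) (A : X -> X).
Variables (B : {linear U -> X}) (C : {linear X -> Y}).
Hypothesis T_semigroup : C0_semigroup T.
Hypothesis T_generator : is_generator T DA A.
Hypothesis T_stable : exp_stable_semigroup T.
Hypothesis B_bounded : continuous B.
Hypothesis C_bounded : continuous C.

Lemma exp_stable_semigroupP : exists M w : R, [/\ 1 <= M, w < 0 &
  forall t x, 0 <= t -> rnorm (T t x) <= M * expR (w * t) * rnorm x].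
Proof.
have [M [w [M1 w0 TM]]] := T_stable; exists M, w; split=> // t x t0.
have K0 : 0 <= M * expR (w * t) by rewrite mulr_ge0 ?expR_ge0// (le_trans ler01).
by have /(opnorm_le _ K0) := TM t t0.
Qed.

Lemma transfer_le (r om : R) (u : U) : 0 <= r ->
  (forall Delta, Linf_s Delta -> (Linfnorm Delta <= r%:E)%E ->
    forall W, perturbed_family T B C Delta W -> exp_stable_family W) ->
  rnorm u <= 1 ->
  r * rnorm (C (inv_shift DA A (Complex 0 om) (B u))) <= 1.
Proof.
move=> r0 rW u1; rewrite leNgt; apply/negP; rewrite /inv_shift.
(* If [B u] has no preimage under [A - i om], [inv_shift] takes its default value 0 and the bound is
   trivial. *)
case: xgetP => [x _ [xA Ax]|_]; last by rewrite linear0 rnorm0 mulr0 ltr10.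
set y := C x => ry.
have y0 : 0 < rnorm y.
  by rewrite lt_neqAle rnorm_ge0 andbT; apply: contraTneq ry => <-; rewrite mulr0 ltr10.
have x0 : 0 < rnorm x.
  rewrite lt_neqAle rnorm_ge0 andbT eq_sym; apply: contraTneq y0 => /rnorm_eq0 E.
  by rewrite /y E linear0 rnorm0 ltxx.
have [phi [phil phile phiy]] := hahn_banach y.
(* This rank-one feedback has norm at most [(rnorm y)^-1], which is below [r] because [ry] says
   [1 < r * rnorm y]. *)
have [D DE] : exists D : {linear Y -> U},
    D =1 fun z => (- (rnorm y)^-1)%:C *: (phi z *: u).
  apply: exists_linear => a z z'; rewrite phil scalerDl scalerDr !scalerA.
  by rewrite mulrCA.
have Dr z : rnorm (D z) <= r * rnorm z.
  rewrite DE rnormZr rnormZ normrN ger0_norm ?invr_ge0 ?rnorm_ge0// ler_pM//.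
  - by rewrite invr_ge0 ltW.
  - by rewrite mulr_ge0 ?rnorm_ge0//; exact: (@rnorm_ge0 R R[i]^o (phi z)).
  - by rewrite -div1r ler_pdivrMr// ltW.
  - by rewrite (le_trans _ (phile z))// ler_piMr//; exact: (@rnorm_ge0 R R[i]^o (phi z)).
have Dy : D y = - u.
  have e : (- (rnorm y)^-1)%:C * (rnorm y)%:C = -1 :> R[i].
    by rewrite -[LHS]rmorphM mulNr mulVf ?gt_eqF// rmorphN1.
  by rewrite DE phiy scalerA e scaleN1r.
have [M [w [M1 w0 TM]]] := exp_stable_semigroupP.
have [b b0 Bb] := linear_rnorm_bounded B_bounded.
have [c c0 Cc] := linear_rnorm_bounded C_bounded.
have r1 : 0 < r by rewrite -(pmulr_lgt0 _ y0) (lt_trans ltr01).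
have [K KE] : exists K : {linear X -> X}, forall z, K z = B (D (C z)).
  by exists (B \o (D \o C)).
have k0 : 0 < b * (r * c) by rewrite !mulr_gt0.
have Kk z : rnorm (K z) <= b * (r * c) * rnorm z.
  rewrite KE -!mulrA (le_trans (Bb _)) ?ler_pM2l//.
  by rewrite (le_trans (Dr _)) ?ler_pM2l.
have w0' := ltW w0.
have /choice[S SE] t : exists S : {linear X -> X}, S =1 perturbed T K t.
  exact/exists_linear/(perturbed_linear T_semigroup M1 w0' TM k0 Kk).
pose W (t s : R) := S (t - s).
have D_Linf : (Linfnorm (fun _ : R => (D : Y -> U)) <= r%:E)%E by exact: Linfnorm_cst_le.
have Wp : perturbed_family T B C (fun=> D) W.
  apply: (perturbed_family_cst T_semigroup M1 w0' TM k0 Kk KE) => t s z.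
  exact: SE.
have [|M' [w' [M1' w0'' WM]]] := rW (fun=> D) _ D_Linf W Wp.
  split=> [t _|z|].
  - exact: linear_rnorm_continuous Dr.
  - exact: strongly_measurable_cst.
  - exact: le_lt_trans D_Linf (ltry _).
have xE t : 0 <= t -> rnorm (W t 0 x) = rnorm x.
  move=> t0; rewrite /W subr0 SE.
  rewrite (perturbed_eigenvector T_semigroup M1 w0' TM k0 Kk (Ax := A x) (om := om))//.
  - by rewrite rnormZ norm_cexp mul1r.
  - by case: T_generator => _; apply.
  - by rewrite KE -/y Dy linearN -Ax opprB.
(* A time with [M' * expR (w' * t) < 1] contradicts the constant norm of the orbit. Here the
   exponent is [- M'], and [M' < 1 + M' <= expR M']. *)
pose t := M' / - w'.
have t0 : 0 <= t by rewrite divr_ge0 ?oppr_ge0 ?(ltW w0'')// (le_trans ler01).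
have : rnorm (W t 0 x) <= M' * expR (w' * t) * rnorm x.
  rewrite -{2}(subr0 t).
  have K0 : 0 <= M' * expR (w' * (t - 0)) by rewrite mulr_ge0 ?expR_ge0// (le_trans ler01).
  by have /(opnorm_le _ K0) := WM t 0 (lexx 0) t0.
rewrite xE// -{1}(mul1r (rnorm x)) ler_pM2r// leNgt => /negP; apply.
have -> : w' * t = - M' by rewrite /t; field; rewrite lt_eqF.
rewrite expRN ltr_pdivrMr ?expR_gt0// mul1r.
by rewrite (lt_le_trans _ (expR_ge1Dx _))// ltrDr.
Qed.

End upper_bound.

Section main.
Context {R : realType} {X U Y : completeNormedModType R[i]}.
Variables (T : R -> {linear X -> X}) (DA : set X) (A : X -> X).
Variables (B : {linear U -> X}) (C : {linear X -> Y}).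
Hypothesis T_semigroup : C0_semigroup T.
Hypothesis T_generator : is_generator T DA A.
Hypothesis T_stable : exp_stable_semigroup T.
Hypothesis B_bounded : continuous B.
Hypothesis C_bounded : continuous C.

Lemma r_stab_ge (p : R) : 1 <= p ->
  ((Lp_opnorm p (io_operator T B C))^-1 <= r_stab T B C)%E.
Proof.
move=> p1.
have [M [w [M1 w0 TM]]] := exp_stable_semigroupP T_stable.
have [b b0 Bb] := linear_rnorm_bounded B_bounded.
have [c c0 Cc] := linear_rnorm_bounded C_bounded.
have r_le r : 0 <= r -> (forall Delta, Linf_s Delta -> (Linfnorm Delta <= r%:E)%E ->
    forall W, perturbed_family T B C Delta W -> exp_stable_family W) ->
    (r%:E <= r_stab T B C)%E.
  by move=> r0 rW; apply: ereal_sup_ubound; exists r.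
have L0 := Lp_opnorm_ge0 (io_operator T B C) p1.
case L : (Lp_opnorm p (io_operator T B C)) L0 => [l||]//; last first.
  move=> _; rewrite invey; apply: r_le => // Delta _ Dr W Wp.
  exact: (exp_stable_of_zero M1 w0 TM b0 Bb C_bounded (lexx 0) Dr Wp).
rewrite lee_fin => l0.
have small r : 0 <= r -> r * l < 1 -> (r%:E <= r_stab T B C)%E.
  move=> r0 rl; apply: r_le => // Delta DL Dr W Wp.
  apply: (exp_stable_of_gain T_semigroup M1 w0 TM b0 Bb C_bounded c0 Cc r0 DL Dr Wp p1 l0 _ rl).
  by rewrite L.
rewrite inver; case: ifPn => [/eqP l_eq0|l_neq0].
  (* Zero gain: the inverse is infinite, and every real [r >= 0] is an admissible radius. *)
  rewrite -ereal_sup_real; apply: ge_ereal_sup => _ [r _ <-].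
  have [r0|/ltW r0] := leP 0 r; first by rewrite small// l_eq0 mulr0 ltr01.
  by rewrite (le_trans _ (small 0 _ _)) ?lee_fin// mul0r ltr01.
have lp : 0 < l by rewrite lt_neqAle eq_sym l_neq0.
(* The radii [l^-1 - e] are admissible; when such a number is negative, the radius 0 already
   suffices. *)
apply/lee_subgt0Pr => e e0; rewrite -EFinB.
have [r0|/ltW r0] := leP 0 (l^-1 - e).
  by rewrite small// mulrBl mulVf// ltrBlDr ltrDl mulr_gt0.
by rewrite (le_trans _ (small 0 _ _)) ?lee_fin// mul0r ltr01.
Qed.

Lemma r_stab_le : (r_stab T B C <=
    (ereal_sup [set opnorm (fun u => C (inv_shift DA A (Complex 0%R s) (B u)))
                | s in [set: R]])^-1)%E.
Proof.
apply: ge_ereal_sup => _ [r [r0 rW] <-].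
(* Both sides are nonnegative, as the input 0 at frequency 0 shows for the supremum, so the claim
   becomes the upper bound [r^-1] of the supremum, which is infinite for [r = 0]. *)
rewrite inve_pge ?inE ?lee_fin//; last first.
  apply: (@le_trans _ _ (opnorm (fun u => C (inv_shift DA A (Complex 0 0) (B u))))).
    apply: (@le_trans _ _ (rnorm (C (inv_shift DA A (Complex 0 0) (B 0))))%:E).
      by rewrite lee_fin rnorm_ge0.
    by apply: ereal_sup_ubound; exists 0 => //=; rewrite rnorm0.
  by apply: ereal_sup_ubound; exists 0.
move: r0; rewrite le_eqVlt => /predU1P[E|r_gt0]; first by rewrite -E inve0 leey.
apply: ge_ereal_sup => _ [s _ <-]; apply: ge_ereal_sup => _ [u u1 <-].
rewrite inver gt_eqF// lee_fin -[leRHS]div1r ler_pdivlMr// mulrC.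
exact: (transfer_le T_semigroup T_generator T_stable B_bounded C_bounded _ (ltW r_gt0) rW u1).
Qed.

End main.

Theorem theorem4p1 (R : realType) (X U Y : completeNormedModType R[i])
  (T : R -> {linear X -> X}) (DA : set X) (A : X -> X)
  (B : {linear U -> X}) (C : {linear X -> Y})
  (T_semigroup : C0_semigroup T)
  (T_generator : is_generator T DA A)
  (T_stable : exp_stable_semigroup T)
  (B_bounded : continuous B) (C_bounded : continuous C)
  (p : R) (p_ge1 : 1 <= p) :
  ((Lp_opnorm p (io_operator T B C))^-1 <= r_stab T B C)%E /\
  (r_stab T B C <=
    (ereal_sup [set opnorm (fun u => C (inv_shift DA A (Complex 0%R s) (B u)))
                | s in [set: R]])^-1)%E.
Proof.
split; first exact: (r_stab_ge T_semigroup T_stable B_bounded C_bounded p_ge1).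
exact: (r_stab_le T_semigroup T_generator T_stable B_bounded C_bounded).
Qed.
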